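(* Let $k$ be a field of characteristic zero, $m,n\in\mathbb{N}^*\setminus\{1\}$, $d=(m,n)$, $q\in P_m(k)$, $\overline{q}\in P_n(k)$. \begin{enumerate} \item If $n\neq m$, or $m=n$ and $\overline{q}\neq q$, then for $\sigma,\sigma'\in U_d(k)$ there is a Hopf algebra isomorphism $\mathrm{T}^{\sigma}_{n,m}(\overline{q},q)\cong \mathrm{T}^{\sigma'}_{n,m}(\overline{q},q)$ if and only if $\sigma=\sigma'$. \item If $m=n$ and $\overline{q}=q$, then for $\sigma,\sigma'\in U_n(k)$ there is a Hopf algebra isomorphism $\mathrm{T}^{\sigma}_{n,n}(q,q)\cong \mathrm{T}^{\sigma'}_{n,n}(q,q)$ if and only if $\sigma'=\sigma$ or $\sigma'=\sigma^{-1}$. \item For $m=n$ and every $\alpha\in k^*$ there is a Hopf algebra isomorphism $\mathrm{Q}^{\alpha}_n(q)\cong \mathrm{Q}^{1}_n(q)$; moreover $\mathrm{Q}^1_n(q)$ is isomorphic to the Drinfel'd double $D(T_{n^2}(q))$. \item For $m=n$, $\mathrm{Q}^1_n(q)$ is not isomorphic as a Hopf algebra to any of the Hopf algebras $\mathrm{T}^{\sigma}_{n,n}(q^{n-1},q)$, $\sigma\in U_n(k)$. \end{enumerate}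
   Context: $U_n(k)=\{\omega\in k:\omega^n=1\}$, $P_n(k)$ is the set of primitive $n$-th roots of unity in $k$, $(m,n)$ is the gcd. $T_{m^2}(q)$ is the Taft algebra generated by $h,x$ with $h^m=1$, $x^m=0$, $xh=qhx$, $h$ group-like, $\Delta(x)=x\otimes h+1\otimes x$, $S(h)=h^{-1}$, $S(x)=-xh^{-1}$. For $\sigma\in U_d(k)$, $\mathrm{T}^{\sigma}_{n,m}(\overline{q},q)$ is the Hopf algebra generated by $h,x,H,X$ with relations $h^m=H^n=1$, $x^m=X^n=0$, $xh=qhx$, $XH=\overline{q}HX$, $xH=\sigma Hx$, $hX=\sigma Xh$, $xX=\sigma Xx$, $hH=Hh$, where $h,H$ are group-like, $\Delta(x)=x\otimes h+1\otimes x$, $\Delta(X)=X\otimes H+1\otimes X$, with antipode $S(h)=h^{m-1}$, $S(H)=H^{n-1}$, $S(x)=-q^{m-1}h^{m-1}x$, $S(X)=-\overline{q}^{\,n-1}H^{n-1}X$. For $q\in P_n(k)$ and $\alpha\in k^*$, $\mathrm{Q}^{\alpha}_n(q)$ is the Hopf algebra generated by $h,x,H,X$ with relations $h^n=H^n=1$, $x^n=X^n=0$, $xh=qhx$, $XH=q^{n-1}HX$, $xH=qHx$, $hX=qXh$, $xX-qXx=\alpha(1-Hh)$, $hH=Hh$, with $h,H$ group-like, $\Delta(x)=x\otimes h+1\otimes x$, $\Delta(X)=X\otimes H+1\otimes X$, and antipode $S(h)=h^{n-1}$, $S(H)=H^{n-1}$, $S(x)=-q^{n-1}h^{n-1}x$,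 $S(X)=-qH^{n-1}X$. *)

(* Defs.v *)
(* Finite-dimensional Hopf algebras over a field k are
   encoded by structure constants with respect to a basis indexed by a
   finite type I; presented Hopf algebras are characterized by their
   universal property. *)
From HB Require Import structures.
From mathcomp Require Import all_boot all_order all_algebra.
Set Implicit Arguments.
Unset Strict Implicit.
Unset Printing Implicit Defensive.
Import Order.TTheory GRing.Theory Num.Theory.
Local Open Scope ring_scope.

Section Hopf.
Variable k : fieldType.

(* Bialgebra data on the vector space k^I with basis (e_i)_{i in I}:
   e_i e_j = sum_l mulc i j l e_l,   1 = sum_l unitc l e_l,
   Delta(e_i) = sum_{a,b} comulc i a b e_a (x) e_b,  eps(e_i) = counitc i. *)
Record bialg (I : finType) := Bialg {
  mulc : I -> I -> I -> k;
  unitc : I -> k;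
  comulc : I -> I -> I -> k;
  counitc : I -> k }.

Definition fsc (T : finType) (c : k) (u : {ffun T -> k}) : {ffun T -> k} :=
  [ffun i => c * u i].

Section Ops.
Variables (I : finType) (A : bialg I).

Definition vec := {ffun I -> k}.
Definition tensor := {ffun I * I -> k}.
Definition bvec (i : I) : vec := [ffun j => (i == j)%:R].

Definition amul (u v : vec) : vec :=
  [ffun l => \sum_i \sum_j u i * v j * mulc A i j l].
Definition aone : vec := [ffun l => unitc A l].
Definition comul (v : vec) : tensor :=
  [ffun p => \sum_i v i * comulc A i p.1 p.2].
Definition counit (v : vec) : k := \sum_i v i * counitc A i.
Definition tens (u v : vec) : tensor := [ffun p => u p.1 * v p.2].
Definition tmul (s t : tensor) : tensor :=
  [ffun p => \sum_a \sum_b \sum_c \sum_d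
     s (a, b) * t (c, d) * mulc A a c p.1 * mulc A b d p.2].

Definition Smap (S : I -> I -> k) (v : vec) : vec :=
  [ffun l => \sum_i v i * S i l].
Definition is_antipode (S : I -> I -> k) : Prop :=
  forall i : I,
    \sum_a \sum_b fsc (comulc A i a b) (amul (Smap S (bvec a)) (bvec b))
      = fsc (counitc A i) aone /\
    \sum_a \sum_b fsc (comulc A i a b) (amul (bvec a) (Smap S (bvec b)))
      = fsc (counitc A i) aone.

Definition isHopf : Prop :=
  (forall u v w, amul (amul u v) w = amul u (amul v w)) /\
  (forall u, amul aone u = u /\ amul u aone = u) /\
  (forall i x y z, \sum_a comulc A i a z * comulc A a x y
                   = \sum_b comulc A i x b * comulc A b y z) /\
  (forall i b, \sum_a counitc A a * comulc A i a b = (i == b)%:R) /\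
  (forall i a, \sum_b comulc A i a b * counitc A b = (i == a)%:R) /\
  (forall u v, comul (amul u v) = tmul (comul u) (comul v)) /\
  comul aone = tens aone aone /\
  (forall u v, counit (amul u v) = counit u * counit v) /\
  counit aone = 1 /\
  (exists S, is_antipode S).

Definition generates (gens : seq vec) : Prop :=
  forall P : vec -> Prop,
    P aone ->
    (forall u v, P u -> P v -> P (u + v)) ->
    (forall c u, P u -> P (fsc c u)) ->
    (forall g u, g \in gens -> P u -> P (amul g u)) ->
    forall u, P u.
End Ops.

(* Signature of a k-algebra, used to state defining relations uniformly *)
Record ksig := KSig {
  car :> Type;
  sadd : car -> car -> car;
  smul : car -> car -> car;
  ssc : k -> car -> car;
  sone : car;
  szero : car }.

Definition vsig (I : finType) (A : bialg I) : ksig :=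
  @KSig (vec I) +%R (@amul I A) (@fsc I) (aone A) 0.
Definition asig (B : algType k) : ksig :=
  @KSig B +%R *%R *:%R 1 0.

Definition spow (S : ksig) (v : S) (e : nat) : S := iter e (smul v) (sone S).

Definition presents (I : finType) (A : bialg I) (gens : seq (vec I))
    (rels : forall S : ksig, seq S -> Prop) : Prop :=
  [/\ rels (vsig A) gens,
      generates A gens &
      forall (B : algType k) (bs : seq B), size bs = size gens ->
        rels (asig B) bs ->
        exists f : vec I -> B,
          [/\ (forall u v, f (u + v) = f u + f v),
              (forall c u, f (fsc c u) = c *: f u),
              (forall u v, f (amul A u v) = f u * f v),
              f (aone A) = 1 &
              map f gens = bs]].

Definition T_rels (n m : nat) (qb q s : k) (S : ksig) (gs : seq S) : Prop :=
  match gs with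
  | [:: h; x; H; X] =>
    spow h m = sone S /\ spow H n = sone S /\
    spow x m = szero S /\ spow X n = szero S /\
    smul x h = ssc q (smul h x) /\
    smul X H = ssc qb (smul H X) /\
    smul x H = ssc s (smul H x) /\
    smul h X = ssc s (smul X h) /\
    smul x X = ssc s (smul X x) /\
    smul h H = smul H h
  | _ => False
  end.

Definition Q_rels (n : nat) (q alpha : k) (S : ksig) (gs : seq S) : Prop :=
  match gs with
  | [:: h; x; H; X] =>
    spow h n = sone S /\ spow H n = sone S /\
    spow x n = szero S /\ spow X n = szero S /\
    smul x h = ssc q (smul h x) /\
    smul X H = ssc (q ^+ n.-1) (smul H X) /\
    smul x H = ssc q (smul H x) /\
    smul h X = ssc q (smul X h) /\
    (* x X - q X x = alpha (1 - H h) *)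
    smul x X = sadd (ssc q (smul X x))
                    (sadd (ssc alpha (sone S)) (ssc (- alpha) (smul H h))) /\
    smul h H = smul H h
  | _ => False
  end.

Definition Taft_rels (m : nat) (q : k) (S : ksig) (gs : seq S) : Prop :=
  match gs with
  | [:: h; x] =>
    [/\ spow h m = sone S, spow x m = szero S & smul x h = ssc q (smul h x)]
  | _ => False
  end.

Section Models.
Variables (I : finType) (A : bialg I).

Definition is_T (n m : nat) (qb q s : k) : Prop :=
  isHopf A /\
  exists h x H X : vec I,
    [/\ presents A [:: h; x; H; X] (T_rels n m qb q s),
        comul A h = tens h h, comul A H = tens H H,
        comul A x = tens x h + tens (aone A) x &
        comul A X = tens X H + tens (aone A) X].

Definition is_Q (n : nat) (q alpha : k) : Prop :=
  isHopf A /\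
  exists h x H X : vec I,
    [/\ presents A [:: h; x; H; X] (Q_rels n q alpha),
        comul A h = tens h h, comul A H = tens H H,
        comul A x = tens x h + tens (aone A) x &
        comul A X = tens X H + tens (aone A) X].

Definition is_Taft (m : nat) (q : k) : Prop :=
  isHopf A /\
  exists h x : vec I,
    [/\ presents A [:: h; x] (Taft_rels m q),
        comul A h = tens h h &
        comul A x = tens x h + tens (aone A) x].
End Models.

(* Drinfel'd double D(H) = H^{*cop} (x) H (Kassel, Def. IX.4.1), on the basis
   e^i (x) e_j (index (i, j)), where (e^i) is the dual basis of (e_j).
   Product: (f (x) a)(g (x) b) = sum f g(S^{-1}(a''') ? a') (x) a'' b.
   Sb is the coordinate matrix of the inverse antipode S^{-1} of H. *)
Definition DD (I : finType) (H : bialg I) (Sb : I -> I -> k) : bialg (I * I)%type :=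
  @Bialg (I * I)%type
    (fun ij pr lw =>
       \sum_a \sum_b \sum_c \sum_t
         comulc H ij.2 t c * comulc H t a b *
         (\sum_s (\sum_u Sb c u * \sum_v mulc H u s v * mulc H v a pr.1)
                  * comulc H lw.1 ij.1 s) *
         mulc H b pr.2 lw.2)
    (fun ij => counitc H ij.1 * unitc H ij.2)
    (fun ij ya xb => mulc H xb.1 ya.1 ij.1 * comulc H ij.2 ya.2 xb.2)
    (fun ij => unitc H ij.1 * counitc H ij.2).

Definition tmapf (I J : finType) (f : vec I -> vec J) (t : tensor I)
  : tensor J :=
  \sum_(p : (I * I)%type) fsc (t p) (tens (f (bvec p.1)) (f (bvec p.2))).

Definition HopfIso (I J : finType) (A : bialg I) (B : bialg J) : Prop :=
  exists f : vec I -> vec J,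
    bijective f /\
    (forall u v, f (u + v) = f u + f v) /\
    (forall c u, f (fsc c u) = fsc c (f u)) /\
    (forall u v, f (amul A u v) = amul B (f u) (f v)) /\
    f (aone A) = aone B /\
    (forall u, comul B (f u) = tmapf f (comul A u)) /\
    (forall u, counit B (f u) = counit A u).

End Hopf.

(* Main.v *)
(** Distinguishing the algebras.  In T^sigma, the (1,2) entries of the two
    triangular two-dimensional representations in which x, resp. X, acts as the
    matrix unit E12 give operators D u = u' xi(u'') on the algebra, acting on
    w x^l, resp. w X^l, as q-derivatives.  Hence the joint kernel of the two
    operators is the span K of the products of h and H, group-like elements lie
    in K, and a nonzero y with Delta y = y (x) g + 1 (x) y and y g = p g y, p <> 1,
    is a multiple of x (with g = h, p = q) or of X (with g = H, p = qb).  So a Hopf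
    isomorphism either fixes or swaps the pairs (h, x) and (H, X) up to scalars,
    and the commutation relations determine sigma up to inversion.  Under an
    isomorphism from Q^1, the element 1 - H h would be a multiple of X x, which
    dies in a one-dimensional representation with H h <> 1.

    The double.  In D(T) the characters and skew-derivations of T given by
    chi(h) = 1/q, xi(x) = -1/q play the roles of H and X; they satisfy the
    relations of Q^1 and chi^i xi^j is, up to a discrete Fourier transform in i,
    the basis dual to h^a x^b.  The resulting map from Q^1 to D(T) is onto, and
    bijective since Q^1 is spanned by n^4 monomials. *)
Require Import Defs.
From HB Require Import structures.
From mathcomp Require Import all_boot all_order all_algebra.
Set Implicit Arguments.
Unset Strict Implicit.
Unset Printing Implicit Defensive.
Import GRing.Theory.
Local Open Scope ring_scope.

(** A presentation yields maps out of an algebra and spanning sets, but no linear independence. For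
    T^sigma and Q no basis is ever exhibited: nonvanishing and distinctness of elements are read off
    two-by-two matrix representations, and the kernel arguments only use that an expansion in powers
    of [x] or [X] exists, not that its coefficients are unique. The universal property of Q^1 maps
    only into associative unital algebras, and coproducts may be compared on generators only when
    both are multiplicative. Since [DD] is given by bare structure constants, these laws must be
    derived for it. Reading f (x) a as z |-> f(z) a makes this tractable: associativity becomes two
    identities for moving an element of T past a functional, and multiplicativity of the coproduct
    becomes a single cancellation b' S^-1(b) = eps between neighbouring legs. *)

Section Linear.
Variable k : fieldType.

(** Linearity is a predicate on plain functions because the maps below are lambda terms built from
    nested contractions; the tactic [lin] discharges it. Forms get their own predicate, since their
    values lie in the field [k] and not in the module [k^o]. *)
Definition lin (U V : lmodType k) (f : U -> V) : Prop :=
  forall c u v, f (c *: u + v) = c *: f u + f v.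
Definition linf (U : lmodType k) (f : U -> k) : Prop :=
  forall c u v, f (c *: u + v) = c * f u + f v.

Variables U V W : lmodType k.

Lemma lin0 (f : U -> V) : lin f -> f 0 = 0.
Proof.
by move=> lf; have := lf (-1) 0 0; rewrite !scaleN1r oppr0 addr0 addNr.
Qed.

Lemma linD (f : U -> V) : lin f -> {morph f : u v / u + v}.
Proof. by move=> lf u v; have := lf 1 u v; rewrite !scale1r. Qed.

Lemma linZ (f : U -> V) : lin f -> forall c u, f (c *: u) = c *: f u.
Proof. by move=> lf c u; have := lf c u 0; rewrite !addr0 (lin0 lf) addr0. Qed.

Lemma linN (f : U -> V) : lin f -> {morph f : u / - u}.
Proof. by move=> lf u; rewrite -scaleN1r linZ // scaleN1r. Qed.

Lemma linB (f : U -> V) : lin f -> {morph f : u v / u - v}.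
Proof. by move=> lf u v; rewrite linD // linN. Qed.

Lemma lin_sum (f : U -> V) (T : Type) (r : seq T) (P : pred T) F :
  lin f -> f (\sum_(i <- r | P i) F i) = \sum_(i <- r | P i) f (F i).
Proof. by move=> lf; apply: big_morph; [exact: linD | exact: lin0]. Qed.

Lemma lin_id : lin (fun u : U => u). Proof. by []. Qed.

Lemma lin_cst0 : lin (fun _ : U => 0 : V).
Proof. by move=> c u v; rewrite scaler0 addr0. Qed.

Lemma lin_comp (g : V -> W) (f : U -> V) :
  lin g -> lin f -> lin (fun u => g (f u)).
Proof. by move=> lg lf c u v; rewrite lf lg. Qed.

Lemma lin_scale (f : U -> V) c : lin f -> lin (fun u => c *: f u).
Proof. by move=> lf a u v; rewrite lf scalerDr !scalerA mulrC. Qed.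

Lemma lin_add (f g : U -> V) : lin f -> lin g -> lin (fun u => f u + g u).
Proof. by move=> lf lg a u v; rewrite lf lg scalerDr addrACA. Qed.

Lemma lin_opp (f : U -> V) : lin f -> lin (fun u => - f u).
Proof. by move=> lf a u v; rewrite lf opprD scalerN. Qed.

Lemma lin_scalef (f : U -> k) (v : V) : linf f -> lin (fun u => f u *: v).
Proof. by move=> lf a u w; rewrite lf scalerDl scalerA. Qed.

Lemma linf_comp (g : V -> k) (f : U -> V) :
  linf g -> lin f -> linf (fun u => g (f u)).
Proof. by move=> lg lf c u v; rewrite lf lg. Qed.

Lemma linf_mull (f : U -> k) c : linf f -> linf (fun u => c * f u).
Proof. by move=> lf a u v; rewrite lf mulrDr mulrCA. Qed.

Lemma linf_mulr (f : U -> k) c : linf f -> linf (fun u => f u * c).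
Proof. by move=> lf a u v; rewrite lf mulrDl mulrA. Qed.

Lemma linf0 (f : U -> k) : linf f -> f 0 = 0.
Proof.
by move=> lf; have := lf (-1) 0 0; rewrite !scaleN1r oppr0 addr0 mulN1r addNr.
Qed.

Lemma linfD (f : U -> k) : linf f -> {morph f : u v / u + v}.
Proof. by move=> lf u v; have := lf 1 u v; rewrite !scale1r mul1r. Qed.

Lemma linfZ (f : U -> k) : linf f -> forall c u, f (c *: u) = c * f u.
Proof. by move=> lf c u; have := lf c u 0; rewrite !addr0 (linf0 lf) addr0. Qed.

Lemma linf_sum (f : U -> k) (T : Type) (r : seq T) (P : pred T) F :
  linf f -> f (\sum_(i <- r | P i) F i) = \sum_(i <- r | P i) f (F i).
Proof. by move=> lf; apply: big_morph; [exact: linfD | exact: linf0]. Qed.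

Lemma lin_sumf (T : Type) (r : seq T) (P : pred T) (F : T -> U -> V) :
  (forall i, lin (F i)) -> lin (fun u => \sum_(i <- r | P i) F i u).
Proof.
move=> lF c u v; rewrite scaler_sumr -big_split /=.
by apply: eq_bigr => i _; apply: lF.
Qed.
End Linear.

Section LinearAlg.
Variables (k : fieldType) (U : lmodType k) (B : algType k).
Lemma lin_mull (f : U -> B) a : lin f -> lin (fun u => a * f u).
Proof. by move=> lf c u v; rewrite lf mulrDr scalerAr. Qed.
Lemma lin_mulr (f : U -> B) a : lin f -> lin (fun u => f u * a).
Proof. by move=> lf c u v; rewrite lf mulrDl scalerAl. Qed.
End LinearAlg.

Section Vec.
Variables (k : fieldType) (I : finType).
Implicit Types u v : vec k I.

Lemma vec_basis u : u = \sum_i fsc (u i) (bvec k i).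
Proof.
apply/ffunP=> j; rewrite sum_ffunE (bigD1 j) //= !ffunE eqxx mulr1.
by rewrite big1 ?addr0 // => i /negbTE ij; rewrite !ffunE ij mulr0.
Qed.
End Vec.

(** * Sweedler calculus *)

(* Everything but coassociativity, the counit laws and the antipode: the
   Drinfel'd double is used through this structure only. *)
Record bialgebra (k : fieldType) (I : finType) := Bialgebra {
  bdata :> bialg k I;
  bmulA : forall u v w, amul bdata (amul bdata u v) w = amul bdata u (amul bdata v w);
  bmul1 : forall u, amul bdata (aone bdata) u = u /\ amul bdata u (aone bdata) = u;
  bcomulM : forall u v, comul bdata (amul bdata u v) = tmul bdata (comul bdata u) (comul bdata v);
  bcomul1 : comul bdata (aone bdata) = tens (aone bdata) (aone bdata);
  bcounitM : forall u v, counit bdata (amul bdata u v) = counit bdata u * counit bdata v;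
  bcounit1 : counit bdata (aone bdata) = 1 }.

(** The product depends on [A], so [vec k I] cannot carry it canonically; this alias, convertible to
    [vec k I], is where the algebra structure of [A] is attached. *)
Definition halg (k : fieldType) (I : finType) (A : bialgebra k I) : Type := vec k I.

Section HalgInstances.
Variables (k : fieldType) (I : finType) (A : bialgebra k I).
HB.instance Definition _ := GRing.Zmodule.copy (halg A) (vec k I).

Fact halg_scaleA (a b : k) (v : halg A) : fsc a (fsc b v) = fsc (a * b) v.
Proof. by apply/ffunP=> i; rewrite !ffunE mulrA. Qed.
Fact halg_scale1 : left_id 1 (@fsc k I : k -> halg A -> halg A).
Proof. by move=> v; apply/ffunP=> i; rewrite !ffunE mul1r. Qed.
Fact halg_scaleDr : right_distributive (@fsc k I : k -> halg A -> halg A) +%R.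
Proof. by move=> a u v; apply/ffunP=> i; rewrite !ffunE mulrDr. Qed.
Fact halg_scaleDl (v : halg A) : {morph (fun a : k => fsc a v : halg A) : a b / a + b}.
Proof. by move=> a b; apply/ffunP=> i; rewrite !ffunE mulrDl. Qed.
HB.instance Definition _ := GRing.Zmodule_isLmodule.Build k (halg A)
  halg_scaleA halg_scale1 halg_scaleDr halg_scaleDl.

Fact halg_mulDl : left_distributive (amul A : halg A -> halg A -> halg A) +%R.
Proof.
move=> u v w; apply/ffunP=> l; rewrite !ffunE -big_split; apply: eq_bigr => i _ /=.
by rewrite -big_split; apply: eq_bigr => j _ /=; rewrite !ffunE !mulrDl.
Qed.
Fact halg_mulDr : right_distributive (amul A : halg A -> halg A -> halg A) +%R.
Proof.
move=> u v w; apply/ffunP=> l; rewrite !ffunE -big_split; apply: eq_bigr => i _ /=.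
by rewrite -big_split; apply: eq_bigr => j _ /=; rewrite !ffunE mulrDr mulrDl.
Qed.
Fact halg_mul1 : left_id (aone A) (amul A : halg A -> halg A -> halg A).
Proof. by move=> u; case: (bmul1 A u). Qed.
Fact halg_mulr1 : right_id (aone A) (amul A : halg A -> halg A -> halg A).
Proof. by move=> u; case: (bmul1 A u). Qed.
Fact halg_one_neq0 : (aone A : halg A) != 0.
Proof.
apply/eqP=> e; have := bcounit1 A; rewrite e /counit big1 => [/eqP|i _].
  by rewrite eq_sym oner_eq0.
by rewrite ffunE mul0r.
Qed.
Fact halg_mulA : associative (amul A : halg A -> halg A -> halg A).
Proof. by move=> u v w; rewrite bmulA. Qed.
HB.instance Definition _ := GRing.Zmodule_isNzRing.Build (halg A)
  halg_mulA halg_mul1 halg_mulr1 halg_mulDl halg_mulDr halg_one_neq0.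
Fact halg_scaleAl (c : k) (u v : halg A) : c *: (u * v) = (c *: u) * v.
Proof.
apply/ffunP=> l; rewrite !ffunE mulr_sumr; apply: eq_bigr => i _.
by rewrite mulr_sumr; apply: eq_bigr => j _; rewrite ffunE !mulrA.
Qed.
HB.instance Definition _ := GRing.Lmodule_isLalgebra.Build k (halg A) halg_scaleAl.
Fact halg_scaleAr (c : k) (u v : halg A) : c *: (u * v) = u * (c *: v).
Proof.
apply/ffunP=> l; rewrite !ffunE mulr_sumr; apply: eq_bigr => i _.
by rewrite mulr_sumr; apply: eq_bigr => j _; rewrite ffunE !mulrA [c * _]mulrC.
Qed.
HB.instance Definition _ := GRing.Lalgebra_isAlgebra.Build k (halg A) halg_scaleAr.

Definition ebas (i : I) : halg A := bvec k i.

Lemma halg_basis (u : halg A) : u = \sum_i u i *: ebas i.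
Proof. exact: vec_basis. Qed.

Lemma lin_basis (V : lmodType k) (f : halg A -> V) : lin f ->
  forall u : halg A, f u = \sum_i u i *: f (ebas i).
Proof.
by move=> lf u; rewrite {1}[u]halg_basis lin_sum //; apply: eq_bigr => i _; rewrite linZ.
Qed.

Lemma linf_basis (f : halg A -> k) : linf f ->
  forall u : halg A, f u = \sum_i u i * f (ebas i).
Proof.
by move=> lf u; rewrite {1}[u]halg_basis linf_sum //; apply: eq_bigr => i _; rewrite linfZ.
Qed.

Lemma linf_coord i : linf (fun u : halg A => u i).
Proof. by move=> c u v; rewrite !ffunE. Qed.

Lemma lin_coordl i (c : k) : lin (fun u : halg A => u i * c : k^o).
Proof. by move=> a u v; rewrite !ffunE mulrDl -mulrA. Qed.

Lemma lin_coordr i (c : k) : lin (fun u : halg A => c * u i : k^o).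
Proof. by move=> a u v; rewrite !ffunE mulrDr mulrCA. Qed.

Lemma ebasE i j : ebas i j = (i == j)%:R.
Proof. by rewrite ffunE. Qed.

Lemma mul_ebas i j : ebas i * ebas j = \sum_l mulc A i j l *: ebas l.
Proof.
rewrite [LHS]halg_basis; apply: eq_bigr => l _; congr (_ *: _).
rewrite ffunE (bigD1 i) //= (bigD1 j) //= !ffunE !eqxx !mul1r.
rewrite [X in _ + X + _]big1 ?addr0; last first.
  by move=> j' /negbTE jj; rewrite !ffunE [j == _]eq_sym jj mulr0 mul0r.
rewrite big1 ?addr0 // => i' /negbTE ii; rewrite big1 // => j' _.
by rewrite !ffunE [i == _]eq_sym ii !mul0r.
Qed.

Definition tapp (V : lmodType k) (t : tensor k I) (b : halg A -> halg A -> V) : V :=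
  \sum_i \sum_j t (i, j) *: b (ebas i) (ebas j).

(** Sweedler notation: the sum of b(u', u''). Only the values of [b] at basis vectors enter, so
    replacing the coproduct of [u] by pure tensors requires [b] to be bilinear. *)
Definition sw (V : lmodType k) (u : halg A) (b : halg A -> halg A -> V) : V :=
  tapp (comul A u) b.

Definition eps (u : halg A) : k := counit A u.

Section Sweedler.
Variable V : lmodType k.
Implicit Types (b : halg A -> halg A -> V) (u v : halg A).

Lemma eq_tapp t b b' : (forall u v, b u v = b' u v) -> tapp t b = tapp t b'.
Proof. by move=> e; apply: eq_bigr => i _; apply: eq_bigr => j _; rewrite e. Qed.

Lemma eq_sw u b b' : (forall u v, b u v = b' u v) -> sw u b = sw u b'.
Proof. exact: eq_tapp. Qed.

Lemma tapp_tens u v b : (forall y, lin (b^~ y)) -> (forall x, lin (b x)) ->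
  tapp (tens u v) b = b u v.
Proof.
move=> l1 l2; rewrite (lin_basis (l1 v)); apply: eq_bigr => i _.
rewrite (lin_basis (l2 _) v) scaler_sumr; apply: eq_bigr => j _.
by rewrite ffunE scalerA.
Qed.

Lemma tappD s t b : tapp (s + t) b = tapp s b + tapp t b.
Proof.
rewrite -big_split; apply: eq_bigr => i _ /=; rewrite -big_split.
by apply: eq_bigr => j _ /=; rewrite ffunE scalerDl.
Qed.

Lemma tapp_mul s t b : (forall y, lin (b^~ y)) -> (forall x, lin (b x)) ->
  tapp (tmul A s t) b = tapp s (fun x y => tapp t (fun z w => b (x * z) (y * w))).
Proof.
move=> l1 l2.
transitivity (\sum_i \sum_j \sum_x \sum_y \sum_z \sum_w
   (s (x, y) * t (z, w) * mulc A x z i * mulc A y w j) *: b (ebas i) (ebas j)).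
  apply: eq_bigr => i _; apply: eq_bigr => j _; rewrite ffunE.
  rewrite scaler_suml; apply: eq_bigr => x _; rewrite scaler_suml; apply: eq_bigr => y _.
  by rewrite scaler_suml; apply: eq_bigr => z _; rewrite scaler_suml.
under eq_bigr => i _ do rewrite exchange_big.
rewrite exchange_big; apply: eq_bigr => x _.
under eq_bigr => i _ do rewrite exchange_big.
rewrite exchange_big; apply: eq_bigr => y _.
under eq_bigr => i _ do rewrite exchange_big.
rewrite exchange_big scaler_sumr; apply: eq_bigr => z _.
under eq_bigr => i _ do rewrite exchange_big.
rewrite exchange_big scaler_sumr; apply: eq_bigr => w _.
rewrite mul_ebas (lin_sum _ _ _ (l1 _)) !scaler_sumr; apply: eq_bigr => i _.
rewrite (linZ (l1 _)) mul_ebas (lin_sum _ _ _ (l2 _)) !scaler_sumr; apply: eq_bigr => j _.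
by rewrite (linZ (l2 _)) !scalerA !mulrA.
Qed.

Lemma sw_tens u x y b : comul A u = tens x y ->
  (forall y, lin (b^~ y)) -> (forall x, lin (b x)) -> sw u b = b x y.
Proof. by move=> e l1 l2; rewrite /sw e tapp_tens. Qed.

Lemma sw_tens2 u x y z w b : comul A u = tens x y + tens z w ->
  (forall y, lin (b^~ y)) -> (forall x, lin (b x)) -> sw u b = b x y + b z w.
Proof. by move=> e l1 l2; rewrite /sw e tappD !tapp_tens. Qed.

Lemma sw_mul u v b : (forall y, lin (b^~ y)) -> (forall x, lin (b x)) ->
  sw (u * v) b = sw u (fun x y => sw v (fun z w => b (x * z) (y * w))).
Proof. by move=> l1 l2; rewrite /sw bcomulM tapp_mul. Qed.

Lemma sw_one b : (forall y, lin (b^~ y)) -> (forall x, lin (b x)) -> sw 1 b = b 1 1.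
Proof. by move=> l1 l2; rewrite /sw bcomul1 tapp_tens. Qed.

Lemma lin_swl b : lin (fun u => sw u b).
Proof.
move=> c u v; rewrite /sw /tapp scaler_sumr -big_split; apply: eq_bigr => i _ /=.
rewrite scaler_sumr -big_split; apply: eq_bigr => j _ /=.
rewrite scalerA -scalerDl; congr (_ *: _); rewrite !ffunE mulr_sumr -big_split.
by apply: eq_bigr => l _ /=; rewrite !ffunE mulrDl mulrA.
Qed.

Lemma lin_sw (W : lmodType k) (f : V -> W) u b : lin f ->
  f (sw u b) = sw u (fun x y => f (b x y)).
Proof.
move=> lf; rewrite /sw /tapp lin_sum //; apply: eq_bigr => i _.
by rewrite lin_sum //; apply: eq_bigr => j _; rewrite linZ.
Qed.

Lemma sw_add u b b' : sw u (fun x y => b x y + b' x y) = sw u b + sw u b'.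
Proof.
rewrite /sw /tapp -big_split; apply: eq_bigr => i _ /=; rewrite -big_split.
by apply: eq_bigr => j _ /=; rewrite scalerDr.
Qed.
End Sweedler.

Lemma lin_swf (U V : lmodType k) u (b : U -> halg A -> halg A -> V) :
  (forall x y, lin (fun z => b z x y)) -> lin (fun z => sw u (b z)).
Proof.
move=> lb; rewrite /sw /tapp; apply: lin_sumf => i; apply: lin_sumf => j.
exact: lin_scale.
Qed.

Lemma comulE u i j : comul A u (i, j) = \sum_l u l * comulc A l i j.
Proof. by rewrite ffunE. Qed.

Lemma comul_ebas l i j : comul A (ebas l) (i, j) = comulc A l i j.
Proof.
rewrite comulE (bigD1 l) //= ebasE eqxx mul1r big1 ?addr0 // => l' /negbTE ll.
by rewrite ebasE eq_sym ll mul0r.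
Qed.

(** The way back from contractions to tensors: an [sw] identity applied to this bilinear form gives
    an equality of coproducts entry by entry. *)
Lemma comul_coord u i j :
  comul A u (i, j) = sw u (fun x y => x i * y j : k^o).
Proof.
rewrite /sw /tapp (bigD1 i) //= (bigD1 j) //= !ebasE !eqxx [X in _ + X + _]big1 ?addr0; last first.
  by move=> j' /negbTE jj; rewrite !ebasE jj mulr0 scaler0.
rewrite big1 ?addr0; first by rewrite mulr1 /GRing.scale /= mulr1.
move=> i' /negbTE ii; rewrite big1 // => j' _; by rewrite !ebasE ii mul0r scaler0.
Qed.

Lemma linf_eps : linf eps.
Proof.
move=> c u v; rewrite /eps /counit mulr_sumr -big_split; apply: eq_bigr => i _ /=.
by rewrite !ffunE mulrDl mulrA.
Qed.

Lemma eps_ebas i : eps (ebas i) = counitc A i.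
Proof.
rewrite /eps /counit (bigD1 i) //= ffunE eqxx mul1r big1 ?addr0 // => j /negbTE ij.
by rewrite ffunE eq_sym ij mul0r.
Qed.

Lemma epsM u v : eps (u * v) = eps u * eps v. Proof. exact: bcounitM. Qed.
Lemma eps1 : eps 1 = 1. Proof. exact: bcounit1. Qed.
End HalgInstances.

Lemma sw_exch (k : fieldType) (I J : finType) (A : bialgebra k I) (B : bialgebra k J)
    (V : lmodType k) u v (b : halg A -> halg A -> halg B -> halg B -> V) :
  sw u (fun x y => sw v (b x y)) = sw v (fun z w => sw u (fun x y => b x y z w)).
Proof.
rewrite /sw /tapp.
under eq_bigr => i _ do (under eq_bigr => j _ do rewrite scaler_sumr).
under eq_bigr => i _ do rewrite exchange_big.
rewrite exchange_big; apply: eq_bigr => z _.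
under eq_bigr => i _ do (under eq_bigr => j _ do rewrite scaler_sumr).
under eq_bigr => i _ do rewrite exchange_big.
rewrite exchange_big; apply: eq_bigr => w _; rewrite scaler_sumr.
apply: eq_bigr => i _; rewrite scaler_sumr; apply: eq_bigr => j _.
by rewrite !scalerA mulrC.
Qed.

(** Extension point of [lin]: sections rebind it with [::=] to register the linearity of their own
    operators. *)
Ltac lin_hook := fail.
Ltac lin_base :=
  first [ lin_hook
        | match goal with
          | |- lin (fun x => x) => exact: lin_id
          | |- linf (@eps _ _ _) => exact: linf_eps
          | |- linf (fun x => eps x) => exact: linf_eps
          | |- linf (fun x => fun_of_fin x _) => exact: linf_coord
          | H : lin ?f |- lin ?f => exact: H
          | H : lin ?f |- lin (fun x => ?f x) => exact: H
          | H : forall x, lin (fun y => ?b y x) |- lin (fun y => ?b y _) => exact: H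
          | H : forall x, lin (?b x) |- lin (?b _) => exact: H
          | H : forall x, lin (?b x) |- lin (fun y => ?b _ y) => exact: H
          | H : linf ?f |- linf ?f => exact: H
          | H : linf ?f |- linf (fun x => ?f x) => exact: H
          end ].

(** Stops the composition rules from splitting off an identity map, which would reproduce the same
    goal forever. *)
Ltac not_id g := lazymatch g with (fun x => x) => fail | _ => idtac end.

Ltac lin_step :=
  cbv beta;
  match goal with
  | |- forall _, _ => intro
  | |- lin _ => solve [lin_base]
  | |- linf _ => solve [lin_base]
  | |- lin (GRing.mul ?a) => exact: (@lin_mull _ _ _ id a (@lin_id _ _))
  | |- lin (GRing.scale ?a) => exact: (@lin_scale _ _ _ id a (@lin_id _ _))
  | |- lin (fun u => sw (@?g u) ?b) => apply: (lin_comp (lin_swl b))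
  | |- lin (fun u => sw ?a (fun x y => @?b u x y)) => apply: lin_swf
  | |- lin (fun u => ?a * @?f u) => apply: (@lin_mull _ _ _ f)
  | |- lin (fun u => @?f u * ?a) => apply: (@lin_mulr _ _ _ f)
  | |- lin (fun u => ?a *: @?f u) => apply: (@lin_scale _ _ _ f)
  | |- lin (fun u => @?f u *: ?a) => apply: (@lin_scalef _ _ _ f)
  | |- lin (fun u => @?f u + @?g u) => apply: (@lin_add _ _ _ f g)
  | |- lin (fun u => - @?f u) => apply: (@lin_opp _ _ _ f)
  | |- linf (fun u => ?a * @?f u) => apply: (@linf_mull _ _ f)
  | |- linf (fun u => @?f u * ?a) => apply: (@linf_mulr _ _ f)
  | |- lin (fun u => ?f (@?g u)) => not_id g; apply: (@lin_comp _ _ _ _ f g); first lin_step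
  | |- lin (fun u => ?f (@?g u) ?a) =>
      not_id g; apply: (@lin_comp _ _ _ _ (fun x => f x a) g); first lin_step
  | |- lin (fun u => ?f (@?g u) ?a ?b) =>
      not_id g; apply: (@lin_comp _ _ _ _ (fun x => f x a b) g); first lin_step
  | |- linf (fun u => ?f (@?g u)) => not_id g; apply: (@linf_comp _ _ _ f g); first lin_step
  end.
Ltac lin := solve [repeat lin_step].

Lemma sum_delta (k : fieldType) (I : finType) (V : lmodType k) (i : I) (g : I -> V) :
  \sum_j (i == j)%:R *: g j = g i.
Proof.
rewrite (bigD1 i) //= eqxx scale1r big1 ?addr0 // => j /negbTE ij.
by rewrite eq_sym ij scale0r.
Qed.

(** * Coassociativity and counit laws in Sweedler form *)

Section Coalgebra.
Variables (k : fieldType) (I : finType).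

Definition bialg_of_hopf (A : bialg k I) (hA : isHopf A) : bialgebra k I :=
  Bialgebra (proj1 hA) (proj1 (proj2 hA)) (proj1 (proj2 (proj2 (proj2 (proj2 (proj2 hA))))))
    (proj1 (proj2 (proj2 (proj2 (proj2 (proj2 (proj2 hA)))))))
    (proj1 (proj2 (proj2 (proj2 (proj2 (proj2 (proj2 (proj2 hA))))))))
    (proj1 (proj2 (proj2 (proj2 (proj2 (proj2 (proj2 (proj2 (proj2 hA))))))))).

Variable A : bialgebra k I.

Definition coalgebra : Prop :=
  [/\ (forall i x y z, \sum_a comulc A i a z * comulc A a x y
                   = \sum_b comulc A i x b * comulc A b y z),
      (forall i b, \sum_a counitc A a * comulc A i a b = (i == b)%:R) &
      (forall i a, \sum_b comulc A i a b * counitc A b = (i == a)%:R)].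

Hypothesis coA : coalgebra.
Implicit Types u v : halg A.

Lemma sw_coassoc (V : lmodType k) u (b : halg A -> halg A -> halg A -> V) :
  sw u (fun x y => sw x (fun z w => b z w y)) = sw u (fun x y => sw y (b x)).
Proof.
case: coA => coassA _ _.
transitivity (\sum_i u i *: \sum_x \sum_y \sum_z
   (\sum_a comulc A i a z * comulc A a x y) *: b (ebas A x) (ebas A y) (ebas A z)).
  rewrite (lin_basis (@lin_swl _ _ _ _ _)); apply: eq_bigr => i _; congr (_ *: _).
  rewrite /sw /tapp.
  under eq_bigr => a _ do under eq_bigr => z _ do
    rewrite scaler_sumr.
  under eq_bigr => a _ do rewrite exchange_big.
  rewrite exchange_big; apply: eq_bigr => x _.
  under eq_bigr => a _ do under eq_bigr => z _ do
    rewrite scaler_sumr.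
  under eq_bigr => a _ do rewrite exchange_big.
  rewrite exchange_big; apply: eq_bigr => y _.
  rewrite exchange_big; apply: eq_bigr => z _; rewrite scaler_suml.
  by apply: eq_bigr => a _; rewrite !comul_ebas scalerA.
rewrite (lin_basis (@lin_swl _ _ _ _ _)); apply: eq_bigr => i _; congr (_ *: _).
apply: eq_bigr => x _; rewrite /sw /tapp.
under [RHS]eq_bigr => a _ do rewrite scaler_sumr.
rewrite [RHS]exchange_big; apply: eq_bigr => y _.
under [RHS]eq_bigr => a _ do rewrite scaler_sumr.
rewrite [RHS]exchange_big; apply: eq_bigr => z _; rewrite coassA scaler_suml.
by apply: eq_bigr => a _; rewrite !comul_ebas scalerA.
Qed.

Lemma sw_counitl (V : lmodType k) u (f : halg A -> V) : lin f ->
  sw u (fun x y => eps x *: f y) = f u.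
Proof.
case: coA => _ cl _ lf; rewrite (lin_basis (@lin_swl _ _ _ _ _)) (lin_basis lf u).
apply: eq_bigr => i _; congr (_ *: _); rewrite /sw /tapp exchange_big /=.
rewrite -(sum_delta i (fun j => f (ebas A j))); apply: eq_bigr => j _.
rewrite -cl scaler_suml; apply: eq_bigr => a _.
by rewrite comul_ebas eps_ebas scalerA mulrC.
Qed.

Lemma sw_counitr (V : lmodType k) u (f : halg A -> V) : lin f ->
  sw u (fun x y => eps y *: f x) = f u.
Proof.
case: coA => _ _ cl lf; rewrite (lin_basis (@lin_swl _ _ _ _ _)) (lin_basis lf u).
apply: eq_bigr => i _; congr (_ *: _); rewrite /sw /tapp.
rewrite -(sum_delta i (fun j => f (ebas A j))); apply: eq_bigr => j _.
rewrite -cl scaler_suml; apply: eq_bigr => a _.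
by rewrite comul_ebas eps_ebas scalerA.
Qed.
End Coalgebra.

Lemma coalgebra_hopf (k : fieldType) (I : finType) (A : bialg k I) (hA : isHopf A) :
  coalgebra (bialg_of_hopf hA).
Proof. by case: hA => ? [? [? [? [? ?]]]]. Qed.

(** * The antipode and its inverse as antihomomorphisms *)

Section Antipode.
Variables (k : fieldType) (I : finType) (A : bialgebra k I).
Implicit Types u v : halg A.

Definition smap (S : I -> I -> k) (u : halg A) : halg A := Smap S u.

Lemma lin_smap S : lin (smap S).
Proof.
move=> c u v; apply/ffunP=> i; rewrite !ffunE mulr_sumr -big_split.
by apply: eq_bigr => j _ /=; rewrite !ffunE mulrDl mulrA.
Qed.
Local Ltac lin_hook ::=
  match goal with
  | |- lin (smap _) => exact: lin_smap
  | |- lin (fun x => smap _ x) => exact: lin_smap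
  end.

Lemma smap_ebas S i : smap S (ebas A i) = \sum_l S i l *: ebas A l.
Proof.
rewrite [LHS]halg_basis; apply: eq_bigr => l _; congr (_ *: _).
rewrite ffunE (bigD1 i) //= ffunE eqxx mul1r big1 ?addr0 // => j /negbTE ij.
by rewrite ffunE eq_sym ij mul0r.
Qed.

Lemma smapK S Sb : (forall i l, \sum_u S i u * Sb u l = (i == l)%:R) ->
  cancel (smap S) (smap Sb).
Proof.
move=> e u; rewrite (lin_basis (lin_comp (lin_smap Sb) (lin_smap S))).
rewrite [RHS]halg_basis; apply: eq_bigr => i _; congr (_ *: _).
rewrite smap_ebas (lin_sum _ _ _ (lin_smap _)).
under eq_bigr => l _ do rewrite (linZ (lin_smap _)) smap_ebas scaler_sumr.
rewrite exchange_big -(sum_delta i (ebas A)); apply: eq_bigr => j _.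
by rewrite -e scaler_suml; apply: eq_bigr => l _; rewrite scalerA.
Qed.

Variables (S : I -> I -> k).
Hypotheses (coA : coalgebra A) (aS : is_antipode A S).
Local Notation s := (smap S).

Lemma sw_antipl u : sw u (fun x y => s x * y) = eps u *: 1.
Proof.
rewrite (lin_basis (@lin_swl _ _ _ _ _)) (linf_basis (@linf_eps _ _ A)) scaler_suml.
apply: eq_bigr => i _; rewrite -scalerA; congr (_ *: _); rewrite eps_ebas.
rewrite -[RHS](aS i).1; apply: eq_bigr => a _; apply: eq_bigr => b _.
by rewrite comul_ebas.
Qed.

Lemma sw_antipr u : sw u (fun x y => x * s y) = eps u *: 1.
Proof.
rewrite (lin_basis (@lin_swl _ _ _ _ _)) (linf_basis (@linf_eps _ _ A)) scaler_suml.
apply: eq_bigr => i _; rewrite -scalerA; congr (_ *: _); rewrite eps_ebas.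
rewrite -[RHS](aS i).2; apply: eq_bigr => a _; apply: eq_bigr => b _.
by rewrite comul_ebas.
Qed.

Lemma antip1 : s 1 = 1.
Proof.
have := sw_antipl 1; rewrite eps1 scale1r sw_one ?mulr1 //; lin.
Qed.

(** Both sides are convolution inverses of the multiplication map on A (x) A. Concretely, both equal
    S(u1 v1) u2 v2 S(v3) S(u3): cancelling on the right gives S(uv), cancelling on the left gives
    S(v) S(u). *)
Lemma antipM u v : s (u * v) = s v * s u.
Proof.
have step a c b d : eps b *: (eps d *: s (a * c)) =
    sw b (fun b1 b2 => sw d (fun d1 d2 => s (a * c) * (b1 * d1) * s d2 * s b2)).
  transitivity (sw b (fun b1 b2 => s (a * c) * (b1 * (eps d *: 1) * s b2))).
    transitivity (s (a * c) * (eps d *: (eps b *: 1))).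
      by rewrite -!scalerAr mulr1 !scalerA mulrC.
    rewrite -sw_antipr !lin_sw; try lin.
    by apply: eq_sw => b1 b2; rewrite -[b1 * (_ *: 1)]scalerAr mulr1 -scalerAl.
  apply: eq_sw => b1 b2; rewrite -sw_antipr.
  rewrite (lin_sw d _ (f := fun z => s (a * c) * (b1 * z * s b2))); last lin.
  by apply: eq_sw => d1 d2; rewrite !mulrA.
have step' a c : sw a (fun a1 a2 => sw c (fun c1 c2 => s (a1 * c1) * (a2 * c2))) =
    eps a *: (eps c *: 1).
  by rewrite -(sw_mul a c (b := fun x y => s x * y)) ?sw_antipl ?epsM ?scalerA //; lin.
transitivity (sw u (fun a b => sw v (fun c d => eps b *: (eps d *: s (a * c))))).
  rewrite -(sw_counitr coA u (f := fun u => s (u * v))); last lin.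
  apply: eq_sw => a b; rewrite -(sw_counitr coA v (f := fun v => s (a * v))); last lin.
  by rewrite lin_sw //; lin.
under eq_sw => a b do under eq_sw => c d do rewrite step.
under eq_sw => a b do rewrite sw_exch.
under eq_sw => a b do under eq_sw => b1 b2 do
  rewrite -(sw_coassoc coA v (fun c d1 d2 => s (a * c) * (b1 * d1) * s d2 * s b2)).
rewrite -(sw_coassoc coA u (fun a b1 b2 => sw v (fun d d2 => sw d (fun c d1 =>
  s (a * c) * (b1 * d1) * s d2 * s b2)))).
(* After regrouping by coassociativity, the first legs read S(a1 c1) a2 c2 and collapse to
   counits. *)
transitivity (sw u (fun a b => sw v (fun c d => eps a *: (eps c *: (s d * s b))))).
  apply: eq_sw => a b; rewrite sw_exch; apply: eq_sw => c d.
  have := congr1 (fun z => z * (s d * s b)) (step' a c).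
  rewrite /= -!scalerAl mul1r => <-; rewrite (lin_sw _ _ (f := fun z => z * _)); last lin.
  apply: eq_sw => a1 a2; rewrite (lin_sw _ _ (f := fun z => z * _)); last lin.
  by apply: eq_sw => c1 c2; rewrite !mulrA.
transitivity (sw u (fun a b => eps a *: (s v * s b))).
  apply: eq_sw => a b.
  by rewrite -(lin_sw _ _ (f := fun z => eps a *: z)) ?(sw_counitl coA v (f := fun z => s z * s b)) //; lin.
by rewrite (sw_counitl coA u (f := fun b => s v * s b)) //; lin.
Qed.

(** Apply the counit to S(u') u'' = eps(u) and absorb the second leg by the counit law. *)
Lemma eps_antip u : eps (s u) = eps u.
Proof.
have := congr1 (@eps _ _ A) (sw_antipl u); rewrite (linfZ (@linf_eps _ _ A)) eps1 mulr1 => <-.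
rewrite -[in LHS](sw_counitr coA u (lin_smap S)) /sw /tapp !(linf_sum _ _ _ (@linf_eps _ _ A)).
apply: eq_bigr => i _; rewrite !(linf_sum _ _ _ (@linf_eps _ _ A)).
by apply: eq_bigr => j _; rewrite !(linfZ (@linf_eps _ _ A)) epsM [_ * eps (ebas A j)]mulrC.
Qed.

(** The convolution argument of [antipM] with values in A (x) A: both expressions are inverse to the
    coproduct. *)
Lemma sw_antip (V : lmodType k) u (b : halg A -> halg A -> V) :
  (forall y, lin (b^~ y)) -> (forall x, lin (b x)) ->
  sw (s u) b = sw u (fun x y => b (s y) (s x)).
Proof.
move=> l1 l2.
(* both sides are contractions of Delta(S u1) Delta(u2) (S u4 (x) S u3) *)
have stepr c p q : eps c *: b p q =
    sw c (fun r d => sw r (fun r1 r2 => sw d (fun e f => b (p * r1 * s f) (q * r2 * s e)))).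
  have -> : sw c (fun r d => sw r (fun r1 r2 => sw d (fun e f => b (p * r1 * s f) (q * r2 * s e))))
    = sw c (fun r d => sw d (fun e f => sw r (fun r1 r2 => b (p * r1 * s f) (q * r2 * s e)))).
    by apply: eq_sw => r d; rewrite sw_exch.
  rewrite -(sw_coassoc coA c (fun r e f => sw r (fun r1 r2 => b (p * r1 * s f) (q * r2 * s e)))).
  transitivity (sw c (fun x f => b (p * x * s f) q)).
    rewrite -(lin_sw _ (fun x f => p * x * s f) (f := b^~ q)); last lin.
    transitivity (b (sw c (fun x f => p * (x * s f))) q); last by congr b; apply: eq_sw => *; rewrite mulrA.
    rewrite -(lin_sw _ (fun x f => x * s f) (f := fun z => p * z)); last lin.
    by rewrite sw_antipr -scalerAr mulr1 (linZ (l1 q)).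
  apply: eq_sw => x f.
  rewrite (sw_coassoc coA x (fun r1 r2 e => b (p * r1 * s f) (q * r2 * s e))).
  rewrite -{1}(sw_counitr coA x (f := fun x => b (p * x * s f) q)); last lin.
  apply: eq_sw => r1 y.
  transitivity (b (p * r1 * s f) (q * (eps y *: 1))).
    by rewrite -scalerAr mulr1 (linZ (l2 _)).
  rewrite -sw_antipr (lin_sw _ _ (f := fun z => q * z)) ?(lin_sw _ _ (f := b _)) //; try lin.
  by apply: eq_sw => *; rewrite mulrA.
rewrite -(sw_counitr coA u (f := fun u => sw (s u) b)); last lin.
transitivity (sw u (fun a c => sw (s a) (fun p q => sw c (fun r d => sw r (fun r1 r2 =>
  sw d (fun e f => b (p * r1 * s f) (q * r2 * s e))))))).
  apply: eq_sw => a c; rewrite (lin_sw _ _ (f := fun z => eps c *: z)); last lin.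
  by apply: eq_sw => p q; rewrite stepr.
transitivity (sw u (fun a c => sw c (fun r d => sw (s a * r) (fun p q => 
  sw d (fun e f => b (p * s f) (q * s e)))))).
  apply: eq_sw => a c; rewrite sw_exch; apply: eq_sw => r d.
  by rewrite sw_mul //; lin.
rewrite -(sw_coassoc coA u (fun a r d => sw (s a * r) (fun p q => sw d (fun e f => b (p * s f) (q * s e))))).
rewrite -(sw_counitl coA u (f := fun d => sw d (fun x y => b (s y) (s x)))); last lin.
apply: eq_sw => c d.
rewrite -(lin_sw _ _ (f := fun z => sw z _)); last lin.
rewrite sw_antipl (linZ (@lin_swl _ _ _ _ _)) sw_one; [|lin|lin]; congr (_ *: _).
by apply: eq_sw => *; rewrite !mul1r.
Qed.

Variable Sb : I -> I -> k.
Hypotheses (SSb : forall i l, \sum_u S i u * Sb u l = (i == l)%:R)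
           (SbS : forall i l, \sum_u Sb i u * S u l = (i == l)%:R).
Local Notation t := (smap Sb).

Let sK : cancel s t. Proof. exact: smapK. Qed.
Let tK : cancel t s. Proof. exact: smapK. Qed.

Lemma skew1 : t 1 = 1.
Proof. by rewrite -[in t 1]antip1 sK. Qed.

Lemma skewM u v : t (u * v) = t v * t u.
Proof. by rewrite -{1}[u]tK -{1}[v]tK -antipM sK. Qed.

Lemma eps_skew u : eps (t u) = eps u.
Proof. by rewrite -[in RHS](tK u) eps_antip. Qed.

Lemma sw_skew (V : lmodType k) u (b : halg A -> halg A -> V) :
  (forall y, lin (b^~ y)) -> (forall x, lin (b x)) ->
  sw (t u) b = sw u (fun x y => b (t y) (t x)).
Proof.
move=> l1 l2; rewrite -[in RHS](tK u) sw_antip; [|lin|lin].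
by apply: eq_sw => x y; rewrite !sK.
Qed.

(** Apply S, which reverses products and undoes S^-1: y S^-1(x) becomes x S(y). So the antipode laws
    hold for S^-1 with the two legs exchanged. *)
Lemma sw_skewr u : sw u (fun x y => y * t x) = eps u *: 1.
Proof.
rewrite -[LHS]sK (lin_sw _ _ (lin_smap S)).
under eq_sw => x y do rewrite antipM tK.
by rewrite sw_antipr (linZ (lin_smap Sb)) skew1.
Qed.

Lemma sw_skewl u : sw u (fun x y => t y * x) = eps u *: 1.
Proof.
rewrite -[LHS]sK (lin_sw _ _ (lin_smap S)).
under eq_sw => x y do rewrite antipM tK.
by rewrite sw_antipl (linZ (lin_smap Sb)) skew1.
Qed.
End Antipode.

Lemma sw_sum (k : fieldType) (I : finType) (A : bialgebra k I) (V : lmodType k)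
    (T : finType) (u : halg A) (c : T -> k) (b : T -> halg A -> halg A -> V) :
  sw u (fun x y => \sum_i c i *: b i x y) = \sum_i c i *: sw u (b i).
Proof.
rewrite /sw /tapp.
under eq_bigr => x _ do under eq_bigr => y _ do rewrite scaler_sumr.
under eq_bigr => x _ do rewrite exchange_big.
rewrite exchange_big; apply: eq_bigr => i _; rewrite scaler_sumr.
apply: eq_bigr => x _; rewrite scaler_sumr; apply: eq_bigr => y _.
by rewrite !scalerA mulrC.
Qed.

(** * The Drinfel'd double is a bialgebra *)

Section Double.
Variables (k : fieldType) (J : finType) (T : bialgebra k J) (S Sb : J -> J -> k).
Hypotheses (coT : coalgebra T) (aS : is_antipode T S).
Hypotheses (SSb : forall i l, \sum_u S i u * Sb u l = (i == l)%:R)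
           (SbS : forall i l, \sum_u Sb i u * S u l = (i == l)%:R).
Local Notation t := (smap Sb).
Local Notation D := (DD T Sb).
Local Ltac lin_hook ::=
  match goal with
  | |- lin (smap _) => exact: lin_smap
  | |- lin (fun x => smap _ x) => exact: lin_smap
  end.

Definition delt (p : J * J) (z : halg T) : halg T := z p.1 *: ebas T p.2.

(* f (x) a in T^* (x) T is read as the map z |-> f(z) a *)
Definition dfun (F : vec k (J * J)%type) (z : halg T) : halg T :=
  \sum_p F p *: delt p z.

Lemma lin_delt p : lin (delt p).
Proof. rewrite /delt; lin. Qed.

Lemma lin_dfun F : lin (dfun F).
Proof. by apply: lin_sumf => p; apply: lin_scale; apply: lin_delt. Qed.

Lemma dfun_ebas F i : dfun F (ebas T i) = \sum_j F (i, j) *: ebas T j.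
Proof.
rewrite /dfun (eq_bigr (fun p => F (p.1, p.2) *: delt (p.1, p.2) (ebas T i))) => [|[] //].
rewrite -(pair_bigA _ (fun a b => F (a, b) *: delt (a, b) (ebas T i))) /=.
rewrite exchange_big; apply: eq_bigr => j _ /=.
rewrite -(sum_delta i (fun l => F (l, j) *: ebas T j)); apply: eq_bigr => l _.
by rewrite /delt /= ebasE !scalerA mulrC.
Qed.

Lemma dfun_coord F i j : dfun F (ebas T i) j = F (i, j).
Proof.
rewrite dfun_ebas (linf_sum _ _ _ (@linf_coord _ _ T j)) (bigD1 j) //=.
rewrite (linfZ (@linf_coord _ _ T j)) ebasE eqxx mulr1 big1 ?addr0 // => l /negbTE lj.
by rewrite (linfZ (@linf_coord _ _ T j)) ebasE lj mulr0.
Qed.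

Lemma dfun_inj F G : dfun F =1 dfun G -> F = G.
Proof. by move=> e; apply/ffunP=> -[i j]; rewrite -!dfun_coord e. Qed.

(* the cross relation u g = g(S^-1(u''') y u') u'' of the double, evaluated at y *)
Definition dact (y : halg T) (g : halg T -> halg T) (u : halg T) : halg T :=
  sw u (fun v c => sw v (fun a b => b * g (t c * y * a))).
(** The product of the double on functions: a convolution in z, in which the element f(z') of T must
    first move past g, evaluated at z''. *)
Definition dmul (f g : halg T -> halg T) (z : halg T) : halg T :=
  sw z (fun z1 z2 => dact z2 g (f z1)).

Lemma lin_dact y g : lin g -> lin (dact y g).
Proof. by move=> lg; rewrite /dact; lin. Qed.
Lemma lin_dacty u g : lin g -> lin (fun y => dact y g u).
Proof. by move=> lg; rewrite /dact; lin. Qed.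
Local Ltac lin_hook ::=
  match goal with
  | |- lin (smap _) => exact: lin_smap
  | |- lin (fun x => smap _ x) => exact: lin_smap
  | |- lin (dfun _) => exact: lin_dfun
  | |- lin (fun x => dfun _ x) => exact: lin_dfun
  | |- lin (delt _) => exact: lin_delt
  | |- lin (fun x => delt _ x) => exact: lin_delt
  | |- lin (dact _ _) => apply: lin_dact; lin
  | |- lin (fun x => dact _ _ x) => apply: lin_dact; lin
  | |- lin (fun x => dact x _ _) => apply: lin_dacty; lin
  end.

Lemma lin_dmul f g : lin (dmul f g).
Proof. exact: lin_swl. Qed.

(** To move u v past g, move v first. The outer legs of u end up inside the argument of g, in the
    right order because S^-1 reverses products. *)
Lemma dact_mul y g u v : lin g ->
  dact y g (u * v) = sw u (fun p r => sw p (fun p1 p2 => p2 * dact (t r * y * p1) g v)).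
Proof.
move=> lg; rewrite /dact sw_mul; [|lin|lin].
apply: eq_sw => p r.
transitivity (sw v (fun z w => sw p (fun p1 p2 => sw z (fun a b =>
    p2 * (b * g (t w * (t r * y * p1) * a)))))).
  apply: eq_sw => z w; rewrite sw_mul; [|lin|lin].
  apply: eq_sw => p1 p2; apply: eq_sw => a b.
  by rewrite (skewM coT aS SSb SbS) !mulrA.
rewrite sw_exch; apply: eq_sw => p1 p2.
rewrite (lin_sw _ _ (f := fun z => p2 * z)); last lin.
by apply: eq_sw => z w; rewrite (lin_sw _ _ (f := fun z => p2 * z)) //; lin.
Qed.

(** Moving u past a product of functionals means passing the factors one at a time; associativity of
    [dmul] reduces to this. *)
Lemma dact_dmul y g h u : lin g -> lin h ->
  dact y (dmul g h) u = sw y (fun y1 y2 => dact y2 h (dact y1 g u)).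
Proof.
move=> lg lh.
(* The arguments are five consecutive legs of [u]. As S^-1 reverses the coproduct, the first leg of
   S^-1(c) y a carries c2 and a1, the second c1 and a2. *)
pose Q a1 a2 b c1 c2 := sw y (fun y1 y2 => b * dact (t c1 * y2 * a2) h (g (t c2 * y1 * a1))).
transitivity (sw u (fun v c2 => sw v (fun v' c1 => sw v' (fun w b => sw w (fun a1 a2 =>
   Q a1 a2 b c1 c2))))).
  rewrite {1}/dact.
  transitivity (sw u (fun v c => sw c (fun c1 c2 => sw v (fun a b => sw a (fun a1 a2 =>
     Q a1 a2 b c1 c2))))).
    apply: eq_sw => v c; rewrite sw_exch; apply: eq_sw => a b.
    rewrite sw_exch /dmul sw_mul; [|lin|lin].
    rewrite sw_mul; [|lin|lin]; rewrite (sw_skew coT aS SSb SbS); [|lin|lin].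
    rewrite (lin_sw _ _ (f := fun z => b * z)); last lin.
    rewrite [RHS]sw_exch; apply: eq_sw => c1 c2.
    rewrite (lin_sw _ _ (f := fun z => b * z)); last lin.
    rewrite /Q [RHS]sw_exch; apply: eq_sw => y1 y2.
    by rewrite (lin_sw _ _ (f := fun z => b * z)) //; lin.
  exact: (esym (sw_coassoc coT u (fun v c1 c2 => sw v (fun a b => sw a (fun a1 a2 => Q a1 a2 b c1 c2))))).
(* Regrouped so that the outermost legs feed [g], while the middle leg is split again into the three
   legs needed for [h]. *)
transitivity (sw u (fun v c => sw v (fun a b => sw b (fun p r => sw p (fun p1 p2 =>
  Q a p1 p2 r c))))).
  apply: eq_sw => v c.
  transitivity (sw v (fun v' r => sw v' (fun a p => sw p (fun p1 p2 => Q a p1 p2 r c)))); last first.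
    exact: (sw_coassoc coT v (fun a p r => sw p (fun p1 p2 => Q a p1 p2 r c))).
  by apply: eq_sw => v' r; exact: (sw_coassoc coT v' (fun a p1 p2 => Q a p1 p2 r c)).
transitivity (sw y (fun y1 y2 => sw u (fun v c => sw v (fun a b => sw b (fun p r =>
  sw p (fun p1 p2 => p2 * dact (t r * y2 * p1) h (g (t c * y1 * a)))))))).
  rewrite [RHS]sw_exch; apply: eq_sw => v c; rewrite [RHS]sw_exch; apply: eq_sw => a b.
  rewrite [RHS]sw_exch; apply: eq_sw => p r; rewrite [RHS]sw_exch; by apply: eq_sw => p1 p2.
apply: eq_sw => y1 y2; rewrite [dact y1 g u]/dact.
rewrite (lin_sw _ _ (f := dact y2 h)); last exact: lin_dact.
apply: eq_sw => v c; rewrite (lin_sw _ _ (f := dact y2 h)); last exact: lin_dact.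
by apply: eq_sw => a b; rewrite dact_mul.
Qed.

Lemma dmulA f g h : lin f -> lin g -> lin h ->
  dmul (dmul f g) h =1 dmul f (dmul g h).
Proof.
move=> lf lg lh z; rewrite /dmul.
transitivity (sw z (fun z1 z2 => sw z1 (fun y1 y2 => dact z2 h (dact y2 g (f y1))))).
  by apply: eq_sw => z1 z2; rewrite (lin_sw _ _ (f := dact z2 h)) //; exact: lin_dact.
rewrite (sw_coassoc coT z (fun y1 y2 z2 => dact z2 h (dact y2 g (f y1)))).
by apply: eq_sw => z1 z'; rewrite dact_dmul.
Qed.

Lemma dact1 y g : lin g -> dact y g 1 = g y.
Proof.
move=> lg; rewrite /dact sw_one; [|lin|lin]; rewrite sw_one; [|lin|lin].
by rewrite (skew1 aS SSb) !mul1r mulr1.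
Qed.

Definition dun (z : halg T) : halg T := eps z *: 1.
Lemma lin_dun : lin dun. Proof. rewrite /dun; lin. Qed.

Lemma dact_un y u : dact y dun u = eps y *: u.
Proof.
rewrite /dact /dun.
transitivity (sw u (fun v c => eps c *: (eps y *: v))); last first.
  by rewrite (sw_counitr coT u (f := fun v => eps y *: v)) //; lin.
apply: eq_sw => v c.
rewrite -(sw_counitl coT v (f := fun v => eps c *: (eps y *: v))); last lin.
apply: eq_sw => a b; rewrite -scalerAr mulr1 !epsM (eps_skew coT aS SbS) !scalerA.
by congr (_ *: _); rewrite mulrC mulrA.
Qed.

Lemma dmul1f f : lin f -> dmul dun f =1 f.
Proof.
move=> lf z; rewrite /dmul /dun -[RHS](sw_counitl coT z lf); apply: eq_sw => z1 z2.
by rewrite (linZ (lin_dact _ lf)) dact1.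
Qed.

Lemma dmulf1 f : lin f -> dmul f dun =1 f.
Proof.
move=> lf z; rewrite /dmul -[RHS](sw_counitr coT z lf); apply: eq_sw => z1 z2.
by rewrite dact_un.
Qed.

Lemma mul_ebasE i j l : (ebas T i * ebas T j) l = mulc T i j l.
Proof.
rewrite mul_ebas (linf_sum _ _ _ (@linf_coord _ _ T l)) (bigD1 l) //=.
rewrite (linfZ (@linf_coord _ _ T l)) ebasE eqxx mulr1 big1 ?addr0 // => l' /negbTE ll.
by rewrite (linfZ (@linf_coord _ _ T l)) ebasE ll mulr0.
Qed.

(** The bridge to the structure constants: here the nested sums in the product of [DD] are matched
    with [dmul], so that later arguments can stay in Sweedler form. *)
Lemma dmul_delt p r l w : dmul (delt p) (delt r) (ebas T l) w = mulc D p r (l, w).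
Proof.
pose X c s a := \sum_u Sb c u * \sum_v mulc T u s v * mulc T v a r.1.
have XE c s a : (t (ebas T c) * ebas T s * ebas T a) r.1 = X c s a.
  rewrite smap_ebas !mulr_suml (linf_sum _ _ _ (@linf_coord _ _ T _)).
  apply: eq_bigr => u _; rewrite -!scalerAl (linfZ (@linf_coord _ _ T _)); congr (_ * _).
  rewrite mul_ebas !mulr_suml (linf_sum _ _ _ (@linf_coord _ _ T _)).
  by apply: eq_bigr => v _; rewrite -!scalerAl (linfZ (@linf_coord _ _ T _)) mul_ebasE.
have actE s : dact (ebas T s) (delt r) (ebas T p.2) w = \sum_v \sum_c comulc T p.2 v c *
    \sum_a \sum_b comulc T v a b * (X c s a * mulc T b r.2 w).
  rewrite /dact /sw /tapp (linf_sum _ _ _ (@linf_coord _ _ T w)); apply: eq_bigr => v _.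
  rewrite (linf_sum _ _ _ (@linf_coord _ _ T w)); apply: eq_bigr => c _.
  rewrite (linfZ (@linf_coord _ _ T _)) comul_ebas; congr (_ * _).
  rewrite (linf_sum _ _ _ (@linf_coord _ _ T w)); apply: eq_bigr => a _.
  rewrite (linf_sum _ _ _ (@linf_coord _ _ T w)); apply: eq_bigr => b _.
  rewrite (linfZ (@linf_coord _ _ T _)) comul_ebas; congr (_ * _).
  by rewrite /delt -scalerAr (linfZ (@linf_coord _ _ T _)) mul_ebasE XE.
have -> : dmul (delt p) (delt r) (ebas T l) =
    \sum_s comulc T l p.1 s *: dact (ebas T s) (delt r) (ebas T p.2).
  rewrite /dmul [LHS]/sw /tapp exchange_big; apply: eq_bigr => s _.
  rewrite -(sum_delta p.1 (fun i => comulc T l i s *: dact (ebas T s) (delt r) (ebas T p.2))).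
  apply: eq_bigr => i _; rewrite comul_ebas {2}/delt (linZ (lin_dact _ (lin_delt _))) ebasE.
  by rewrite !scalerA mulrC eq_sym.
rewrite (linf_sum _ _ _ (@linf_coord _ _ T w)).
under eq_bigr => s _ do rewrite (linfZ (@linf_coord _ _ T _)) actE mulr_sumr.
transitivity (\sum_a \sum_b \sum_c \sum_v \sum_s comulc T p.2 v c * comulc T v a b *
   (X c s a * comulc T l p.1 s) * mulc T b r.2 w); last first.
  apply: eq_bigr => a _; apply: eq_bigr => b _; apply: eq_bigr => c _; apply: eq_bigr => v _.
  by rewrite mulr_sumr mulr_suml.
under eq_bigr => s _ do under eq_bigr => v _ do rewrite mulr_sumr.
under eq_bigr => s _ do under eq_bigr => v _ do under eq_bigr => c _ do rewrite !mulr_sumr.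
under eq_bigr => s _ do under eq_bigr => v _ do rewrite exchange_big.
under eq_bigr => s _ do rewrite exchange_big.
rewrite exchange_big; apply: eq_bigr => a _.
under eq_bigr => s _ do under eq_bigr => v _ do under eq_bigr => c _ do rewrite !mulr_sumr.
under eq_bigr => s _ do under eq_bigr => v _ do rewrite exchange_big.
under eq_bigr => s _ do rewrite exchange_big.
rewrite exchange_big; apply: eq_bigr => b _.
under eq_bigr => s _ do rewrite exchange_big.
rewrite exchange_big; apply: eq_bigr => c _.
rewrite exchange_big; apply: eq_bigr => v _; apply: eq_bigr => s _.
by rewrite mulrCA !mulrA; congr (_ * _); rewrite -!mulrA; congr (_ * _); rewrite [RHS]mulrA [RHS]mulrC.
Qed.

Lemma dmul_dfun F G z : dmul (dfun F) (dfun G) z =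
  \sum_p F p *: \sum_r G r *: dmul (delt p) (delt r) z.
Proof.
have actE y u : dact y (dfun G) u = \sum_r G r *: dact y (delt r) u.
  rewrite /dact -sw_sum; apply: eq_sw => v c; rewrite -sw_sum; apply: eq_sw => a b.
  by rewrite /dfun mulr_sumr; apply: eq_bigr => r _; rewrite -scalerAr.
under eq_bigr => p _ do rewrite -sw_sum.
rewrite -sw_sum; apply: eq_sw => z1 z2.
rewrite {1}/dfun (lin_sum _ _ _ (lin_dact _ (lin_dfun _))); apply: eq_bigr => p _.
by rewrite (linZ (lin_dact _ (lin_dfun _))) actE.
Qed.

Lemma dfun_mul F G : dfun (amul D F G) =1 dmul (dfun F) (dfun G).
Proof.
move=> z; rewrite (lin_basis (lin_dfun _) z) (lin_basis (lin_dmul _ _) z).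
apply: eq_bigr => l _; congr (_ *: _); apply/ffunP=> w.
rewrite dfun_coord dmul_dfun ffunE (linf_sum _ _ _ (@linf_coord _ _ T w)).
apply: eq_bigr => p _; rewrite (linfZ (@linf_coord _ _ T w)) (linf_sum _ _ _ (@linf_coord _ _ T w)).
rewrite mulr_sumr; apply: eq_bigr => r _.
by rewrite (linfZ (@linf_coord _ _ T w)) dmul_delt mulrA.
Qed.

(** The dual factor carries the opposite coproduct, which is why the index [x] of the second tensor
    factor multiplies from the left. *)
Lemma comul_DD F y a x b :
  comul D F ((y, a), (x, b)) = comul T (dfun F (ebas T x * ebas T y)) (a, b).
Proof.
have lc : linf (fun u : halg T => comul T u (a, b)).
  move=> c u v; rewrite !comulE mulr_sumr -big_split; apply: eq_bigr => l _ /=.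
  by rewrite !ffunE mulrDl mulrA.
rewrite ffunE /dfun (linf_sum _ _ _ lc); apply: eq_bigr => p _ /=.
by rewrite (linfZ lc) /delt (linfZ lc) comul_ebas mul_ebasE.
Qed.

(** Stands in for [sw] on the double, which is not yet known to be a bialgebra at this point; it
    contracts over basis indices. *)
Definition dsw (V : lmodType k) (F : vec k (J * J)%type) (b : J * J -> J * J -> V) : V :=
  \sum_p \sum_r comul D F (p, r) *: b p r.

Lemma eq_dsw (V : lmodType k) F (b b' : J * J -> J * J -> V) :
  (forall p r, b p r = b' p r) -> dsw F b = dsw F b'.
Proof. by move=> e; apply: eq_bigr => i _; apply: eq_bigr => j _; rewrite e. Qed.

Lemma dsw_sw (V : lmodType k) F (u : halg T) (b : J * J -> J * J -> halg T -> halg T -> V) :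
  dsw F (fun p r => sw u (b p r)) = sw u (fun x y => dsw F (fun p r => b p r x y)).
Proof.
rewrite /dsw /sw /tapp.
under eq_bigr => i _ do (under eq_bigr => j _ do rewrite scaler_sumr).
under eq_bigr => i _ do rewrite exchange_big.
rewrite exchange_big; apply: eq_bigr => z _.
under eq_bigr => i _ do (under eq_bigr => j _ do rewrite scaler_sumr).
under eq_bigr => i _ do rewrite exchange_big.
rewrite exchange_big; apply: eq_bigr => w _; rewrite scaler_sumr.
apply: eq_bigr => i _; rewrite scaler_sumr; apply: eq_bigr => j _.
by rewrite !scalerA mulrC.
Qed.

Lemma lin_dsw (U V : lmodType k) F (b : U -> J * J -> J * J -> V) :
  (forall p r, lin (fun z => b z p r)) -> lin (fun z => dsw F (b z)).
Proof.
by move=> lb; apply: lin_sumf => i; apply: lin_sumf => j; apply: lin_scale.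
Qed.

Lemma dsw_delt (V : lmodType k) F x y (b : halg T -> halg T -> V) :
  (forall y, lin (b^~ y)) -> (forall x, lin (b x)) ->
  dsw F (fun p r => b (delt p y) (delt r x)) = sw (dfun F (x * y)) b.
Proof.
move=> l1 l2.
have lx : lin (fun x => sw (dfun F (x * y)) b) by lin.
have ly x' : lin (fun y => sw (dfun F (x' * y)) b) by lin.
rewrite (lin_basis lx).
under [RHS]eq_bigr => i _ do rewrite (lin_basis (ly _)) scaler_sumr.
rewrite exchange_big /dsw.
rewrite (eq_bigr (fun p => \sum_r comul D F ((p.1, p.2), r) *: b (delt (p.1, p.2) y) (delt r x)));
  last by case.
rewrite -(pair_bigA _ (fun j a => \sum_r comul D F ((j, a), r) *: b (delt (j, a) y) (delt r x))) /=.
apply: eq_bigr => j _.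
transitivity (\sum_a \sum_i \sum_c comul D F ((j, a), (i, c)) *: b (delt (j, a) y) (delt (i, c) x)).
  apply: eq_bigr => a _.
  by rewrite (pair_bigA _ (fun i c => comul D F ((j, a), (i, c)) *: b (delt (j, a) y) (delt (i, c) x)));
     apply: eq_bigr => -[].
rewrite exchange_big; apply: eq_bigr => i _; rewrite scaler_sumr scaler_sumr.
apply: eq_bigr => a _; rewrite !scaler_sumr; apply: eq_bigr => c _.
rewrite comul_DD /delt /= (linZ (l1 _)) (linZ (l2 _)) !scalerA; congr (_ *: _).
by rewrite mulrC -mulrA mulrCA mulrA.
Qed.

Local Ltac lin_hook ::=
  match goal with
  | |- lin (smap _) => exact: lin_smap
  | |- lin (fun x => smap _ x) => exact: lin_smap
  | |- lin (dfun _) => exact: lin_dfun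
  | |- lin (fun x => dfun _ x) => exact: lin_dfun
  | |- lin (delt _) => exact: lin_delt
  | |- lin (fun x => delt _ x) => exact: lin_delt
  | |- lin (dact _ _) => apply: lin_dact; lin
  | |- lin (fun x => dact _ _ x) => apply: lin_dact; lin
  | |- lin (fun x => dact x _ _) => apply: lin_dacty; lin
  | |- lin (fun x => dsw _ (fun p r => @?b x p r)) => apply: (@lin_dsw _ _ _ b); lin
  end.

(** The legs of [u] come in the order a1, a2, c, b1, b2, c'. The neighbours c and b1 meet as b1
    S^-1(c) and cancel, leaving the four legs a1, a2, b2, c'. *)
Lemma contract_skew (V : lmodType k) u
    (Q : halg T -> halg T -> halg T -> halg T -> halg T -> V) :
  (forall a1 a2 b2 c', lin (fun m => Q a1 a2 m b2 c')) ->
  (forall a2 m b2 c', lin (fun a1 => Q a1 a2 m b2 c')) ->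
  (forall a1 m b2 c', lin (fun a2 => Q a1 a2 m b2 c')) ->
  sw u (fun a b => sw a (fun v c => sw v (fun a1 a2 => sw b (fun v' c' =>
      sw v' (fun b1 b2 => Q a1 a2 (b1 * t c) b2 c'))))) =
  sw u (fun v c' => sw v (fun a1 m => sw m (fun a2 b2 => Q a1 a2 1 b2 c'))).
Proof.
move=> lQ lQ1 lQ2.
transitivity (sw u (fun a b => sw b (fun v' c' => sw v' (fun b1 b2 =>
  sw a (fun v c => sw v (fun a1 a2 => Q a1 a2 (b1 * t c) b2 c')))))).
  apply: eq_sw => a b.
  transitivity (sw a (fun v c => sw b (fun v' c' => sw v' (fun b1 b2 =>
      sw v (fun a1 a2 => Q a1 a2 (b1 * t c) b2 c'))))).
    by apply: eq_sw => v c; rewrite sw_exch; apply: eq_sw => v' c'; rewrite sw_exch.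
  by rewrite sw_exch; apply: eq_sw => v' c'; rewrite sw_exch.
transitivity (sw u (fun v c' => sw v (fun a v' => sw v' (fun b1 b2 =>
  sw a (fun v c => sw v (fun a1 a2 => Q a1 a2 (b1 * t c) b2 c')))))).
  exact: (esym (sw_coassoc coT u (fun a v' c' => sw v' (fun b1 b2 =>
    sw a (fun v c => sw v (fun a1 a2 => Q a1 a2 (b1 * t c) b2 c')))))).
apply: eq_sw => v c'.
transitivity (sw v (fun v' b2 => sw v' (fun a b1 =>
  sw a (fun v c => sw v (fun a1 a2 => Q a1 a2 (b1 * t c) b2 c'))))).
  exact: (esym (sw_coassoc coT v (fun a b1 b2 =>
    sw a (fun v c => sw v (fun a1 a2 => Q a1 a2 (b1 * t c) b2 c'))))).
transitivity (sw v (fun v' b2 => sw v' (fun a1 a2 => Q a1 a2 1 b2 c'))); last first.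
  exact: (sw_coassoc coT v (fun a1 a2 b2 => Q a1 a2 1 b2 c')).
apply: eq_sw => v' b2.
transitivity (sw v' (fun w d => sw d (fun c b1 => sw w (fun a1 a2 => Q a1 a2 (b1 * t c) b2 c')))).
  exact: (sw_coassoc coT v' (fun w c b1 => sw w (fun a1 a2 => Q a1 a2 (b1 * t c) b2 c'))).
rewrite -(sw_counitr coT v' (f := fun w => sw w (fun a1 a2 => Q a1 a2 1 b2 c'))); last lin.
apply: eq_sw => w d; rewrite sw_exch (lin_sw _ _ (f := fun z => eps d *: z)); last lin.
apply: eq_sw => a1 a2; rewrite -(linZ (lQ a1 a2 b2 c')) -(sw_skewr coT aS SSb SbS d).
by rewrite (lin_sw _ _ (lQ a1 a2 b2 c')).
Qed.

(** Multiplicativity of the coproduct, evaluated at y and x. Each tensor factor has its own cross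
    relation, and the two arguments of G multiply to S^-1(c') x2 b1 S^-1(c) y2 a1. Cancelling b1
    S^-1(c) leaves the cross relation at x2 y2. *)
Lemma dsw_dmul (V : lmodType k) F G x y (b : halg T -> halg T -> V) :
  (forall y, lin (b^~ y)) -> (forall x, lin (b x)) ->
  dsw F (fun p r => dsw G (fun p' r' =>
     b (dmul (delt p) (delt p') y) (dmul (delt r) (delt r') x)))
  = sw (dmul (dfun F) (dfun G) (x * y)) b.
Proof.
move=> l1 l2.
transitivity (sw y (fun y1 y2 => sw x (fun x1 x2 => dsw F (fun p r => dsw G (fun p' r' =>
   b (dact y2 (delt p') (delt p y1)) (dact x2 (delt r') (delt r x1))))))).
  transitivity (dsw F (fun p r => sw y (fun y1 y2 => sw x (fun x1 x2 => dsw G (fun p' r' =>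
     b (dact y2 (delt p') (delt p y1)) (dact x2 (delt r') (delt r x1))))))).
    apply: eq_dsw => p r.
    transitivity (dsw G (fun p' r' => sw y (fun y1 y2 => sw x (fun x1 x2 =>
       b (dact y2 (delt p') (delt p y1)) (dact x2 (delt r') (delt r x1)))))).
      apply: eq_dsw => p' r'; rewrite {1}/dmul (lin_sw _ _ (l1 _)); apply: eq_sw => y1 y2.
      by rewrite /dmul (lin_sw _ _ (l2 _)).
    by rewrite dsw_sw; apply: eq_sw => y1 y2; rewrite dsw_sw.
  by rewrite dsw_sw; apply: eq_sw => y1 y2; rewrite dsw_sw.
have actE x1 x2 y1 y2 : dsw F (fun p r => dsw G (fun p' r' =>
     b (dact y2 (delt p') (delt p y1)) (dact x2 (delt r') (delt r x1)))) =
   sw (dact (x2 * y2) (dfun G) (dfun F (x1 * y1))) b.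
  rewrite (dsw_delt F x1 y1 (b := fun a c => dsw G (fun p' r' =>
     b (dact y2 (delt p') a) (dact x2 (delt r') c)))); [|lin|lin].
  set u := dfun F _.
  pose Q a1 a2 m b2 c' := sw (dfun G (t c' * x2 * m * y2 * a1)) (fun v w => b (a2 * v) (b2 * w)).
  transitivity (sw u (fun a b => sw a (fun v c => sw v (fun a1 a2 => sw b (fun v' c' =>
      sw v' (fun b1 b2 => Q a1 a2 (b1 * t c) b2 c')))))).
    apply: eq_sw => a c.
    transitivity (dsw G (fun p r => sw a (fun v c0 => sw v (fun a1 a2 => sw c (fun v' c' =>
      sw v' (fun b1 b2 => b (a2 * delt p (t c0 * y2 * a1)) (b2 * delt r (t c' * x2 * b1)))))))).
      apply: eq_dsw => p r; rewrite {1}/dact (lin_sw _ _ (l1 _)); apply: eq_sw => v c0.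
      rewrite (lin_sw _ _ (l1 _)); apply: eq_sw => a1 a2.
      rewrite /dact (lin_sw _ _ (l2 _)); apply: eq_sw => v' c'.
      by rewrite (lin_sw _ _ (l2 _)).
    rewrite dsw_sw; apply: eq_sw => v c0; rewrite dsw_sw; apply: eq_sw => a1 a2.
    rewrite dsw_sw; apply: eq_sw => v' c'; rewrite dsw_sw; apply: eq_sw => b1 b2.
    rewrite (dsw_delt G _ _ (b := fun v w => b (a2 * v) (b2 * w))); [|lin|lin].
    by rewrite /Q !mulrA.
  rewrite contract_skew; try (rewrite /Q; lin).
  rewrite /dact (lin_sw _ _ (f := fun z => sw z b)); last lin.
  apply: eq_sw => v c; rewrite (lin_sw _ _ (f := fun z => sw z b)); last lin.
  apply: eq_sw => a m; rewrite sw_mul //; apply: eq_sw => a2 b2.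
  by rewrite /Q mulr1 !mulrA.
under eq_sw => y1 y2 do under eq_sw => x1 x2 do rewrite actE.
rewrite sw_exch /dmul (lin_sw _ _ (f := fun z => sw z b)); last lin.
by rewrite sw_mul //; lin.
Qed.

Lemma DD_comulM F G : comul D (amul D F G) = tmul D (comul D F) (comul D G).
Proof.
apply/ffunP=> -[[y a] [x b]]; rewrite comul_DD comul_coord dfun_mul.
rewrite -(dsw_dmul F G (ebas T x) (ebas T y) (b := fun u v => u a * v b : k^o));
  [|by move=> *; apply: lin_coordl|by move=> *; apply: lin_coordr].
rewrite [RHS]ffunE; apply: eq_bigr => p _; apply: eq_bigr => r _.
rewrite scaler_sumr; apply: eq_bigr => p' _; rewrite scaler_sumr; apply: eq_bigr => r' _.
by rewrite scalerA !dmul_delt [LHS]mulrA.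
Qed.

Lemma dfun_one : dfun (aone D) =1 dun.
Proof.
move=> z; rewrite (lin_basis (lin_dfun _) z) (lin_basis lin_dun z).
apply: eq_bigr => l _; congr (_ *: _); rewrite dfun_ebas /dun [RHS]halg_basis.
apply: eq_bigr => j _; congr (_ *: _).
by rewrite (linfZ (@linf_coord _ _ T j)) !ffunE /= eps_ebas.
Qed.

Lemma counit_DD F : counit D F = eps (dfun F 1).
Proof.
rewrite /dfun (linf_sum _ _ _ (@linf_eps _ _ T)); apply: eq_bigr => p _.
by rewrite (linfZ (@linf_eps _ _ T)) /delt (linfZ (@linf_eps _ _ T)) eps_ebas ffunE.
Qed.

Lemma DD_mulA F G K : amul D (amul D F G) K = amul D F (amul D G K).
Proof.
apply: dfun_inj => z; rewrite !dfun_mul.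
transitivity (dmul (dmul (dfun F) (dfun G)) (dfun K) z).
  by apply: eq_sw => z1 z2; rewrite dfun_mul.
rewrite dmulA //; try exact: lin_dfun.
apply: eq_sw => z1 z2; rewrite /dact; apply: eq_sw => *; apply: eq_sw => *.
by rewrite dfun_mul.
Qed.

Lemma DD_mul1 F : amul D (aone D) F = F /\ amul D F (aone D) = F.
Proof.
split; apply: dfun_inj => z; rewrite dfun_mul.
  rewrite -[RHS]dmul1f; last exact: lin_dfun.
  by apply: eq_sw => z1 z2; rewrite dfun_one.
rewrite -[RHS]dmulf1; last exact: lin_dfun.
apply: eq_sw => z1 z2; rewrite /dact; apply: eq_sw => *; apply: eq_sw => *.
by rewrite dfun_one.
Qed.

Lemma DD_comul1 : comul D (aone D) = tens (aone D) (aone D).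
Proof.
apply/ffunP=> -[[y a] [x b]]; rewrite comul_DD dfun_one /dun epsM [RHS]ffunE /=.
rewrite comul_coord (linZ (@lin_swl _ _ _ _ _)) sw_one;
  [|by move=> *; apply: lin_coordl|by move=> *; apply: lin_coordr].
by rewrite !eps_ebas !ffunE /= [counitc T x * _]mulrC; apply: mulrACA.
Qed.

(** The counit evaluates at 1 and applies eps. At y = 1 the cross relation puts S^-1(c) a inside G,
    and once eps has absorbed the middle leg this collapses to eps(u). *)
Lemma DD_counitM F G : counit D (amul D F G) = counit D F * counit D G.
Proof.
rewrite !counit_DD dfun_mul /dmul sw_one; [|lin|lin].
set u := dfun F 1.
have lg : lin (fun z => (eps (dfun G z) : k^o)).
  exact: (linf_comp (@linf_eps _ _ T) (lin_dfun G)).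
transitivity (sw u (fun v c => eps (dfun G (t c * v)) : k^o)).
  have le : lin (fun z : halg T => (eps z : k^o)) by exact: linf_eps.
  rewrite /dact (lin_sw _ _ le); apply: (@eq_sw _ _ _ k^o) => v c; rewrite (lin_sw _ _ le).
  rewrite -(sw_counitr coT v (f := fun v => (eps (dfun G (t c * v)) : k^o))); last first.
    exact: (lin_comp lg (lin_mull _ (@lin_id _ _))).
  by apply: (@eq_sw _ _ _ k^o) => a b; rewrite epsM mulr1.
rewrite -(lin_sw _ _ lg) (sw_skewl coT aS SSb SbS) (linZ lg).
by [].
Qed.

Lemma DD_counit1 : counit D (aone D) = 1.
Proof. by rewrite counit_DD dfun_one /dun eps1 scale1r eps1. Qed.

Definition DDb : bialgebra k (J * J)%type :=
  Bialgebra DD_mulA DD_mul1 DD_comulM DD_comul1 DD_counitM DD_counit1.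
End Double.

(** * Subalgebras and presentations *)

Section Closure.
Variables (k : fieldType) (B : algType k).

(** Words grow by left multiplication with generators, as in the induction principle [generates];
    closure under all products is [cl_mul]. *)
Inductive cl (gs : seq B) : B -> Prop :=
| cl1 : cl gs 1
| clD u v : cl gs u -> cl gs v -> cl gs (u + v)
| clZ c u : cl gs u -> cl gs (c *: u)
| clM g u : g \in gs -> cl gs u -> cl gs (g * u).

Lemma cl0 gs : cl gs 0.
Proof. by rewrite -(scale0r 1); apply/clZ/cl1. Qed.

Lemma cl_mul gs u v : cl gs u -> cl gs v -> cl gs (u * v).
Proof.
move=> cu cv; elim: cu => [|{}u u' _ IH _ IH'|c {}u _ IH|g {}u gg _ IH].
- by rewrite mul1r.
- by rewrite mulrDl; apply: clD.
- by rewrite -scalerAl; apply: clZ.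
- by rewrite -mulrA; apply: clM.
Qed.

Lemma cl_gen gs g : g \in gs -> cl gs g.
Proof. by move=> gg; rewrite -(mulr1 g); apply: clM => //; apply: cl1. Qed.

Lemma cl_sub gs gs' u : {subset gs <= gs'} -> cl gs u -> cl gs' u.
Proof.
move=> sub; elim=> {u} [|u v _ IH _ IH'|c u _ IH|g u gg _ IH].
- exact: cl1.
- exact: clD.
- exact: clZ.
- by apply: clM => //; apply: sub.
Qed.

Definition pshape (P : B -> Prop) (y : B) (N : nat) (u : B) : Prop :=
  exists2 w : nat -> B, (forall l, P (w l)) & u = \sum_(l < N) w l * y ^+ l.

Section Shape.
Variables (gs : seq B) (y : B) (N : nat) (c : k).
Hypotheses (N_gt0 : (0 < N)%N) (yN : y ^+ N = c *: 1).
Hypothesis ygs : forall g, g \in gs -> exists d r, cl gs r /\ y * g = d *: (g * y) + r.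

Lemma shapeD u v : pshape (cl gs) y N u -> pshape (cl gs) y N v -> pshape (cl gs) y N (u + v).
Proof.
move=> [w cw ->] [w' cw' ->]; exists (fun l => w l + w' l) => [l|]; first exact: clD.
by rewrite -big_split; apply: eq_bigr => l _ /=; rewrite mulrDl.
Qed.

Lemma shapeZ d u : pshape (cl gs) y N u -> pshape (cl gs) y N (d *: u).
Proof.
move=> [w cw ->]; exists (fun l => d *: w l) => [l|]; first exact: clZ.
by rewrite scaler_sumr; apply: eq_bigr => l _ /=; rewrite scalerAl.
Qed.

Lemma shape_term w l : cl gs w -> pshape (cl gs) y N (w * y ^+ l).
Proof.
move: {2}(l %/ N)%N (leqnn (l %/ N)) => d; elim: d l => [|d IH] l ld cw.
  have lN : (l < N)%N by move: ld; rewrite leqn0 -leqn0 leqNgt divn_gt0 // -ltnNge.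
  exists (fun l' => if l' == l then w else 0) => [l'|]; first by case: ifP => // _; apply: cl0.
  rewrite (bigD1 (Ordinal lN)) //= eqxx big1 ?addr0 // => i /negbTE il.
  by rewrite -val_eqE /= in il; rewrite il mul0r.
have [lN|Nl] := ltnP l N; first by apply: IH => //; rewrite divn_small.
rewrite -(subnK Nl) exprD yN -scalerAr -scalerAr mulr1; apply: shapeZ; apply: IH => //.
by rewrite -ltnS (leq_trans _ ld) // -{2}(subnK Nl) divnDr // divnn N_gt0 addn1.
Qed.

Lemma cl_comm w : cl gs w -> exists w' w'', [/\ cl gs w', cl gs w'' & y * w = w' * y + w''].
Proof.
elim=> {w} [|u v _ [u1 [u2 [h1 h2 e]]] _ [v1 [v2 [h3 h4 e']]]|d u _ [u1 [u2 [h1 h2 e]]]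
           |g u gg cu [u1 [u2 [h1 h2 e]]]].
- by exists 1, 0; split; [exact: cl1 | exact: cl0 | rewrite mulr1 mul1r addr0].
- exists (u1 + v1), (u2 + v2); split; try exact: clD.
  by rewrite mulrDr e e' mulrDl addrACA.
- exists (d *: u1), (d *: u2); split; try exact: clZ.
  by rewrite -scalerAr e scalerDr -scalerAl.
- case: (ygs gg) => d [r [cr eg]]; exists (d *: (g * u1)), (d *: (g * u2) + r * u); split.
  + exact/clZ/clM.
  + by apply: clD; [exact/clZ/clM | exact: cl_mul].
  + by rewrite mulrA eg mulrDl -scalerAl -mulrA e mulrDr scalerDr -!scalerAl !mulrA addrA.
Qed.

(** An Ore-type argument: y moves to the right past each generator at the cost of a remainder
    without y, and high powers are cut by y^N = c. Here c = 1 serves group-like generators and c = 0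
    nilpotent ones; the remainder is there for x X = q X x + a (1 - H h). *)
Lemma cl_shape u : cl (y :: gs) u -> pshape (cl gs) y N u.
Proof.
have sh0 : pshape (cl gs) y N 0 by rewrite -(mul0r (y ^+ 0)); apply/shape_term/cl0.
elim=> {u} [|u v _ IH _ IH'|d u _ IH|g u].
- by rewrite -(mulr1 1) -{2}(expr0 y); apply/shape_term/cl1.
- exact: shapeD.
- exact: shapeZ.
rewrite inE => /orP[/eqP-> | gg] _ [w cw ->]; rewrite mulr_sumr.
  apply: (big_ind (pshape (cl gs) y N)) => //; first exact: shapeD.
  move=> l _; have [w' [w'' [c1 c2 e]]] := cl_comm (cw l).
  rewrite mulrA e mulrDl -mulrA -exprS; apply: shapeD; exact: shape_term.
apply: (big_ind (pshape (cl gs) y N)) => //; first exact: shapeD.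
by move=> l _; rewrite mulrA; apply/shape_term/clM.
Qed.

Definition spans (E : finType) (e : E -> B) (P : B -> Prop) :=
  forall u, P u -> exists c : E -> k, u = \sum_i c i *: e i.

(** Adjoining one generator at a time gives spanning sets of ordered monomials, hence upper bounds
    on dimensions. *)
Lemma spans_cons (E : finType) (e : E -> B) : spans e (cl gs) ->
  spans (fun p : E * 'I_N => e p.1 * y ^+ p.2) (cl (y :: gs)).
Proof.
move=> se u /cl_shape[w cw ->].
apply: (big_ind (fun u => exists d : E * 'I_N -> k, u = \sum_p d p *: (e p.1 * y ^+ p.2))).
- by exists (fun=> 0); rewrite big1 // => p _; rewrite scale0r.
- move=> _ _ [d ->] [d' ->]; exists (fun p => d p + d' p); rewrite -big_split.
  by apply: eq_bigr => p _ /=; rewrite scalerDl.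
- move=> l _; have [d ->] := se _ (cw l).
  exists (fun p => (l == p.2)%:R * d p.1).
  rewrite -(pair_bigA _ (fun i l' => ((l == l')%:R * d i) *: (e i * y ^+ l'))) /= mulr_suml.
  apply: eq_bigr => i _; rewrite -scalerAl.
  rewrite -(sum_delta l (fun l' : 'I_N => d i *: (e i * y ^+ l'))).
  by apply: eq_bigr => l' _; rewrite scalerA.
Qed.
End Shape.

Lemma spans_nil : spans (fun _ : 'I_1 => 1 : B) (cl [::]).
Proof.
move=> u; elim=> {u} [|u v _ [c ->] _ [d ->]|a u _ [c ->]|//].
- by exists (fun=> 1); rewrite big_ord1 scale1r.
- by exists (fun i => c i + d i); rewrite !big_ord1 scalerDl.
- by exists (fun i => a * c i); rewrite !big_ord1 scalerA.
Qed.
End Closure.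

(** * Algebra maps, group-like and skew-primitive elements *)

Section AlgMaps.
Variables (k : fieldType) (I : finType) (A : bialgebra k I).

Definition algmor (B : algType k) (f : halg A -> B) : Prop :=
  [/\ lin f, {morph f : u v / u * v} & f 1 = 1].

Lemma algmor_lin (B : algType k) (f : halg A -> B) : algmor f -> lin f.
Proof. by case. Qed.

Lemma algmorX (B : algType k) (f : halg A -> B) u e : algmor f -> f (u ^+ e) = f u ^+ e.
Proof. by case=> _ fM f1; elim: e => [|e IH]; rewrite ?expr0 // !exprS fM IH. Qed.

Lemma generates_cl (gens : seq (halg A)) : generates A gens -> forall u, cl gens u.
Proof.
move=> G; exact: (G (cl gens) (@cl1 k (halg A) gens) (@clD k (halg A) gens)
  (@clZ k (halg A) gens) (@clM k (halg A) gens)).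
Qed.

Lemma algmor_ext (B : algType k) (gens : seq (halg A)) (f g : halg A -> B) :
  (forall u, cl gens u) -> algmor f -> algmor g -> {in gens, f =1 g} -> f =1 g.
Proof.
move=> G [lf fM f1] [lg gM g1] e u.
elim: (G u) => {u} [|u v _ IH _ IH'|c u _ IH|h u hh _ IH].
- by rewrite f1 g1.
- by rewrite !linD // IH IH'.
- by rewrite !linZ // IH.
- by rewrite fM gM IH e.
Qed.

Lemma presents_mor (gens : seq (halg A)) rels (B : algType k) (bs : seq B) :
  presents A gens rels -> size bs = size gens -> rels (asig B) bs ->
  exists f : halg A -> B, algmor f /\ map f gens = bs.
Proof.
move=> [_ _ U] sz r; have [f [fD fZ fM f1 e]] := U B bs sz r.
exists f; split=> //; split=> // c u v.
by rewrite -fZ -fD.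
Qed.

(** Stated through all bilinear contractions, so that a hypothesis [grouplike g] rewrites [sw g]
    directly; [skewprim] follows the same pattern. *)
Definition grouplike (g : halg A) : Prop :=
  forall (V : lmodType k) (b : halg A -> halg A -> V),
    (forall y, lin (b^~ y)) -> (forall x, lin (b x)) -> sw g b = b g g.

Definition skewprim (g y : halg A) : Prop :=
  forall (V : lmodType k) (b : halg A -> halg A -> V),
    (forall y, lin (b^~ y)) -> (forall x, lin (b x)) -> sw y b = b y g + b 1 y.

Lemma grouplikeP g : comul A g = tens g g -> grouplike g.
Proof. by move=> e V b l1 l2; apply: sw_tens. Qed.

Lemma skewprimP g y : comul A y = tens y g + tens (aone A) y -> skewprim g y.
Proof. by move=> e V b l1 l2; apply: sw_tens2. Qed.

(** The counit law reads eps(g) g = g. *)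
Lemma eps_grouplike g : coalgebra A -> g != 0 -> grouplike g -> eps g = 1.
Proof.
move=> coA g0 gg; apply/eqP; rewrite -subr_eq0; apply: contraNT g0 => e.
have := sw_counitl coA g (@lin_id _ _); rewrite gg; [|lin|lin].
move/eqP; rewrite -subr_eq0 -[X in _ - X]scale1r -scalerBl scaler_eq0 => /orP[|//].
by rewrite (negbTE e).
Qed.

(** The counit law reads eps(y) g + y = y. *)
Lemma eps_skewprim g y : coalgebra A -> g != 0 -> skewprim g y -> eps y = 0.
Proof.
move=> coA g0 yy; have := sw_counitl coA y (@lin_id _ _); rewrite yy; [|lin|lin].
rewrite eps1 scale1r => /eqP; rewrite -subr_eq0 addrK scaler_eq0 (negbTE g0) orbF.
by move/eqP.
Qed.
End AlgMaps.

Lemma unit_neq0 (R : nzRingType) (u : R) e : (0 < e)%N -> u ^+ e = 1 -> u != 0.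
Proof.
move=> e0 ue; apply/eqP=> u0; move: ue; rewrite u0 expr0n gtn_eqF //= => /esym/eqP.
by rewrite oner_eq0.
Qed.

(** * Compatibility with coproducts, checked on generators *)

Section Iso.
Variables (k : fieldType) (I J : finType) (A : bialgebra k I) (B : bialgebra k J).
Variable f : halg A -> halg B.

(** Compatibility with the coproduct at one element: for an algebra map, the elements satisfying it
    form a subalgebra, which is how it spreads from the generators. *)
Definition comul_at (u : halg A) : Prop :=
  forall (V : lmodType k) (b : halg B -> halg B -> V),
    (forall y, lin (b^~ y)) -> (forall x, lin (b x)) ->
    sw (f u) b = sw u (fun x y => b (f x) (f y)).

Lemma tmapf_coord u i j :
  tmapf f (comul A u) (i, j) = sw u (fun x y => f x i * f y j : k^o).
Proof.
rewrite /tmapf sum_ffunE /sw /tapp pair_bigA; apply: eq_bigr => -[a b] _ /=.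
by rewrite !ffunE.
Qed.

Lemma comul_atP u : comul_at u -> comul B (f u) = tmapf f (comul A u).
Proof.
move=> cu; apply/ffunP=> -[i j]; rewrite comul_coord tmapf_coord cu //.
  by move=> y; apply: lin_coordl.
by move=> x; apply: lin_coordr.
Qed.

Lemma comul_atE u : comul B (f u) = tmapf f (comul A u) -> comul_at u.
Proof.
move=> e V b l1 l2; rewrite {1}/sw e.
have tS (T : finType) (t : T -> tensor k J) (r : seq T) :
    tapp (A := B) (\sum_(i <- r) t i) b = \sum_(i <- r) tapp (A := B) (t i) b.
  apply: (big_morph (fun t => tapp (A := B) t b)) => [x y|]; first exact: tappD.
  by rewrite /tapp big1 // => i _; rewrite big1 // => j _; rewrite ffunE scale0r.
rewrite /tmapf tS [RHS]/sw [RHS]/tapp [RHS]pair_bigA; apply: eq_bigr => -[i j] _ /=.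
rewrite -(tapp_tens (f (ebas A i)) (f (ebas A j)) l1 l2) /tapp scaler_sumr.
apply: eq_bigr => a _; rewrite scaler_sumr; apply: eq_bigr => c _.
by rewrite scalerA !ffunE.
Qed.

Hypothesis fm : algmor f.

Lemma comul_at_ind gens : (forall u, cl gens u) -> (forall g, g \in gens -> comul_at g) ->
  forall u, comul_at u.
Proof.
move=> G cg u V b l1 l2; have [lf fM f1] := fm.
elim: (G u) V b l1 l2 => {u} [|u v _ IH _ IH'|c u _ IH|g u gg _ IH] V b l1 l2.
- by rewrite f1 !sw_one ?f1 //; lin.
- by rewrite linD // !(linD (lin_swl _)) IH // IH'.
- by rewrite linZ // !(linZ (lin_swl _)) IH.
- rewrite fM sw_mul // cg //; [|lin|lin].
  rewrite sw_mul; [|lin|lin]; apply: eq_sw => x y.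
  by rewrite IH; [|lin|lin]; apply: eq_sw => z w; rewrite !fM.
Qed.

Lemma comul_at_grouplike g : grouplike g -> grouplike (f g) -> comul_at g.
Proof.
by move=> gg gf V b l1 l2; have lf := algmor_lin fm; rewrite gf // gg //; lin.
Qed.

Lemma comul_at_skewprim g y : skewprim g y -> skewprim (f g) (f y) -> comul_at y.
Proof.
move=> gg gf V b l1 l2; have [lf _ f1] := fm.
by rewrite gf // gg ?f1 //; lin.
Qed.

Lemma HopfIso_mor (h x H X : halg A) :
  (forall u, cl [:: h; x; H; X] u) -> bijective f ->
  grouplike h -> grouplike H -> skewprim h x -> skewprim H X ->
  grouplike (f h) -> grouplike (f H) -> skewprim (f h) (f x) -> skewprim (f H) (f X) ->
  eps (f h) = eps h -> eps (f H) = eps H -> eps (f x) = eps x -> eps (f X) = eps X ->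
  HopfIso A B.
Proof.
move=> G bf gh gH sx sX gfh gfH sfx sfX eh eH ex eX; have [lf fM f1] := fm.
exists f; split=> //; split; first exact: (linD lf).
split; first exact: (linZ lf).
split; first exact: fM.
split; first exact: f1.
split=> u.
  apply/comul_atP/(comul_at_ind G) => g; rewrite !inE.
  case/or4P=> /eqP->; [exact: comul_at_grouplike | exact: comul_at_skewprim sx sfx
    | exact: comul_at_grouplike | exact: comul_at_skewprim sX sfX].
change (eps (f u) = eps (u : halg A)).
elim: (G u) => {u} [|u v _ IH _ IH'|c u _ IH|g u gg _ IH].
- by rewrite f1 !eps1.
- by rewrite linD // !(linfD (@linf_eps _ _ _)) IH IH'.
- by rewrite linZ // !(linfZ (@linf_eps _ _ _)) IH.
- rewrite fM !epsM IH; congr (_ * _); move: gg; rewrite !inE.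
  by case/or4P=> /eqP->.
Qed.
End Iso.

Section FromIso.
Variables (k : fieldType) (I J : finType) (A : bialgebra k I) (B : bialgebra k J).

Lemma HopfIsoE : HopfIso A B -> exists f : halg A -> halg B,
  [/\ algmor f, injective f & forall u, comul_at f u].
Proof.
case=> f [bf [fD [fZ [fM [f1 [fc _]]]]]]; exists f; split.
- by split=> // c u v; rewrite fD fZ.
- exact: bij_inj.
- by move=> u; apply: comul_atE.
Qed.

Variable f : halg A -> halg B.
Hypotheses (fm : algmor f) (fc : forall u, comul_at f u).

Lemma grouplike_mor g : grouplike g -> grouplike (f g).
Proof.
by move=> gg V b l1 l2; have lf := algmor_lin fm; rewrite fc // gg //; lin.
Qed.

Lemma skewprim_mor g y : skewprim g y -> skewprim (f g) (f y).
Proof.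
by move=> gg V b l1 l2; have [lf _ f1] := fm; rewrite fc // gg ?f1 //; lin.
Qed.
End FromIso.

(** * Two-by-two matrices *)

Section Mx2.
Variable k : fieldType.

Definition mx2 (a b c d : k) : 'M[k]_2 :=
  \matrix_(i, j) if i == 0 then if j == 0 then a else b else if j == 0 then c else d.

Lemma mx2E (M : 'M[k]_2) : M = mx2 (M 0 0) (M 0 1) (M 1 0) (M 1 1).
Proof.
apply/matrixP=> i j; rewrite mxE.
case: i => [[|[|//]] li]; case: j => [[|[|//]] lj] /=; congr (M _ _); exact: val_inj.
Qed.

Lemma mx2M a b c d a' b' c' d' : mx2 a b c d * mx2 a' b' c' d' =
  mx2 (a * a' + b * c') (a * b' + b * d') (c * a' + d * c') (c * b' + d * d').
Proof. by rewrite [LHS]mx2E !mxE !big_ord_recl !big_ord0 !mxE /= !addr0. Qed.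

Lemma mx2Z e a b c d : e *: mx2 a b c d = mx2 (e * a) (e * b) (e * c) (e * d).
Proof. by rewrite [LHS]mx2E !mxE. Qed.

Lemma mx2D a b c d a' b' c' d' :
  mx2 a b c d + mx2 a' b' c' d' = mx2 (a + a') (b + b') (c + c') (d + d').
Proof. by rewrite [LHS]mx2E !mxE. Qed.

Lemma mx2_1 : 1 = mx2 1 0 0 1.
Proof. by rewrite [LHS]mx2E !mxE. Qed.

Lemma mx2_0 : 0 = mx2 0 0 0 0.
Proof. by rewrite [LHS]mx2E !mxE. Qed.

Lemma mx2_diagX a d e : mx2 a 0 0 d ^+ e = mx2 (a ^+ e) 0 0 (d ^+ e).
Proof.
elim: e => [|e IH]; first by rewrite !expr0 mx2_1.
by rewrite !exprS IH mx2M !mulr0 !mul0r !addr0 !add0r.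
Qed.

Lemma nilp_exp (R : nzRingType) (u : R) e : (2 <= e)%N -> u * u = 0 -> u ^+ e = 0.
Proof. by case: e => [|[|e]] // _ uu; rewrite !exprS mulrA uu mul0r. Qed.

Lemma mx2_upX b e : (2 <= e)%N -> mx2 0 b 0 0 ^+ e = 0.
Proof. by move=> e2; apply: nilp_exp => //; rewrite mx2M !mulr0 !mul0r !addr0 -mx2_0. Qed.

Lemma mx2_loX c e : (2 <= e)%N -> mx2 0 0 c 0 ^+ e = 0.
Proof. by move=> e2; apply: nilp_exp => //; rewrite mx2M !mulr0 !mul0r !addr0 -mx2_0. Qed.
End Mx2.

Section Relations.
Variables (k : fieldType) (B : algType k).

Lemma spow_asig (v : asig B) e : spow v e = (v : B) ^+ e.
Proof. by elim: e => [|e IH]; rewrite ?expr0 // exprS -IH. Qed.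

Lemma T_relsP n m (qb q s : k) (h x H X : B) :
  @T_rels k n m qb q s (asig B) [:: h; x; H; X] <->
  h ^+ m = 1 /\ H ^+ n = 1 /\ x ^+ m = 0 /\ X ^+ n = 0 /\
  x * h = q *: (h * x) /\ X * H = qb *: (H * X) /\ x * H = s *: (H * x) /\
  h * X = s *: (X * h) /\ x * X = s *: (X * x) /\ h * H = H * h.
Proof. by rewrite /T_rels !spow_asig. Qed.

Lemma Q_relsP n (q a : k) (h x H X : B) :
  @Q_rels k n q a (asig B) [:: h; x; H; X] <->
  h ^+ n = 1 /\ H ^+ n = 1 /\ x ^+ n = 0 /\ X ^+ n = 0 /\
  x * h = q *: (h * x) /\ X * H = q ^+ n.-1 *: (H * X) /\ x * H = q *: (H * x) /\
  h * X = q *: (X * h) /\ x * X = q *: (X * x) + (a *: 1 + (- a) *: (H * h)) /\ h * H = H * h.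
Proof. by rewrite /Q_rels !spow_asig. Qed.

Lemma Taft_relsP m (q : k) (h x : B) :
  @Taft_rels k m q (asig B) [:: h; x] <-> [/\ h ^+ m = 1, x ^+ m = 0 & x * h = q *: (h * x)].
Proof. by rewrite /Taft_rels !spow_asig. Qed.
End Relations.

(** * Triangular representations and convolution operators *)

Section TriangularRep.
Variables (k : fieldType) (I : finType) (A : bialgebra k I).

(* u |-> [[al u, xi u], [0, be u]] is an algebra map *)
Record trirep (al xi be : halg A -> k) : Prop := TriRep {
  tr_la : linf al; tr_lx : linf xi; tr_lb : linf be;
  tr_a1 : al 1 = 1; tr_x1 : xi 1 = 0; tr_b1 : be 1 = 1;
  tr_aM : forall u v, al (u * v) = al u * al v;
  tr_bM : forall u v, be (u * v) = be u * be v;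
  tr_xM : forall u v, xi (u * v) = al u * xi v + xi u * be v }.

Lemma trirep_of_mor gens (f : halg A -> 'M[k]_2) : (forall u, cl gens u) -> algmor f ->
  (forall g, g \in gens -> f g 1 0 = 0) ->
  trirep (fun u => f u 0 0) (fun u => f u 0 1) (fun u => f u 1 1).
Proof.
move=> G [lf fM f1] tg.
have tri u : f u 1 0 = 0.
  elim: (G u) => {u} [|u v _ IH _ IH'|c u _ IH|g u gg _ IH].
  - by rewrite f1 mxE.
  - by rewrite linD // mxE IH IH' addr0.
  - by rewrite linZ // mxE IH mulr0.
  - by rewrite fM [f g]mx2E [f u]mx2E mx2M mxE /= IH tg // mul0r mulr0 addr0.
have lE i j : linf (fun u => f u i j) by move=> c u v; rewrite lf !mxE.
split=> //; try by rewrite f1 mxE.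
- by move=> u v; rewrite fM {1}[f u]mx2E {1}[f v]mx2E mx2M mxE /= tri mulr0 addr0.
- by move=> u v; rewrite fM {1}[f u]mx2E {1}[f v]mx2E mx2M mxE /= tri mul0r add0r.
- by move=> u v; rewrite fM {1}[f u]mx2E {1}[f v]mx2E mx2M mxE.
Qed.

Lemma char_ext gens (al be : halg A -> k) : (forall u, cl gens u) ->
  linf al -> linf be -> al 1 = 1 -> be 1 = 1 ->
  (forall u v, al (u * v) = al u * al v) -> (forall u v, be (u * v) = be u * be v) ->
  {in gens, al =1 be} -> al =1 be.
Proof.
move=> G la lb a1 b1 aM bM e u.
elim: (G u) => {u} [|u v _ IH _ IH'|c u _ IH|g u gg _ IH].
- by rewrite a1 b1.
- by rewrite !linfD // IH IH'.
- by rewrite !linfZ // IH.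
- by rewrite aM bM IH e.
Qed.

Hypothesis coA : coalgebra A.

(** The right operator is multiplicative when f is a character and a twisted derivation when f is
    the corner entry [xi]. The left one recovers the group-like attached to a skew-primitive y:
    since xi(1) = 0, it sends y to xi(y) g. *)
Definition rconv (f : halg A -> k) (u : halg A) : halg A := sw u (fun a b => f b *: a).
Definition lconv (f : halg A -> k) (u : halg A) : halg A := sw u (fun a b => f a *: b).

Lemma lin_rconv f : lin (rconv f). Proof. exact: lin_swl. Qed.
Lemma lin_lconv f : lin (lconv f). Proof. exact: lin_swl. Qed.

Lemma rconv_eps : rconv (@eps _ _ A) =1 id.
Proof. by move=> u; rewrite /rconv (sw_counitr coA u (@lin_id _ _)). Qed.

Lemma rconvM (f : halg A -> k) : linf f -> (forall u v, f (u * v) = f u * f v) ->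
  forall u v, rconv f (u * v) = rconv f u * rconv f v.
Proof.
move=> lf fM u v; rewrite /rconv sw_mul; [|lin|lin].
rewrite (lin_sw _ _ (f := fun z => z * _)); last lin.
apply: eq_sw => a b; rewrite (lin_sw _ _ (f := fun z => _ * z)); last lin.
by apply: eq_sw => c d; rewrite fM -scalerAl -scalerAr scalerA.
Qed.

Lemma rconv_one (f : halg A -> k) : linf f -> rconv f 1 = f 1 *: 1.
Proof. by move=> lf; rewrite /rconv sw_one //; lin. Qed.

Lemma rconv_grouplike f g : linf f -> grouplike g -> rconv f g = f g *: g.
Proof. by move=> lf gg; rewrite /rconv gg //; lin. Qed.

Lemma rconv_skewprim f g y : linf f -> skewprim g y -> rconv f y = f g *: y + f y *: 1.
Proof. by move=> lf gg; rewrite /rconv gg //; lin. Qed.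

Lemma lconv_skewprim f g y : linf f -> skewprim g y -> lconv f y = f y *: g + f 1 *: y.
Proof. by move=> lf gg; rewrite /lconv gg //; lin. Qed.

Variables al xi be : halg A -> k.
Hypothesis tr : trirep al xi be.

(** The twisted Leibniz rule, inherited from the corner entry of a product of triangular
    matrices. *)
Lemma rconv_trirep u v :
  rconv xi (u * v) = rconv al u * rconv xi v + rconv xi u * rconv be v.
Proof.
have [[la lx] lb] := (tr_la tr, tr_lx tr, tr_lb tr).
rewrite /rconv sw_mul; [|lin|lin].
rewrite !(lin_sw u _ (f := fun z => z * _)); try lin.
rewrite -sw_add; apply: eq_sw => a b.
rewrite !(lin_sw v _ (f := fun z => _ * z)); try lin.
rewrite -sw_add; apply: eq_sw => c d.
by rewrite (tr_xM tr) scalerDl -!scalerA -!scalerAl -!scalerAr.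
Qed.

Lemma lconv_cl gens : (forall g, g \in gens -> grouplike g /\ xi g = 0) ->
  forall u, cl gens u -> lconv xi u = 0.
Proof.
have [[la lx] lb] := (tr_la tr, tr_lx tr, tr_lb tr).
move=> G u; elim=> {u} [|u v _ IH _ IH'|c u _ IH|g u gg _ IH].
- by rewrite /lconv sw_one; [rewrite (tr_x1 tr) scale0r|lin|lin].
- by rewrite (linD (lin_lconv _)) IH IH' addr0.
- by rewrite (linZ (lin_lconv _)) IH scaler0.
- have [gl xg] := G g gg; rewrite /lconv sw_mul; [|lin|lin]; rewrite gl; [|lin|lin].
  transitivity (al g *: (g * lconv xi u)); last by rewrite IH mulr0 scaler0.
  rewrite /lconv (lin_sw _ _ (f := fun z => al g *: (g * z))); last lin.
  by apply: eq_sw => a b; rewrite (tr_xM tr) xg mul0r addr0 -scalerA -scalerAr.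
Qed.

Lemma rconv_cl gens : (forall g, g \in gens -> rconv xi g = 0) ->
  forall u, cl gens u -> rconv xi u = 0.
Proof.
move=> G u; elim=> {u} [|u v _ IH _ IH'|c u _ IH|g u gg _ IH].
- by rewrite rconv_one ?(tr_x1 tr) ?scale0r //; apply: tr_lx tr.
- by rewrite (linD (lin_rconv _)) IH IH' addr0.
- by rewrite (linZ (lin_rconv _)) IH scaler0.
- by rewrite rconv_trirep IH (G _ gg) mulr0 mul0r addr0.
Qed.
End TriangularRep.

Definition qnum (k : fieldType) (q : k) (l : nat) : k := \sum_(i < l) q ^+ i.

(** Because (q - 1) [l]_q = q^l - 1, which is nonzero below the order of q. *)
Lemma qnum_neq0 (k : fieldType) (q : k) N l :
  N.-primitive_root q -> (0 < l < N)%N -> qnum q l != 0.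
Proof.
move=> pq /andP[l0 lN]; apply/eqP=> q0.
have := subrX1 q l; rewrite -/(qnum q l) q0 mulr0 => /eqP; rewrite subr_eq0.
by rewrite -(prim_order_dvd pq) gtnNdvd.
Qed.

(* q-Taylor expansion: D acts on the coefficients of y^l as the q-derivative *)
Section QDerivative.
Variables (k : fieldType) (B : algType k) (D : B -> B) (y : B) (q : k) (N : nat).
Variable K : B -> Prop.
Hypotheses (lD : lin D) (pq : N.-primitive_root q).
Hypothesis Dpow : forall w l, K w -> D (w * y ^+ l) = qnum q l *: (w * y ^+ l.-1).

Lemma iterD_lin j : lin (iter j D).
Proof. by elim: j => // j IH; apply: (lin_comp lD IH). Qed.

Lemma iterD_small w l j : K w -> (l < j)%N -> iter j D (w * y ^+ l) = 0.
Proof.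
move=> Kw; elim: l j => [|l IH] [|j] // lj; rewrite iterSr Dpow //.
  by rewrite /qnum big_ord0 scale0r (lin0 (iterD_lin _)).
by rewrite (linZ (iterD_lin _)) /= IH // scaler0.
Qed.

Lemma iterD_top w l : K w -> (l < N)%N ->
  exists2 c, c != 0 & iter l D (w * y ^+ l) = c *: w.
Proof.
move=> Kw; elim: l => [|l IH] lN.
  by exists 1; rewrite ?oner_eq0 //= expr0 mulr1 scale1r.
have [c c0 e] := IH (ltnW lN); exists (qnum q l.+1 * c).
  by rewrite mulf_neq0 // (qnum_neq0 pq).
by rewrite iterSr Dpow // (linZ (iterD_lin _)) /= e scalerA.
Qed.

Lemma shape_nilp u : pshape K y N u -> iter N D u = 0.
Proof.
case=> w Kw ->; rewrite (lin_sum _ _ _ (iterD_lin _)) big1 // => l _.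
exact: iterD_small.
Qed.

(** Coefficients are removed from the top: D^l kills all lower terms and multiplies the coefficient
    of y^l by a q-factorial, nonzero for l < N. Only the coefficient of y^0 survives. *)
Lemma shape_ker u : pshape K y N u -> D u = 0 -> K u.
Proof.
case=> w Kw ->.
suff main M : (M < N)%N -> D (\sum_(l < M.+1) w l * y ^+ l) = 0 ->
    K (\sum_(l < M.+1) w l * y ^+ l).
  have N0 := prim_order_gt0 pq; rewrite -(prednK N0); apply: main.
  by rewrite prednK.
elim: M => [|M IH] MN D0; first by rewrite big_ord1 expr0 mulr1.
have wM : w M.+1 = 0.
  have [c c0 e] := iterD_top (Kw M.+1) MN.
  have : iter M.+1 D (\sum_(l < M.+2) w l * y ^+ l) = 0.
    by rewrite iterSr D0 (lin0 (iterD_lin _)).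
  rewrite big_ord_recr /= -iterS (linD (iterD_lin _)) e (lin_sum _ _ _ (iterD_lin _)).
  rewrite big1 ?add0r => [/eqP|l _]; last exact: iterD_small.
  by rewrite scaler_eq0 (negbTE c0) => /eqP.
move: D0; rewrite big_ord_recr /= wM mul0r addr0 => D0.
by apply: IH => //; apply: ltnW.
Qed.
End QDerivative.

(** * Skew-primitive elements of T^sigma *)

Lemma trirep_eql (k : fieldType) (I : finType) (A : bialgebra k I)
    (al al' xi be : halg A -> k) : al =1 al' -> trirep al xi be -> trirep al' xi be.
Proof.
move=> e [la lx lb a1 x1 b1 aM bM xM]; split=> //.
- by move=> c u v; rewrite -!e la.
- by rewrite -e.
- by move=> u v; rewrite -!e aM.
- by move=> u v; rewrite -!e xM.
Qed.

(** The Leibniz rule with D y = 1; each passage of D past a factor y on its right costs q, the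
    eigenvalue of y under [rconv be], and these powers sum to [l]_q. *)
Lemma rconv_pow (k : fieldType) (I : finType) (A : bialgebra k I) (coA : coalgebra A)
    (xi be : halg A -> k) (q : k) (y w : halg A) l : trirep (@eps _ _ A) xi be ->
  rconv xi y = 1 -> rconv be y = q *: y -> rconv xi w = 0 ->
  rconv xi (w * y ^+ l) = qnum q l *: (w * y ^+ l.-1).
Proof.
move=> tr xy bey xw.
have pw : rconv xi (y ^+ l) = qnum q l *: y ^+ l.-1.
  elim: l => [|l IH].
    by rewrite /qnum big_ord0 scale0r expr0 rconv_one ?(tr_x1 tr) ?scale0r //; apply: tr_lx tr.
  have bl j : rconv be (y ^+ j) = q ^+ j *: y ^+ j.
    elim: j => [|j IHj].
      by rewrite !expr0 rconv_one ?(tr_b1 tr) //; apply: tr_lb tr.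
    rewrite !exprS rconvM; [|exact: tr_lb tr|exact: tr_bM tr].
    by rewrite bey IHj -scalerAl -scalerAr scalerA.
  rewrite exprS (rconv_trirep tr) (rconv_eps coA) IH xy bl mul1r -scalerAr.
  rewrite /qnum big_ord_recr /= scalerDl; case: l {IH bl} => [|l] /=.
    by rewrite big_ord0 !scale0r.
  by rewrite -exprS.
by rewrite (rconv_trirep tr) (rconv_eps coA) pw xw mul0r addr0 -scalerAr.
Qed.

Lemma cl_commute (k : fieldType) (B : algType k) (gs : seq B) (z : B) :
  (forall g, g \in gs -> z * g = g * z) -> forall u, cl gs u -> z * u = u * z.
Proof.
move=> G u; elim=> {u} [|u v _ IH _ IH'|c u _ IH|g u gg _ IH].
- by rewrite mulr1 mul1r.
- by rewrite mulrDr mulrDl IH IH'.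
- by rewrite -scalerAr -scalerAl IH.
- by rewrite mulrA G // -mulrA IH mulrA.
Qed.

(** A group-like is an eigenvector of [rconv xi] with eigenvalue xi(g), so nilpotency forces the
    eigenvalue to vanish. *)
Lemma grouplike_nilp (k : fieldType) (I : finType) (A : bialgebra k I)
    (xi : halg A -> k) (g : halg A) N : linf xi -> grouplike g -> g != 0 ->
  iter N (rconv xi) g = 0 -> xi g = 0.
Proof.
move=> lx gg g0.
have -> : iter N (rconv xi) g = xi g ^+ N *: g.
  elim: N => [|N IH]; first by rewrite expr0 scale1r.
  by rewrite iterS IH (linZ (lin_rconv _)) rconv_grouplike // scalerA exprSr.
by move/eqP; rewrite scaler_eq0 (negbTE g0) orbF expf_eq0 => /andP[_ /eqP].
Qed.

Section TaftProduct.
Variables (k : fieldType) (I : finType) (A : bialgebra k I).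
Variables (n m : nat) (qb q s : k) (h x H X : halg A).
Hypotheses (coA : coalgebra A) (m2 : (2 <= m)%N) (n2 : (2 <= n)%N).
Hypotheses (pq : m.-primitive_root q) (pqb : n.-primitive_root qb).
Hypotheses (sm : s ^+ m = 1) (sn : s ^+ n = 1).
Hypothesis pres : presents A [:: h; x; H; X] (@T_rels k n m qb q s).
Hypotheses (gh : grouplike h) (gH : grouplike H) (sx : skewprim h x) (sX : skewprim H X).

Lemma T_rel : h ^+ m = 1 /\ H ^+ n = 1 /\ x ^+ m = 0 /\ X ^+ n = 0 /\
  x * h = q *: (h * x) /\ X * H = qb *: (H * X) /\ x * H = s *: (H * x) /\
  h * X = s *: (X * h) /\ x * X = s *: (X * x) /\ h * H = H * h.
Proof. by apply/T_relsP; case: pres. Qed.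

Lemma T_cl u : cl [:: h; x; H; X] u.
Proof. by case: pres => _ G _; apply: generates_cl. Qed.

Let s0 : s != 0. Proof. by apply: unit_neq0 sn; apply: ltnW. Qed.

Lemma T_neq : h != H.
Proof.
(* The character h |-> q, H |-> 1, x, X |-> 0, written in scalar matrices. *)
have [||f [fm [fh fx fH fX]]] := presents_mor (B := 'M[k]_2)
  (bs := [:: mx2 q 0 0 q; 0; 1; 0]) pres; first by [].
  apply/T_relsP; rewrite mx2_diagX (prim_expr_order pq) -mx2_1 !expr1n !expr0n.
  by rewrite !gtn_eqF ?(ltnW m2) ?(ltnW n2) // !(mulr0, mul0r, scaler0, mulr1, mul1r).
apply/eqP=> e; move: fH; rewrite -e fh => /matrixP/(_ 0 0); rewrite !mxE /= => q1.
have := prim_order_dvd pq 1; rewrite expr1 q1 eqxx dvdn1 => /eqP m1.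
by move: m2; rewrite m1.
Qed.

(** With x sent to E12 and the upper diagonal entries of h and H equal to 1, the relations x h = q h
    x and x H = s H x force the lower entries q and s. The upper-left character is then the
    counit. *)
Lemma T_der_x : exists xi be : halg A -> k, [/\ trirep (@eps _ _ A) xi be,
  [/\ xi h = 0, xi x = 1, xi H = 0 & xi X = 0] &
  [/\ be h = q, be x = 0, be H = s & be X = 0]].
Proof.
have [||f [fm [fh fx fH fX]]] := presents_mor (B := 'M[k]_2)
  (bs := [:: mx2 1 0 0 q; mx2 0 1 0 0; mx2 1 0 0 s; 0]) pres; first by [].
  apply/T_relsP; rewrite !mx2_diagX mx2_upX // (prim_expr_order pq) sn !expr1n -mx2_1 !expr0n.
  rewrite gtn_eqF ?(ltnW n2) // !mulr0 !mul0r !scaler0 !mx2M !mx2Z.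
  by rewrite !(mulr0, mul0r, addr0, add0r, mulr1, mul1r) [s * q]mulrC.
have tr : trirep (fun u => f u 0 0) (fun u => f u 0 1) (fun u => f u 1 1).
  apply: (trirep_of_mor T_cl fm) => g; rewrite !inE.
  by case/or4P=> /eqP->; rewrite ?fh ?fx ?fH ?fX mxE.
exists (fun u => f u 0 1), (fun u => f u 1 1); split; last 2 first.
- by rewrite fh fx fH fX !mxE.
- by rewrite fh fx fH fX !mxE.
apply: (trirep_eql _ tr); apply: (char_ext T_cl).
- exact: tr_la tr.
- exact: linf_eps.
- exact: tr_a1 tr.
- exact: eps1.
- exact: tr_aM tr.
- exact: epsM.
have [hm [Hn _]] := T_rel.
have h0 : h != 0 by apply: unit_neq0 hm; apply: ltnW.
have H0 : H != 0 by apply: unit_neq0 Hn; apply: ltnW.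
move=> g; rewrite !inE; case/or4P=> /eqP->; rewrite ?fh ?fx ?fH ?fX !mxE /=.
- by rewrite eps_grouplike.
- by rewrite (eps_skewprim _ _ sx).
- by rewrite eps_grouplike.
- by rewrite (eps_skewprim _ _ sX).
Qed.

(** The mirror construction with X sent to E12. The inverse of s appears because h X = s X h has h
    on the left. *)
Lemma T_der_X : exists xi be : halg A -> k, [/\ trirep (@eps _ _ A) xi be,
  [/\ xi h = 0, xi x = 0, xi H = 0 & xi X = 1] &
  [/\ be h = s^-1, be x = 0, be H = qb & be X = 0]].
Proof.
have [||f [fm [fh fx fH fX]]] := presents_mor (B := 'M[k]_2)
  (bs := [:: mx2 1 0 0 s^-1; 0; mx2 1 0 0 qb; mx2 0 1 0 0]) pres; first by [].
  apply/T_relsP; rewrite !mx2_diagX mx2_upX // (prim_expr_order pqb) exprVn sm invr1 !expr1n -mx2_1 !expr0n.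
  rewrite gtn_eqF ?(ltnW m2) // !mulr0 !mul0r !scaler0 !mx2M !mx2Z.
  by rewrite !(mulr0, mul0r, addr0, add0r, mulr1, mul1r) divff // [qb * _]mulrC.
have tr : trirep (fun u => f u 0 0) (fun u => f u 0 1) (fun u => f u 1 1).
  apply: (trirep_of_mor T_cl fm) => g; rewrite !inE.
  by case/or4P=> /eqP->; rewrite ?fh ?fx ?fH ?fX mxE.
exists (fun u => f u 0 1), (fun u => f u 1 1); split; last 2 first.
- by rewrite fh fx fH fX !mxE.
- by rewrite fh fx fH fX !mxE.
apply: (trirep_eql _ tr); apply: (char_ext T_cl).
- exact: tr_la tr.
- exact: linf_eps.
- exact: tr_a1 tr.
- exact: eps1.
- exact: tr_aM tr.
- exact: epsM.
have [hm [Hn _]] := T_rel.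
have h0 : h != 0 by apply: unit_neq0 hm; apply: ltnW.
have H0 : H != 0 by apply: unit_neq0 Hn; apply: ltnW.
move=> g; rewrite !inE; case/or4P=> /eqP->; rewrite ?fh ?fx ?fH ?fX !mxE /=.
- by rewrite eps_grouplike.
- by rewrite (eps_skewprim _ _ sx).
- by rewrite eps_grouplike.
- by rewrite (eps_skewprim _ _ sX).
Qed.

Lemma T_x_neq0 : x != 0.
Proof.
have [xi [be [tr [_ xx _ _] _]]] := T_der_x.
by apply/eqP=> x0; move: xx; rewrite x0 (linf0 (tr_lx tr)) => /esym/eqP; rewrite oner_eq0.
Qed.

Lemma T_X_neq0 : X != 0.
Proof.
have [xi [be [tr [_ _ _ xx] _]]] := T_der_X.
by apply/eqP=> x0; move: xx; rewrite x0 (linf0 (tr_lx tr)) => /esym/eqP; rewrite oner_eq0.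
Qed.

(** Finite order makes g cancellable, and p <> 1 excludes skew-primitives commuting with g, such as
    1 - g. *)
Theorem T_skewprim (g y : halg A) (p : k) M : grouplike g -> (0 < M)%N -> g ^+ M = 1 ->
  skewprim g y -> y != 0 -> y * g = p *: (g * y) -> p != 1 ->
  [/\ g = h, p = q & exists2 a, a != 0 & y = a *: x] \/
  [/\ g = H, p = qb & exists2 b, b != 0 & y = b *: X].
Proof.
move=> gg M0 gM sy y0 yg p1.
have g0 : g != 0 := unit_neq0 M0 gM.
have [hm [Hn [xm [Xn [xh [XH [xH [hX [xX hH]]]]]]]]] := T_rel.
have gU u : g * u = 0 -> u = 0.
  by move=> e; rewrite -[u]mul1r -gM -(prednK M0) exprSr -mulrA e mulr0.
have [xi [be [tr [xih xix xiH xiX] [beh bex beH beX]]]] := T_der_x.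
have [xi' [be' [tr' [xih' xix' xiH' xiX'] [beh' bex' beH' beX']]]] := T_der_X.
have [[lx lb] [lx' lb']] := ((tr_lx tr, tr_lb tr), (tr_lx tr', tr_lb tr')).
have Dh : rconv xi h = 0 by rewrite rconv_grouplike // xih scale0r.
have DH : rconv xi H = 0 by rewrite rconv_grouplike // xiH scale0r.
have Dx : rconv xi x = 1 by rewrite (rconv_skewprim lx sx) xih xix scale0r add0r scale1r.
have DX : rconv xi X = 0 by rewrite (rconv_skewprim lx sX) xiH xiX !scale0r addr0.
have Ex : rconv be x = q *: x by rewrite (rconv_skewprim lb sx) beh bex scale0r addr0.
have Dh' : rconv xi' h = 0 by rewrite rconv_grouplike // xih' scale0r.
have DH' : rconv xi' H = 0 by rewrite rconv_grouplike // xiH' scale0r.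
have DX' : rconv xi' X = 1 by rewrite (rconv_skewprim lx' sX) xiH' xiX' scale0r add0r scale1r.
have Dx' : rconv xi' x = 0 by rewrite (rconv_skewprim lx' sx) xih' xix' !scale0r addr0.
have EX' : rconv be' X = qb *: X by rewrite (rconv_skewprim lb' sX) beH' beX' scale0r addr0.
have DK3 u : cl [:: X; h; H] u -> rconv xi u = 0.
  by apply: (rconv_cl tr) => z; rewrite !inE => /or3P[] /eqP->.
have DK u : cl [:: h; H] u -> rconv xi' u = 0.
  by apply: (rconv_cl tr') => z; rewrite !inE => /orP[] /eqP->.
(* Two expansions, first in powers of x over the subalgebra of X, h, H, then in powers of X over
   that of h, H; each kernel computation removes one variable. *)
have sh3 u : pshape (cl [:: X; h; H]) x m u.
  apply: (@cl_shape _ _ _ _ _ 0) => //; first exact: ltnW.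
  - by rewrite scale0r.
  - move=> z; rewrite !inE => /or3P[] /eqP->.
    + by exists s, 0; split; [exact: cl0 | rewrite addr0].
    + by exists q, 0; split; [exact: cl0 | rewrite addr0].
    + by exists s, 0; split; [exact: cl0 | rewrite addr0].
  - by apply: cl_sub (T_cl u) => z; rewrite !inE => /or4P[] /eqP->; rewrite eqxx ?orbT.
have sh2 u : cl [:: X; h; H] u -> pshape (cl [:: h; H]) X n u.
  apply: (@cl_shape _ _ _ _ _ 0); first exact: ltnW.
  - by rewrite scale0r.
  - move=> z; rewrite !inE => /orP[] /eqP->.
    + by exists s^-1, 0; split; [exact: cl0 | rewrite addr0 hX scalerA mulVf // scale1r].
    + by exists qb, 0; split; [exact: cl0 | rewrite addr0].
have P3 w l : cl [:: X; h; H] w -> rconv xi (w * x ^+ l) = qnum q l *: (w * x ^+ l.-1).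
  by move=> cw; apply: (rconv_pow coA l tr Dx Ex); apply: DK3.
have P2 w l : cl [:: h; H] w -> rconv xi' (w * X ^+ l) = qnum qb l *: (w * X ^+ l.-1).
  by move=> cw; apply: (rconv_pow coA l tr' DX' EX'); apply: DK.
have ker3 u : rconv xi u = 0 -> cl [:: X; h; H] u.
  exact: (shape_ker (@lin_rconv _ _ _ _) pq P3).
have ker2 u : cl [:: X; h; H] u -> rconv xi' u = 0 -> cl [:: h; H] u.
  by move=> /sh2; apply: (shape_ker (@lin_rconv _ _ _ _) pqb P2).
have xig : xi g = 0.
  apply: (grouplike_nilp (N := m) lx gg g0).
  exact: (shape_nilp (@lin_rconv _ _ _ _) P3).
have g3 : cl [:: X; h; H] g by apply: ker3; rewrite rconv_grouplike // xig scale0r.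
have xig' : xi' g = 0.
  apply: (grouplike_nilp (N := n) lx' gg g0).
  exact: (shape_nilp (@lin_rconv _ _ _ _) P2 (sh2 _ g3)).
have gK : cl [:: h; H] g by apply: ker2 => //; rewrite rconv_grouplike // xig' scale0r.
(* Since xi(g) = 0, the operator of xi sends y to the scalar xi(y), just as it sends x to 1. So
   these multiples of x and X leave a remainder in both kernels. *)
pose a := xi y; pose b := xi' y; pose w := y - a *: x - b *: X.
have ye : y = w + (a *: x + b *: X) by rewrite /w -[y - _ - _]addrA -opprD subrK.
have Dw : rconv xi w = 0.
  rewrite /w !(linB (lin_rconv _)) !(linZ (lin_rconv _)) Dx DX (rconv_skewprim lx sy) xig.
  by rewrite scale0r add0r scaler0 subr0 subrr.
have Dw' : rconv xi' w = 0.
  rewrite /w !(linB (lin_rconv _)) !(linZ (lin_rconv _)) Dx' DX' (rconv_skewprim lx' sy) xig'.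
  by rewrite scale0r add0r scaler0 subr0 subrr.
clearbody w.
have wK : cl [:: h; H] w by apply: ker2 => //; apply: ker3.
have comm u v : cl [:: h; H] u -> cl [:: h; H] v -> u * v = v * u.
  move=> cu; apply: cl_commute => z zz; apply/esym; apply: cl_commute cu => z' zz'.
  by move: zz zz'; rewrite !inE => /orP[] /eqP-> /orP[] /eqP->.
(* The left convolution by xi kills the remainder w and X, and sends y to a g and x to h. *)
have ah : a *: g = a *: h.
  have := congr1 (lconv xi) ye; rewrite (lconv_skewprim lx sy) (tr_x1 tr) scale0r addr0 -/a => ->.
  rewrite !(linD (lin_lconv _)) !(linZ (lin_lconv _)) (lconv_skewprim lx sx) (lconv_skewprim lx sX).
  rewrite (lconv_cl tr _ wK) => [|z]; last by rewrite !inE => /orP[] /eqP->.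
  by rewrite xix xiX (tr_x1 tr) !scale0r scale1r !addr0 scaler0 addr0 add0r.
have bH : b *: g = b *: H.
  have := congr1 (lconv xi') ye; rewrite (lconv_skewprim lx' sy) (tr_x1 tr') scale0r addr0 -/b => ->.
  rewrite !(linD (lin_lconv _)) !(linZ (lin_lconv _)) (lconv_skewprim lx' sx) (lconv_skewprim lx' sX).
  rewrite (lconv_cl tr' _ wK) => [|z]; last by rewrite !inE => /orP[] /eqP->.
  by rewrite xix' xiX' (tr_x1 tr') !scale0r scale1r !addr0 scaler0 add0r add0r.
(* Products of h and H commute, so the hypothesis says (1 - p) g w = 0. *)
have w0 : w * g = p *: (g * w) -> w = 0.
  rewrite (comm _ _ wK gK) => /eqP; rewrite -subr_eq0 -{1}[g * w]scale1r -scalerBl scaler_eq0.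
  by rewrite subr_eq0 eq_sym (negbTE p1) => /eqP; apply: gU.
have scI (c : k) (u v : halg A) : c != 0 -> c *: u = c *: v -> u = v.
  by move=> c0 e; rewrite -[u]scale1r -(mulVf c0) -scalerA e scalerA mulVf // scale1r.
have [a0|a0] := eqVneq a 0; last first.
  have gh' : g = h := scI _ _ _ a0 ah.
  have b0 : b = 0.
    apply/eqP/negPn/negP=> b0; move: T_neq; rewrite -gh' => /eqP; apply.
    exact: scI _ _ _ b0 bH.
  have ye' : y = w + a *: x by rewrite {1}ye b0 scale0r addr0.
  (* This is y g = p g y with the x-terms collected. The operator of xi sees only those and leaves a
     (q - p) g = 0, whence p = q. *)
  have e : w * g + (a * (q - p)) *: (g * x) = p *: (g * w).
    move: yg; rewrite ye' mulrDl mulrDr scalerDr gh' -scalerAl xh -scalerAr !scalerA.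
    move/(canRL (addrK _)) => e; apply: (addIr (- ((a * (q - p)) *: (h * x)))).
    rewrite addrK e -addrA -scaleNr; congr (_ + _); rewrite -!scaleNr -scalerDl.
    by congr (_ *: _); rewrite mulrBr opprB [p * a]mulrC.
  have qp : p = q.
    have := congr1 (rconv xi) e; rewrite (linD (lin_rconv _)) !(linZ (lin_rconv _)).
    rewrite (DK3 (w * g)); last first.
      by apply: (@cl_sub _ _ [:: h; H]); [move=> z zz; rewrite inE zz orbT | apply: cl_mul].
    rewrite (DK3 (g * w)); last first.
      by apply: (@cl_sub _ _ [:: h; H]); [move=> z zz; rewrite inE zz orbT | apply: cl_mul].
    rewrite (rconv_trirep tr) (rconv_eps coA) Dx mulr1 (DK3 g) // mul0r addr0 add0r scaler0.
    move/eqP; rewrite scaler_eq0 (negbTE g0) orbF mulf_eq0 (negbTE a0) subr_eq0 /=.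
    by move/eqP.
  left; split=> //; exists a => //; rewrite ye' w0 ?add0r //.
  by move: e; rewrite qp subrr mulr0 scale0r addr0.
have [b0|b0] := eqVneq b 0.
  case/eqP: y0; rewrite ye a0 b0 !scale0r !addr0; apply: w0.
  by move: yg; rewrite ye a0 b0 !scale0r !addr0.
have gH' : g = H := scI _ _ _ b0 bH.
have ye' : y = w + b *: X by rewrite {1}ye a0 scale0r add0r.
have e : w * g + (b * (qb - p)) *: (g * X) = p *: (g * w).
  move: yg; rewrite ye' mulrDl mulrDr scalerDr gH' -scalerAl XH -scalerAr !scalerA.
  move/(canRL (addrK _)) => e; apply: (addIr (- ((b * (qb - p)) *: (H * X)))).
  rewrite addrK e -addrA -scaleNr; congr (_ + _); rewrite -!scaleNr -scalerDl.
  by congr (_ *: _); rewrite mulrBr opprB [p * b]mulrC.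
have qp : p = qb.
  have := congr1 (rconv xi') e; rewrite (linD (lin_rconv _)) !(linZ (lin_rconv _)).
  rewrite (DK (w * g)); last exact: cl_mul.
  rewrite (DK (g * w)); last exact: cl_mul.
  rewrite (rconv_trirep tr') (rconv_eps coA) DX' mulr1 (DK g) // mul0r addr0 add0r scaler0.
  move/eqP; rewrite scaler_eq0 (negbTE g0) orbF mulf_eq0 (negbTE b0) subr_eq0 /=.
  by move/eqP.
right; split=> //; exists b => //; rewrite ye' w0 ?add0r //.
by move: e; rewrite qp subrr mulr0 scale0r addr0.
Qed.
End TaftProduct.

(** * Isomorphisms between presented Hopf algebras *)

Section PresentedIso.
Variables (k : fieldType).

Record hopfgens (I : finType) (A : bialgebra k I) (h x H X : halg A) : Prop := HopfGens {
  hg_co : coalgebra A;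
  hg_h : grouplike h; hg_H : grouplike H;
  hg_x : skewprim h x; hg_X : skewprim H X;
  hg_h0 : h != 0; hg_H0 : H != 0 }.

(** Repackages the raw data; the equality [bdata A' = A] lets a goal about [A] be restated for the
    bundled bialgebra. *)
Lemma is_T_gens (I : finType) (A : bialg k I) n m (qb q s : k) : (0 < m)%N -> (0 < n)%N ->
  is_T A n m qb q s -> exists (A' : bialgebra k I) (h x H X : halg A'),
  [/\ bdata A' = A, presents A' [:: h; x; H; X] (@T_rels k n m qb q s) & hopfgens h x H X].
Proof.
move=> m0 n0 [hA [h [x [H [X [pres eh eH ex eX]]]]]].
exists (bialg_of_hopf hA), h, x, H, X; split=> //; split.
- exact: coalgebra_hopf.
- exact: grouplikeP.
- exact: grouplikeP.
- exact: skewprimP.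
- exact: skewprimP.
- have [+ _ _] := pres.
  by move/(T_relsP (B := halg (bialg_of_hopf hA))) => [e _]; apply: unit_neq0 e.
- have [+ _ _] := pres.
  by move/(T_relsP (B := halg (bialg_of_hopf hA))) => [_ [e _]]; apply: unit_neq0 e.
Qed.

Lemma is_Q_gens (I : finType) (A : bialg k I) n (q a : k) : (0 < n)%N ->
  is_Q A n q a -> exists (A' : bialgebra k I) (h x H X : halg A'),
  [/\ bdata A' = A, presents A' [:: h; x; H; X] (@Q_rels k n q a) & hopfgens h x H X].
Proof.
move=> n0 [hA [h [x [H [X [pres eh eH ex eX]]]]]].
exists (bialg_of_hopf hA), h, x, H, X; split=> //; split.
- exact: coalgebra_hopf.
- exact: grouplikeP.
- exact: grouplikeP.
- exact: skewprimP.
- exact: skewprimP.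
- have [+ _ _] := pres.
  by move/(Q_relsP (B := halg (bialg_of_hopf hA))) => [e _]; apply: unit_neq0 e.
- have [+ _ _] := pres.
  by move/(Q_relsP (B := halg (bialg_of_hopf hA))) => [_ [e _]]; apply: unit_neq0 e.
Qed.

Lemma skewprimZ (I : finType) (A : bialgebra k I) (g y : halg A) c :
  skewprim g y -> skewprim g (c *: y).
Proof.
move=> sy V b l1 l2; rewrite (linZ (lin_swl _)) sy // scalerDr.
by rewrite (linZ (l1 g)) (linZ (l2 1)).
Qed.

(** Each universal property gives one map, and the two are inverse as soon as they are so on
    generators. The last hypothesis keeps both maps abstract, so that images which are not
    generators, such as rescaled ones, can be evaluated by linearity. *)
Lemma presented_iso (I J : finType) (A : bialgebra k I) (B : bialgebra k J)
    (h x H X fh fx fH fX : halg A) (h' x' H' X' gh gx gH gX : halg B) rels rels' :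
  presents A [:: h; x; H; X] rels -> presents B [:: h'; x'; H'; X'] rels' ->
  rels (asig (halg B)) [:: gh; gx; gH; gX] -> rels' (asig (halg A)) [:: fh; fx; fH; fX] ->
  hopfgens h x H X -> hopfgens gh gx gH gX ->
  (forall (f : halg A -> halg B) (g : halg B -> halg A), algmor f -> algmor g ->
     [/\ f h = gh, f x = gx, f H = gH & f X = gX] ->
     [/\ g h' = fh, g x' = fx, g H' = fH & g X' = fX] ->
     [/\ f fh = h', f fx = x', f fH = H' & f fX = X'] /\
     [/\ g gh = h, g gx = x, g gH = H & g gX = X]) ->
  HopfIso A B.
Proof.
move=> pA pB rB rA dA dB inv.
have [|f [fm [efh efx efH efX]]] := presents_mor pA _ rB; first by [].
have [|g [gm [egh egx egH egX]]] := presents_mor pB _ rA; first by [].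
have [[i1 i2 i3 i4] [j1 j2 j3 j4]] := inv f g fm gm (And4 efh efx efH efX) (And4 egh egx egH egX).
have [_ /generates_cl GA _] := pA; have [_ /generates_cl GB _] := pB.
have compm (I1 I2 : finType) (A1 : bialgebra k I1) (A2 : bialgebra k I2)
    (f1 : halg A1 -> halg A2) (f2 : halg A2 -> halg A1) : algmor f1 -> algmor f2 ->
    algmor (f2 \o f1).
  move=> [l1 M1 e1] [l2 M2 e2]; split; first exact: lin_comp.
    by move=> u v /=; rewrite M1 M2.
  by rewrite /= e1 e2.
have idm (I1 : finType) (A1 : bialgebra k I1) : algmor (fun u : halg A1 => u) by split.
have fK : cancel f g.
  apply: (algmor_ext GA (compm _ _ _ _ _ _ fm gm) (idm _ A)) => z; rewrite !inE.
  by case/or4P=> /eqP-> /=; rewrite ?efh ?efx ?efH ?efX ?j1 ?j2 ?j3 ?j4.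
have gK : cancel g f.
  apply: (algmor_ext GB (compm _ _ _ _ _ _ gm fm) (idm _ B)) => z; rewrite !inE.
  by case/or4P=> /eqP-> /=; rewrite ?egh ?egx ?egH ?egX ?i1 ?i2 ?i3 ?i4.
case: dA => coA a1 a2 a3 a4 a5 a6; case: dB => coB b1 b2 b3 b4 b5 b6.
apply: (HopfIso_mor fm GA); rewrite ?efh ?efx ?efH ?efX //; first by exists g.
- by rewrite !eps_grouplike.
- by rewrite !eps_grouplike.
- by rewrite (eps_skewprim coB b5 b3) (eps_skewprim coA a5 a3).
- by rewrite (eps_skewprim coB b6 b4) (eps_skewprim coA a6 a4).
Qed.
End PresentedIso.

(** * Classification of T^sigma up to isomorphism, and comparison with Q *)

Section Parts.
Variable k : fieldType.

Lemma prim_neq1 (q : k) m : (2 <= m)%N -> m.-primitive_root q -> q != 1.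
Proof.
move=> m2 pq; apply/eqP=> q1; have := prim_order_dvd pq 1; rewrite expr1 q1 eqxx dvdn1.
by move/eqP=> m1; move: m2; rewrite m1.
Qed.

Lemma T_iso_refl (I J : finType) (A : bialg k I) (B : bialg k J) n m (qb q s : k) :
  (0 < m)%N -> (0 < n)%N -> is_T A n m qb q s -> is_T B n m qb q s -> HopfIso A B.
Proof.
move=> m0 n0 /(is_T_gens m0 n0)[A' [h [x [H [X [<- pA dA]]]]]].
move=> /(is_T_gens m0 n0)[B' [h' [x' [H' [X' [<- pB dB]]]]]].
have [rA _ _] := pA; have [rB _ _] := pB.
by apply: (presented_iso pA pB rB rA dA dB) => f g _ _ [-> -> -> ->] [-> -> -> ->].
Qed.

(** Exchange (h, x) with (H, X): the relation x H = s H x turns into X h = s h X, that is h X = s^-1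
    X h. *)
Lemma T_iso_flip (I J : finType) (A : bialg k I) (B : bialg k J) n (q s : k) :
  (0 < n)%N -> s ^+ n = 1 -> is_T A n n q q s -> is_T B n n q q s^-1 -> HopfIso A B.
Proof.
move=> n0 sn /(is_T_gens n0 n0)[A' [h [x [H [X [<- pA dA]]]]]].
move=> /(is_T_gens n0 n0)[B' [h' [x' [H' [X' [<- pB dB]]]]]].
have s0 : s != 0 by apply: unit_neq0 sn.
have [/(T_relsP (B := halg A'))[r1 [r2 [r3 [r4 [r5 [r6 [r7 [r8 [r9 r10]]]]]]]]] _ _] := pA.
have [/(T_relsP (B := halg B'))[t1 [t2 [t3 [t4 [t5 [t6 [t7 [t8 [t9 t10]]]]]]]]] _ _] := pB.
apply: (presented_iso (gh := H') (gx := X') (gH := h') (gX := x')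
   (fh := H) (fx := X) (fH := h) (fX := x) pA pB) => //.
- apply/T_relsP; do 6?[split; first by []].
  by rewrite t7 t8 t9 !scalerA !mulfV // !scale1r t10.
- apply/T_relsP; do 6?[split; first by []].
  by rewrite r7 r8 r9 !scalerA !mulVf // !scale1r r10.
- by case: dB => *; split.
- by move=> f g _ _ [-> -> -> ->] [-> -> -> ->].
Qed.

(** The deformed relation has degree one in x on the left and zero on the right, so rescaling x
    absorbs the parameter; all other relations are homogeneous in x. *)
Lemma Q_iso_scale (I J : finType) (A : bialg k I) (B : bialg k J) n (q a : k) :
  (0 < n)%N -> a != 0 -> is_Q A n q a -> is_Q B n q 1 -> HopfIso A B.
Proof.
move=> n0 a0 /(is_Q_gens n0)[A' [h [x [H [X [<- pA dA]]]]]].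
move=> /(is_Q_gens n0)[B' [h' [x' [H' [X' [<- pB dB]]]]]].
have [/(Q_relsP (B := halg A'))[r1 [r2 [r3 [r4 [r5 [r6 [r7 [r8 [r9 r10]]]]]]]]] _ _] := pA.
have [/(Q_relsP (B := halg B'))[t1 [t2 [t3 [t4 [t5 [t6 [t7 [t8 [t9 t10]]]]]]]]] _ _] := pB.
apply: (presented_iso (gh := h') (gx := a *: x') (gH := H') (gX := X')
   (fh := h) (fx := a^-1 *: x) (fH := H) (fX := X) pA pB) => //.
- apply/Q_relsP; do 2!split=> //; rewrite exprZn t3 scaler0 -!scalerAl -!scalerAr t5 t7 t9.
  rewrite !scalerA [a * q]mulrC; do 7?[split=> //].
  by rewrite !scalerDr !scalerA [a * q]mulrC mulr1 mulrN1.
- apply/Q_relsP; do 2!split=> //; rewrite exprZn r3 scaler0 -!scalerAl -!scalerAr r5 r7 r9.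
  rewrite !scalerA [a^-1 * q]mulrC; do 7?[split=> //].
  by rewrite !scalerDr !scalerA [a^-1 * q]mulrC mulrN mulVf.
- by case: dB => *; split=> //; apply: skewprimZ.
- move=> f g fm gm [-> ex -> ->] [-> ex' -> ->].
  rewrite (linZ (algmor_lin fm)) ex (linZ (algmor_lin gm)) ex' !scalerA mulVf // mulfV //.
  by rewrite !scale1r.
Qed.

(** Serves both uniqueness claims: the swap of the two pairs is recorded together with q = qb, which
    it forces because the commutation factor p is preserved. *)
Lemma T_mor (I J : finType) (A : bialg k I) (B : bialg k J) n m (qb q s s' : k) :
  (2 <= m)%N -> (2 <= n)%N -> m.-primitive_root q -> n.-primitive_root qb ->
  s ^+ m = 1 -> s ^+ n = 1 -> s' ^+ m = 1 -> s' ^+ n = 1 ->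
  is_T A n m qb q s -> is_T B n m qb q s' -> HopfIso A B ->
  s = s' \/ q = qb /\ s' = s^-1.
Proof.
move=> m2 n2 pq pqb sm sn sm' sn'.
have [m0 n0] := (ltnW m2, ltnW n2).
move=> /(is_T_gens m0 n0)[A' [h [x [H [X [<- pA dA]]]]]].
move=> /(is_T_gens m0 n0)[B' [h' [x' [H' [X' [<- pB dB]]]]]].
move=> /HopfIsoE[f [fm fI fc]].
case: dA dB => coA gh gH sx sX h0 H0 [coB gh' gH' sx' sX' h0' H0'].
have [/(T_relsP (B := halg A'))[r1 [r2 [r3 [r4 [r5 [r6 [r7 [r8 [r9 r10]]]]]]]]] _ _] := pA.
have [/(T_relsP (B := halg B'))[t1 [t2 [t3 [t4 [t5 [t6 [t7 [t8 [t9 t10]]]]]]]]] _ _] := pB.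
have [lf fM f1] := fm.
have f_neq0 u : u != 0 -> f u != 0 by rewrite -(lin0 lf) (inj_eq fI).
have x0 := T_x_neq0 coA m2 n2 pq sn pA gh gH sx sX.
have X0 := T_X_neq0 coA m2 n2 pqb sm sn pA gh gH sx sX.
have x0' := T_x_neq0 coB m2 n2 pq sn' pB gh' gH' sx' sX'.
have X0' := T_X_neq0 coB m2 n2 pqb sm' sn' pB gh' gH' sx' sX'.
have hH : h != H := T_neq m2 n2 pq pA.
have hU (u : halg B') : h' * u = 0 -> u = 0.
  by move=> e; rewrite -[u]mul1r -t1 -(prednK m0) exprSr -mulrA e mulr0.
have HU (u : halg B') : H' * u = 0 -> u = 0.
  by move=> e; rewrite -[u]mul1r -t2 -(prednK n0) exprSr -mulrA e mulr0.
have cls := T_skewprim coB m2 n2 pq pqb sm' sn' pB gh' gH' sx' sX'.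
(* The image of (h, x) is classified with p = q, then that of (H, X) with p = qb; injectivity of f
   rules out a common group-like. *)
have := cls (f h) (f x) q m (grouplike_mor fm fc gh) m0 _ (skewprim_mor fm fc sx)
   (f_neq0 _ x0) _ (prim_neq1 m2 pq).
rewrite -algmorX // r1 -!fM r5 linZ // => /(_ f1 erefl) c1.
have := cls (f H) (f X) qb n (grouplike_mor fm fc gH) n0 _ (skewprim_mor fm fc sX)
   (f_neq0 _ X0) _ (prim_neq1 n2 pqb).
rewrite -algmorX // r2 -!fM r6 linZ // => /(_ f1 erefl) c2.
have scI (c c' : k) (u : halg B') : u != 0 -> c *: u = c' *: u -> c = c'.
  move=> u0 /eqP; rewrite -subr_eq0 -scalerBl scaler_eq0 (negbTE u0) orbF subr_eq0.
  by move/eqP.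
(* The image of x H = s H x decides between s' = s and s' = s^-1. *)
have := congr1 f r7; rewrite linZ // !fM.
case: c1 c2 => [[eh _ [a a0 ->]] | [eh qq [a a0 ->]]] [[eH _ _]|[eH _ _]].
- by case/eqP: hH; apply: fI; rewrite eh eH.
- rewrite eH -scalerAl t7 -scalerAr !scalerA => e; left.
  apply/esym/(mulfI a0); rewrite [RHS]mulrC.
  by apply: scI e; apply: contra_neq x0' => /HU.
- rewrite eH -scalerAl -scalerAr scalerA => e; right; split=> //.
  have s0' : s' != 0 by apply: unit_neq0 sn'.
  have e' : X' * h' = s'^-1 *: (h' * X') by rewrite t8 scalerA mulVf // scale1r.
  rewrite e' scalerA in e.
  have : a * s'^-1 = s * a by apply: scI e; apply: contra_neq X0' => /hU.
  by rewrite mulrC => /(mulIf a0) <-; rewrite invrK.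
- by case/eqP: hH; apply: fI; rewrite eh eH.
Qed.

Lemma Q_not_T (I J : finType) (A : bialg k I) (B : bialg k J) n (q s : k) :
  (2 <= n)%N -> n.-primitive_root q -> s ^+ n = 1 ->
  is_Q A n q 1 -> is_T B n n (q ^+ n.-1) q s -> ~ HopfIso A B.
Proof.
move=> n2 pq sn; have n0 := ltnW n2.
have qn1 := prim_expr_order pq; have q0 : q != 0 by apply: unit_neq0 qn1.
have q1 := prim_neq1 n2 pq.
have eqV : q ^+ n.-1 = q^-1 by rewrite -[RHS]mulr1 -qn1 -(prednK n0) exprS mulKf.
have pqb : n.-primitive_root (q ^+ n.-1).
  by rewrite (prim_root_exp_coprime _ pq) coprimePn.
move=> /(is_Q_gens n0)[A' [h [x [H [X [<- pA dA]]]]]].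
move=> /(is_T_gens n0 n0)[B' [h' [x' [H' [X' [<- pB dB]]]]]].
move=> /HopfIsoE[f [fm fI fc]].
case: dA dB => coA gh gH sx sX h0 H0 [coB gh' gH' sx' sX' h0' H0'].
have [/(Q_relsP (B := halg A'))[r1 [r2 [r3 [r4 [r5 [r6 [r7 [r8 [r9 r10]]]]]]]]] _ _] := pA.
have [/(T_relsP (B := halg B'))[t1 [t2 [t3 [t4 [t5 [t6 [t7 [t8 [t9 t10]]]]]]]]] _ _] := pB.
have [lf fM f1] := fm.
have f_neq0 u : u != 0 -> f u != 0 by rewrite -(lin0 lf) (inj_eq fI).
(* the two-dimensional simple module *)
have [||r [[lr _ _] [rh rx rH rX]]] := presents_mor (B := 'M[k]_2)
  (bs := [:: mx2 1 0 0 q; mx2 0 1 0 0; mx2 q^-1 0 0 1; mx2 0 0 (1 - q^-1) 0]) pA; first by [].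
  apply/Q_relsP; rewrite !mx2_diagX mx2_upX // mx2_loX // exprVn qn1 invr1 !expr1n -mx2_1.
  rewrite mx2_1 !mx2M !mx2Z !mx2D eqV !(mulr0, mul0r, addr0, add0r, mulr1, mul1r).
  have qe : q * (1 - q^-1) + (1 - q) = 0.
    by rewrite mulrBr mulr1 mulfV // addrA subrK subrr.
  by rewrite !mulN1r mulfV // qe [(1 - _) * q^-1]mulrC.
(* This module witnesses that x and X are nonzero and that h differs from H, as the classification
   of their images requires. *)
have x0 : x != 0.
  apply/eqP=> e; move: rx; rewrite e (lin0 lr) => /matrixP/(_ 0 1)/eqP.
  by rewrite !mxE /= eq_sym oner_eq0.
have X0 : X != 0.
  apply/eqP=> e; move: rX; rewrite e (lin0 lr) => /matrixP/(_ 1 0)/eqP.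
  by rewrite !mxE /= eq_sym subr_eq0 eq_sym invr_eq1 (negbTE q1).
have hH : h != H.
  apply/eqP=> e; move: rH; rewrite -e rh => /matrixP/(_ 1 1)/eqP.
  by rewrite !mxE /= (negbTE q1).
have cls := T_skewprim coB n2 n2 pq pqb sn sn pB gh' gH' sx' sX'.
have := cls (f h) (f x) q n (grouplike_mor fm fc gh) n0 _ (skewprim_mor fm fc sx)
   (f_neq0 _ x0) _ q1.
rewrite -algmorX // r1 -!fM r5 linZ // => /(_ f1 erefl) c1.
have := cls (f H) (f X) (q ^+ n.-1) n (grouplike_mor fm fc gH) n0 _ (skewprim_mor fm fc sX)
   (f_neq0 _ X0) _ (prim_neq1 n2 pqb).
rewrite -algmorX // r2 -!fM r6 linZ // => /(_ f1 erefl) c2.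
have r9' : f x * f X - q *: (f X * f x) = 1 - f H * f h.
  by rewrite -!fM -(linZ lf) -(linB lf) r9 addrC addKr scale1r scaleN1r (linB lf) f1.
have {c1 c2 r9'} [c e] : exists c, c *: (X' * x') = 1 - H' * h'.
  move: r9'; case: c1 c2 => [[eh _ [a a0 ->]] | [eh qq [a a0 ->]]] [[eH _ [b b0 ->]]|[eH _ [b b0 ->]]].
  - by case/eqP: hH; apply: fI; rewrite eh eH.
  - rewrite eh eH => <-; exists (a * b * s - q * (b * a)).
    by rewrite -!scalerAl -!scalerAr t9 !scalerA -scalerBl !mulrA.
  - rewrite eh eH t10 => <-; exists (a * b - q * (b * a) * s).
    by rewrite -!scalerAl -!scalerAr t9 !scalerA -scalerBl !mulrA.
  - by case/eqP: hH; apply: fI; rewrite eh eH.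
(* The character h' |-> q, H' |-> 1 turns the last identity into 0 = 1 - q. *)
have [||r' [[lr' rM' r1'] [rh' rx' rH' rX']]] := presents_mor (B := 'M[k]_2)
  (bs := [:: mx2 q 0 0 q; 0; 1; 0]) pB; first by [].
  apply/T_relsP; rewrite mx2_diagX qn1 -mx2_1 !expr1n !expr0n gtn_eqF //.
  by rewrite !(mulr0, mul0r, scaler0, mulr1, mul1r).
have := congr1 r' e; rewrite (linZ lr') (linB lr') !rM' rh' rx' rH' mulr0 scaler0 mul1r r1'.
move/matrixP/(_ 0 0)/eqP; rewrite !mxE /= eq_sym subr_eq0 eq_sym.
by rewrite (negbTE q1).
Qed.
End Parts.

(** * The double of the Taft algebra *)

Section FiniteMatrices.
Variables (k : fieldType) (E J : finType) (u : E -> J -> k) (v : J -> E -> k).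
Hypothesis uv : forall p r, \sum_l u p l * v l r = (p == r)%:R.

Let M := \matrix_(i < #|E|, j < #|J|) u (enum_val i) (enum_val j).
Let N := \matrix_(j < #|J|, i < #|E|) v (enum_val j) (enum_val i).

Let MN : M *m N = 1%:M.
Proof.
apply/matrixP=> i j; rewrite !mxE -(inj_eq enum_val_inj) -uv.
rewrite (reindex_onto (@enum_val J J) (@enum_rank J)) => [|l _]; last exact: enum_rankK.
by apply: eq_big => [l|l _]; rewrite ?enum_valK ?eqxx // !mxE.
Qed.

Lemma card_le_linv : (#|E| <= #|J|)%N.
Proof. exact: mulmx1_min MN. Qed.

Lemma linv_rinv : (#|J| <= #|E|)%N -> forall l l', \sum_p v l p * u p l' = (l == l')%:R.
Proof.
move=> JE l l'.
have NM : N *m M = 1%:M.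
  (* The two cardinals become variables so that their equality can be eliminated and the matrices
     become square of one size. *)
  move: JE card_le_linv MN; move: M N; move: #|E| #|J| => e j M' N' je ej.
  have {je ej} ej : e = j by apply/eqP; rewrite eqn_leq ej je.
  by case: j / ej M' N' => M' N'; apply: mulmx1C.
have /matrixP/(_ (enum_rank l) (enum_rank l')) := NM.
rewrite !mxE (inj_eq enum_rank_inj) => <-.
rewrite (reindex_onto (@enum_val E E) (@enum_rank E)) => [|p _]; last exact: enum_rankK.
by apply: eq_big => [p|p _]; rewrite ?enum_valK ?eqxx // !mxE !enum_rankK.
Qed.
End FiniteMatrices.

(** Writing the basis vectors in terms of [e] factors the identity of size [I] through size [E]. *)
Lemma spans_card (k : fieldType) (I E : finType) (A : bialgebra k I) (e : E -> halg A) :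
  spans e (fun=> True) -> (#|I| <= #|E|)%N.
Proof.
move=> se; have /fin_all_exists[c ec] i := se (ebas A i) Logic.I.
apply: (@card_le_linv k I E c (fun p l => e p l)) => i j.
rewrite -(ebasE A) ec (linf_sum _ _ _ (@linf_coord _ _ A j)).
by apply: eq_bigr => p _; rewrite (linfZ (@linf_coord _ _ A j)).
Qed.

(** Preimages of the basis vectors give a one-sided inverse of the matrix of [f]; the bound on
    dimensions makes it two-sided. *)
Lemma surj_bij (k : fieldType) (I J : finType) (A : bialgebra k I) (B : bialgebra k J)
    (f : halg A -> halg B) : lin f -> (forall p, exists u, f u = ebas B p) ->
  (#|I| <= #|J|)%N -> bijective f.
Proof.
move=> lf /fin_all_exists[g eg] IJ.
have lc j := @linf_coord _ _ B j.
have gf p r : \sum_i g p i * f (ebas A i) r = (p == r)%:R.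
  rewrite -(ebasE B) -eg (lin_basis lf) (linf_sum _ _ _ (lc r)).
  by apply: eq_bigr => i _; rewrite (linfZ (lc r)).
have fg := linv_rinv gf IJ.
exists (fun v : halg B => \sum_p v p *: g p) => [u|v]; last first.
  rewrite lin_sum // [RHS]halg_basis; apply: eq_bigr => p _.
  by rewrite linZ // eg.
have lF : lin (fun u => \sum_p f u p *: g p).
  apply: lin_sumf => p; apply: lin_scalef => c x y.
  by rewrite lf !ffunE.
rewrite (lin_basis lF) [RHS]halg_basis; apply: eq_bigr => i _; congr (_ *: _).
apply/ffunP=> j; rewrite ebasE -fg (linf_sum _ _ _ (@linf_coord _ _ A j)).
by apply: eq_bigr => p _; rewrite (linfZ (@linf_coord _ _ A j)).
Qed.

(** The generators are adjoined in the order h, H, X, x, so that each one can be moved past the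
    earlier ones. *)
Lemma Q_card (k : fieldType) (I : finType) (A : bialgebra k I) n (q a : k) (h x H X : halg A) :
  (0 < n)%N -> q != 0 -> presents A [:: h; x; H; X] (@Q_rels k n q a) ->
  (#|I| <= n * n * (n * n))%N.
Proof.
move=> n0 q0 [/(Q_relsP (B := halg A))[r1 [r2 [r3 [r4 [r5 [r6 [r7 [r8 [r9 r10]]]]]]]]] G _].
have c0 (y : halg A) e : e *: y = e *: y + 0 by rewrite addr0.
have y1 (g : halg A) : g \in [::] -> exists d r, cl [::] r /\ h * g = d *: (g * h) + r by [].
have y2 g : g \in [:: h] -> exists d r, cl [:: h] r /\ H * g = d *: (g * H) + r.
  by rewrite !inE => /eqP->; exists 1, 0; rewrite scale1r addr0; split=> //; apply: cl0.
have y3 g : g \in [:: H; h] -> exists d r, cl [:: H; h] r /\ X * g = d *: (g * X) + r.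
  rewrite !inE => /orP[] /eqP->.
    by exists (q ^+ n.-1), 0; rewrite -c0; split=> //; apply: cl0.
  exists q^-1, 0; rewrite -c0 r8 scalerA mulVf // scale1r; split=> //; exact: cl0.
have y4 g : g \in [:: X; H; h] -> exists d r, cl [:: X; H; h] r /\ x * g = d *: (g * x) + r.
  rewrite !inE => /or3P[] /eqP->.
  (* The only nonzero remainder: the deformed relation between x and X. *)
  - exists q, (a *: 1 + (- a) *: (H * h)); split=> //; apply: clD; apply: clZ; first exact: cl1.
    by apply: clM; rewrite ?inE ?eqxx ?orbT //; apply: cl_gen; rewrite !inE eqxx !orbT.
  - by exists q, 0; rewrite -c0; split=> //; apply: cl0.
  - by exists q, 0; rewrite -c0; split=> //; apply: cl0.
have e1 : h ^+ n = 1 *: 1 by rewrite scale1r.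
have e2 : H ^+ n = 1 *: 1 by rewrite scale1r.
have e3 : X ^+ n = 0 *: 1 by rewrite scale0r.
have e4 : x ^+ n = 0 *: 1 by rewrite scale0r.
have s4 := spans_cons n0 e4 y4 (spans_cons n0 e3 y3 (spans_cons n0 e2 y2
  (spans_cons n0 e1 y1 (@spans_nil k (halg A))))).
have := spans_card (fun u _ => s4 u (cl_sub _ (generates_cl G u))).
rewrite !card_prod !card_ord mul1n !mulnA; apply.
by move=> g; rewrite !inE => /or4P[] /eqP->; rewrite eqxx ?orbT.
Qed.

(** * The Taft algebra and its dual *)

Section Taft.
Variables (k : fieldType) (J : finType) (T : bialgebra k J) (n : nat) (q : k) (h x : halg T).
Hypotheses (coT : coalgebra T) (n2 : (2 <= n)%N) (pq : n.-primitive_root q).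
Hypothesis pres : presents T [:: h; x] (@Taft_rels k n q).
Hypotheses (eh : comul T h = tens h h) (ex : comul T x = tens x h + tens (aone T) x).

Let n0 : (0 < n)%N. Proof. exact: ltnW. Qed.
Let gh : grouplike h. Proof. exact: grouplikeP. Qed.
Let sx : skewprim h x. Proof. exact: skewprimP. Qed.
Let q0 : q != 0. Proof. by apply: (unit_neq0 n0 (prim_expr_order pq)). Qed.

Lemma Taft_rel : [/\ h ^+ n = 1, x ^+ n = 0 & x * h = q *: (h * x)].
Proof. by apply/Taft_relsP; case: pres. Qed.

Lemma Taft_cl u : cl [:: h; x] u.
Proof. by case: pres => _ G _; apply: generates_cl. Qed.

Lemma Taft_eps : eps h = 1 /\ eps x = 0.
Proof.
have [hn _ _] := Taft_rel; have h0 := unit_neq0 n0 hn.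
by rewrite eps_grouplike // (eps_skewprim coT h0 sx).
Qed.

Lemma Taft_ext (V : lmodType k) (f g : halg T -> V) : lin f -> lin g ->
  (forall a b, (b < n)%N -> f (h ^+ a * x ^+ b) = g (h ^+ a * x ^+ b)) -> f =1 g.
Proof.
move=> lf lg fg u; have [hn xn xh] := Taft_rel.
have y1 (z : halg T) : z \in [::] -> exists d r, cl [::] r /\ h * z = d *: (z * h) + r by [].
have y2 z : z \in [:: h] -> exists d r, cl [:: h] r /\ x * z = d *: (z * x) + r.
  by rewrite !inE => /eqP->; exists q, 0; rewrite addr0; split=> //; apply: cl0.
have e1 : h ^+ n = 1 *: 1 by rewrite scale1r.
have e2 : x ^+ n = 0 *: 1 by rewrite scale0r.
have [|c ->] := spans_cons n0 e2 y2 (spans_cons n0 e1 y1 (@spans_nil k (halg T))) (u := u).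
  by apply: cl_sub (Taft_cl u) => z; rewrite !inE orbC.
rewrite !lin_sum //; apply: eq_bigr => p _; rewrite !linZ //= mul1r fg //.
Qed.

(* The functionals H and X of the double; xi x = - 1 / q normalises the cross relation. *)
Lemma Taft_functionals : exists chi xi : halg T -> k, [/\ trirep chi xi (@eps _ _ T),
  chi h = q^-1, chi x = 0, xi h = 0 & xi x = - q^-1].
Proof.
have [||f [fm [fh fx]]] := presents_mor (B := 'M[k]_2)
  (bs := [:: mx2 q^-1 0 0 1; mx2 0 (- q^-1) 0 0]) pres; first by [].
  apply/Taft_relsP; rewrite mx2_diagX mx2_upX // exprVn (prim_expr_order pq) invr1 expr1n -mx2_1.
  split=> //; rewrite !mx2M !mx2Z !(mulr0, mul0r, addr0, add0r, mulr1, mul1r).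
  by rewrite mulrA mulfV // mul1r.
have tr : trirep (fun u => f u 0 0) (fun u => f u 0 1) (fun u => f u 1 1).
  apply: (trirep_of_mor Taft_cl fm) => g; rewrite !inE.
  by case/orP=> /eqP->; rewrite ?fh ?fx mxE.
exists (fun u => f u 0 0), (fun u => f u 0 1); split; try by rewrite ?fh ?fx !mxE.
have e : (fun u => f u 1 1) =1 @eps _ _ T.
  apply: (char_ext Taft_cl).
  - exact: tr_lb tr.
  - exact: linf_eps.
  - exact: tr_b1 tr.
  - exact: eps1.
  - exact: tr_bM tr.
  - exact: epsM.
  have [e1 e2] := Taft_eps.
  by move=> g; rewrite !inE => /orP[] /eqP->; rewrite ?fh ?fx !mxE /= ?e1 ?e2.
case: tr => la lx lb a1 x1 b1 aM bM xM; split=> //.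
- exact: linf_eps.
- exact: eps1.
- exact: epsM.
- by move=> u v; rewrite xM e.
Qed.

Section Functionals.
Variables chi xi : halg T -> k.
Hypotheses (tr : trirep chi xi (@eps _ _ T)).
Hypotheses (chih : chi h = q^-1) (chix : chi x = 0) (xih : xi h = 0) (xix : xi x = - q^-1).
Let la := tr_la tr.
Let lx := tr_lx tr.
Local Notation mono a b := (h ^+ a * x ^+ b).

(** Both h and x are eigenvectors of the multiplicative operator [rconv chi], with eigenvalue
    1/q. *)
Lemma rchi_mono a b : rconv chi (mono a b) = q^-1 ^+ (a + b) *: mono a b.
Proof.
have rM := rconvM la (tr_aM tr).
have rX (z : halg T) (c : k) e : rconv chi z = c *: z -> rconv chi (z ^+ e) = c ^+ e *: z ^+ e.
  move=> ez; elim: e => [|e IH]; first by rewrite !expr0 rconv_one // (tr_a1 tr).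
  by rewrite !exprS rM ez IH -scalerAl -scalerAr scalerA.
rewrite rM (rX h q^-1); last by rewrite rconv_grouplike // chih.
rewrite (rX x q^-1); last by rewrite (rconv_skewprim la sx) chih chix scale0r addr0.
by rewrite -scalerAl -scalerAr scalerA exprD.
Qed.

Lemma iter_rchi_mono i a b : iter i (rconv chi) (mono a b) = q^-1 ^+ (i * (a + b)) *: mono a b.
Proof.
elim: i => [|i IH]; first by rewrite mul0n expr0 scale1r.
by rewrite iterS IH (linZ (lin_rconv _)) rchi_mono scalerA -exprD mulSn addnC.
Qed.

Lemma rxi_hX a : rconv xi (h ^+ a) = 0.
Proof.
apply: (rconv_cl tr (gens := [:: h])).
  by move=> g; rewrite inE => /eqP->; rewrite rconv_grouplike // xih scale0r.
elim: a => [|a IH]; first exact: cl1.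
by rewrite exprS; apply: clM => //; rewrite inE.
Qed.

(** Here the twist of the Leibniz rule sits on the left factor, through chi; it contributes q^-a for
    h^a and the powers of 1/q that sum to the q-number. *)
Lemma rxi_mono a b :
  rconv xi (mono a b.+1) = (q^-1 ^+ a * (- q^-1 * qnum q^-1 b.+1)) *: mono a b.
Proof.
have rx e : rconv xi (x ^+ e.+1) = (- q^-1 * qnum q^-1 e.+1) *: x ^+ e.
  have rx1 : rconv xi x = - q^-1 *: 1.
    by rewrite (rconv_skewprim lx sx) xih xix scale0r add0r.
  elim: e => [|e IH].
    by rewrite expr1 rx1 /qnum big_ord1 expr0 mulr1.
  rewrite exprS (rconv_trirep tr) (rconv_eps coT) IH rx1 -scalerAl mul1r.
  have -> : rconv chi x = q^-1 *: x.
    by rewrite (rconv_skewprim la sx) chih chix scale0r addr0.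
  rewrite -scalerAl -scalerAr -exprS scalerA -scalerDl; congr (_ *: _).
  rewrite /qnum [in RHS]big_ord_recl /= expr0 mulrDr mulr1 addrC; congr (_ + _).
  rewrite mulrCA; congr (_ * _); rewrite mulr_sumr; apply: eq_bigr => i _.
  by rewrite -exprS.
rewrite (rconv_trirep tr) rxi_hX mul0r addr0 rx -[h ^+ a]mulr1 -{1}(expr0 x) rchi_mono.
by rewrite expr0 mulr1 addn0 -scalerAl -scalerAr scalerA.
Qed.

Let pqV : n.-primitive_root q^-1.
Proof.
have -> : q^-1 = q ^+ n.-1.
  by rewrite -[LHS]mulr1 -(prim_expr_order pq) -(prednK n0) exprS mulKf.
by rewrite (prim_root_exp_coprime _ pq) coprimePn.
Qed.

(** The constant does not depend on [a], so it can be divided out before the Fourier inversion over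
    exponents of h. *)
Lemma iter_rxi_mono j d : (j + d < n)%N -> exists2 c, c != 0 &
  forall a, iter j (rconv xi) (mono a (j + d)) = (c * q^-1 ^+ (a * j)) *: mono a d.
Proof.
elim: j => [|j IH] jd.
  by exists 1; rewrite ?oner_eq0 // => a; rewrite muln0 expr0 mulr1 scale1r.
have [c c0 e] := IH (ltnW jd); exists (- q^-1 * qnum q^-1 (j + d).+1 * c).
  by rewrite !mulf_neq0 // ?oppr_eq0 ?invr_eq0 // (qnum_neq0 pqV) //= -addSn.
move=> a; rewrite iterSr addSn rxi_mono (linZ (iterD_lin (@lin_rconv _ _ _ _) _)) e scalerA.
by congr (_ *: _); rewrite mulnS exprD [_ ^+ a * (_ * _)]mulrC; apply: mulrACA.
Qed.

Lemma iter_rxi0 j a b : (b < j)%N -> iter j (rconv xi) (mono a b) = 0.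
Proof.
elim: j b => // j IH [|b] bj; rewrite iterSr.
  by rewrite expr0 mulr1 rxi_hX (lin0 (iterD_lin (@lin_rconv _ _ _ _) _)).
by rewrite rxi_mono (linZ (iterD_lin (@lin_rconv _ _ _ _) _)) IH // scaler0.
Qed.

(** The convolution product chi^i xi^j in the dual algebra; see [dfun_phi]. *)
Definition phi i j (z : halg T) : k := eps (iter i (rconv chi) (iter j (rconv xi) z)).

Lemma linf_phi i j : linf (phi i j).
Proof.
apply: (linf_comp (@linf_eps _ _ T)).
apply: (lin_comp (iterD_lin (@lin_rconv _ _ _ _) _)); exact: (iterD_lin (@lin_rconv _ _ _ _)).
Qed.

Lemma eps_mono a b : eps (mono a b) = (b == 0)%:R.
Proof.
have [e1 e2] := Taft_eps.
have eX (z : halg T) e : eps (z ^+ e) = eps z ^+ e.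
  by elim: e => [|e IH]; rewrite ?expr0 ?eps1 // !exprS epsM IH.
by rewrite epsM !eX e1 e2 expr1n mul1r expr0n.
Qed.

Lemma phi_mono j : (j < n)%N -> exists2 c, c != 0 & forall i a b, (b < n)%N ->
  phi i j (mono a b) = (b == j)%:R * (c * q^-1 ^+ (a * (i + j))).
Proof.
move=> jn; have [c c0 e] := @iter_rxi_mono j 0 ltac:(by rewrite addn0); exists c => // i a b bn.
rewrite /phi; have [bj|bj|->] := ltngtP b j.
- by rewrite iter_rxi0 // (lin0 (iterD_lin (@lin_rconv _ _ _ _) _)) (linf0 (@linf_eps _ _ _)) mul0r.
- have [c' _ e'] := @iter_rxi_mono j (b - j) ltac:(by rewrite subnKC // ltnW).
  rewrite -{1}(subnKC (ltnW bj)) e' (linZ (iterD_lin (@lin_rconv _ _ _ _) _)) iter_rchi_mono.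
  by rewrite !(linfZ (@linf_eps _ _ _)) eps_mono subn_eq0 leqNgt bj /= !mulr0 mul0r.
rewrite -{2}[j]addn0 e (linZ (iterD_lin (@lin_rconv _ _ _ _) _)) iter_rchi_mono.
rewrite !(linfZ (@linf_eps _ _ _)) eps_mono mulr1 mul1r -mulrA -exprD addn0.
by congr (_ * _ ^+ _); rewrite mulnDr addnC [(i * a)%N]mulnC.
Qed.

Lemma dual_mono a b : (a < n)%N -> (b < n)%N -> exists d : 'I_n -> k,
  forall a' b', (a' < n)%N -> (b' < n)%N ->
  \sum_i d i * phi i b (mono a' b') = ((a == a') && (b == b'))%:R.
Proof.
move=> an bn; have [c c0 e] := phi_mono bn.
have nn : n%:R != 0 :> k by apply: prim_root_natf_neq0 pq.
(* Inverse discrete Fourier transform: c^-1 undoes the scalar of [phi_mono], and summing over i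
   gives a geometric sum in z = q^a q^-a', equal to n or to 0. *)
exists (fun i => c^-1 * n%:R^-1 * q ^+ (a * (i + b))) => a' b' an' bn'.
pose z := q ^+ a * q^-1 ^+ a'.
transitivity ((b' == b)%:R * n%:R^-1 * z ^+ b * \sum_(i < n) z ^+ i).
  rewrite mulr_sumr; apply: eq_bigr => i _.
  have ez : z ^+ b * z ^+ i = q ^+ (a * (i + b)) * q^-1 ^+ (a' * (i + b)).
    by rewrite -exprD addnC exprMn -!exprM.
  rewrite e // -[RHS]mulrA ez; move: (q ^+ _) (q^-1 ^+ _) => u v.
  rewrite [c^-1 * _]mulrC -!mulrA [u * (_ * _)]mulrCA [c^-1 * _]mulrCA [u * (c * v)]mulrCA.
  by rewrite mulKf //; apply: mulrCA.
have [ea|ab] := eqVneq a a'.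
  have -> : z = 1 by rewrite /z ea -exprMn mulfV // expr1n.
  rewrite expr1n mulr1 (eq_bigr (fun=> 1)) => [|i _]; last by rewrite expr1n.
  by rewrite sumr_const card_ord -mulrA mulVf // mulr1 /= eq_sym.
have z1 : z != 1.
  apply: contra_neq ab => z1; apply/eqP; have : q ^+ a == q ^+ a'.
    by rewrite -[q ^+ a]mulr1 -(expr1n _ a') -(mulVf q0) exprMn mulrA -/z z1 mul1r.
  by rewrite (eq_prim_root_expr pq) !modn_small.
have zn : z ^+ n = 1.
  by rewrite /z exprMn -!exprM ![(_ * n)%N]mulnC !exprM (prim_expr_order pq) (prim_expr_order pqV) !expr1n mulr1.
have := subrX1 z n; rewrite zn subrr => /esym/eqP; rewrite mulf_eq0 subr_eq0 (negbTE z1) /=.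
by move/eqP->; rewrite mulr0.
Qed.

(** The monomials h^a x^b are independent because they have dual functionals. *)
Lemma Taft_card : (n * n <= #|J|)%N.
Proof.
have /fin_all_exists[d ed] (p : 'I_n * 'I_n) := dual_mono (ltn_ord p.1) (ltn_ord p.2).
have := @card_le_linv k ('I_n * 'I_n)%type J (fun p l => mono p.1 p.2 l)
  (fun l p => \sum_i d p i * phi i p.2 (ebas T l)).
rewrite card_prod card_ord; apply => p r.
transitivity (\sum_i d r i * phi i r.2 (mono p.1 p.2)).
  under eq_bigr => l _ do rewrite mulr_sumr.
  rewrite exchange_big; apply: eq_bigr => i _ /=.
  rewrite (linf_basis (linf_phi _ _)) mulr_sumr; apply: eq_bigr => l _.
  by rewrite mulrCA.
by rewrite ed // [p == r]eq_sym; case: p r => a b [a' b'].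
Qed.

(** Expand f in the basis dual to the monomials, each member of which is a combination of the [phi]
    with the same j. *)
Lemma functional_phi (f : halg T -> k) : linf f -> exists d : 'I_n -> 'I_n -> k,
  forall z, f z = \sum_i \sum_j d i j * phi i j z.
Proof.
move=> lf.
have /fin_all_exists[d ed] (p : 'I_n * 'I_n) := dual_mono (ltn_ord p.1) (ltn_ord p.2).
exists (fun i j : 'I_n => \sum_(a < n) f (mono a j) * d (a, j) i) => z.
pose g z := \sum_(i < n) \sum_(j < n) (\sum_(a < n) f (mono a j) * d (a, j) i) * phi i j z.
have lg : linf g.
  move=> c u v; rewrite /g mulr_sumr -big_split; apply: eq_bigr => i _ /=.
  rewrite mulr_sumr -big_split; apply: eq_bigr => j _ /=.
  by rewrite linf_phi mulrDr mulrCA.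
change (f z = g z); apply: (@Taft_ext k^o f g lf lg) => a b bn.
have [hn _ _] := Taft_rel.
(* [Taft_ext] leaves the exponent of h unbounded, whereas the dual basis is indexed by exponents
   below n. *)
have -> : h ^+ a = h ^+ (a %% n) by rewrite {1}(divn_eq a n) exprD mulnC exprM hn expr1n mul1r.
have an : (a %% n < n)%N by rewrite ltn_mod.
move: (a %% n)%N an => {}a an; rewrite /g.
transitivity (\sum_(j < n) \sum_(a' < n) f (mono a' j) * (((a' : nat) == a) && ((j : nat) == b))%:R).
  rewrite (bigD1 (Ordinal bn)) //= (bigD1 (Ordinal an)) //= !eqxx mulr1.
  rewrite [X in _ + X + _]big1 ?addr0 => [|i /negbTE ia]; last by rewrite -val_eqE /= in ia; rewrite ia mulr0.
  rewrite big1 ?addr0 // => j /negbTE jb; rewrite big1 // => i _.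
  by rewrite -val_eqE /= in jb; rewrite jb andbF mulr0.
rewrite [RHS]exchange_big; apply: eq_bigr => j _ /=.
under [RHS]eq_bigr => i _ do rewrite mulr_suml.
rewrite [RHS]exchange_big; apply: eq_bigr => a' _ /=.
have /= <- := ed (a', j) a b an bn; rewrite mulr_sumr; apply: eq_bigr => i _; exact: mulrA.
Qed.
End Functionals.
End Taft.

(** * The isomorphism from Q^1 to the double *)

Section DoubleTaft.
Variables (k : fieldType) (J : finType) (T : bialgebra k J) (n : nat) (q : k) (h x : halg T).
Variables (S Sb : J -> J -> k).
Hypotheses (coT : coalgebra T) (aS : is_antipode T S).
Hypotheses (SSb : forall i l, \sum_u S i u * Sb u l = (i == l)%:R)
           (SbS : forall i l, \sum_u Sb i u * S u l = (i == l)%:R).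
Hypotheses (n2 : (2 <= n)%N) (pq : n.-primitive_root q).
Hypothesis pres : presents T [:: h; x] (@Taft_rels k n q).
Hypotheses (eh : comul T h = tens h h) (ex : comul T x = tens x h + tens (aone T) x).

Let D := DDb coT aS SSb SbS.
Let n0 : (0 < n)%N. Proof. exact: ltnW. Qed.
Let gh : grouplike h. Proof. exact: grouplikeP. Qed.
Let sx : skewprim h x. Proof. exact: skewprimP. Qed.
Let q0 : q != 0. Proof. by apply: (unit_neq0 n0 (prim_expr_order pq)). Qed.

(** The pure tensor f (x) a. *)
Definition el (f : halg T -> k) (a : halg T) : halg D :=
  [ffun p => f (ebas T p.1) * a p.2].

Lemma dfun_el f a z : linf f -> dfun (el f a) z = f z *: a.
Proof.
move=> lf; rewrite (lin_basis (lin_dfun _)) (linf_basis lf z) scaler_suml.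
apply: eq_bigr => i _; rewrite -scalerA dfun_ebas [in RHS](halg_basis a) scaler_sumr.
by congr (_ *: _); apply: eq_bigr => j _; rewrite ffunE scalerA.
Qed.

Lemma dfunM (F G : halg D) (z : halg T) :
  dfun (F * G) z = sw z (fun z1 z2 => dact Sb z2 (dfun G) (dfun F z1)).
Proof. exact: (dfun_mul Sb F G z). Qed.

Lemma dfun1 (z : halg T) : dfun (1 : halg D) z = eps z *: 1.
Proof. exact: (dfun_one Sb z). Qed.

Lemma dfunD (F G : halg D) (z : halg T) : dfun (F + G) z = dfun F z + dfun G z.
Proof. by rewrite /dfun -big_split; apply: eq_bigr => p _ /=; rewrite ffunE scalerDl. Qed.

Lemma dfunZ c (F : halg D) (z : halg T) : dfun (c *: F) z = c *: dfun F z.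
Proof.
by rewrite /dfun scaler_sumr; apply: eq_bigr => p _ /=; rewrite ffunE; apply/esym/scalerA.
Qed.

Lemma dfunM_eps a (G : halg D) (z : halg T) : dfun (el (@eps _ _ T) a * G) z = dact Sb z (dfun G) a.
Proof.
have lG := lin_dfun (T := T) G.
rewrite dfunM -(sw_counitl coT z (f := fun z => dact Sb z (dfun G) a)); last exact: lin_dacty.
apply: eq_sw => z1 z2; rewrite dfun_el; last exact: linf_eps.
by rewrite (linZ (lin_dact _ _ lG)).
Qed.

Lemma dfunM_one f (G : halg D) (z : halg T) : linf f ->
  dfun (el f 1 * G) z = sw z (fun z1 z2 => f z1 *: dfun G z2).
Proof.
move=> lf; have lG := lin_dfun (T := T) G; rewrite dfunM; apply: eq_sw => z1 z2.
by rewrite dfun_el // (linZ (lin_dact _ _ lG)) (dact1 aS SSb).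
Qed.

Lemma eq_dact (f g : halg T -> halg T) y u : f =1 g -> dact Sb y f u = dact Sb y g u.
Proof. by move=> e; apply: eq_sw => v c; apply: eq_sw => a b; rewrite e. Qed.

Lemma el_epsM a b : el (@eps _ _ T) a * el (@eps _ _ T) b = el (@eps _ _ T) (a * b).
Proof.
have le := @linf_eps _ _ T; apply: (@dfun_inj _ _ T) => z; rewrite dfunM_eps dfun_el //.
rewrite (eq_dact (g := fun z => eps z *: b)); last by move=> y; rewrite dfun_el.
rewrite scalerAl -(dact_un coT aS SbS z a) /dact.
rewrite (lin_sw _ _ (f := fun y => y * b)); last lin.
apply: eq_sw => v c; rewrite (lin_sw _ _ (f := fun y => y * b)); last lin.
by apply: eq_sw => a' b'; rewrite /dun -!scalerAr mulr1 -scalerAl.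
Qed.

Lemma el_eps1 : el (@eps _ _ T) 1 = 1.
Proof.
by apply: (@dfun_inj _ _ T) => z; rewrite dfun1 dfun_el //; apply: linf_eps.
Qed.

Lemma el_epsX a e : el (@eps _ _ T) a ^+ e = el (@eps _ _ T) (a ^+ e).
Proof. by elim: e => [|e IH]; rewrite ?expr0 ?el_eps1 // !exprS IH el_epsM. Qed.

Lemma elZ f c a : el f (c *: a) = c *: el f a.
Proof. by apply/ffunP=> p; rewrite !ffunE mulrCA. Qed.

Lemma elD f a b : el f (a + b) = el f a + el f b.
Proof. by apply/ffunP=> p; rewrite !ffunE mulrDr. Qed.

Lemma el_split f a : linf f -> el f a = el f 1 * el (@eps _ _ T) a.
Proof.
move=> lf; apply: (@dfun_inj _ _ T) => z; rewrite dfunM_one // dfun_el //.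
rewrite -(sw_counitr coT z (f := fun z => f z *: a)); last lin.
apply: eq_sw => z1 z2; rewrite dfun_el; last exact: linf_eps.
by rewrite !scalerA mulrC.
Qed.

(** Right multiplication by f (x) 1 precomposes a functional with [rconv f], so products of
    functionals turn into iterated operators on T. *)
Lemma dfunM_conv (F : halg D) (g : halg T -> halg T) f z : lin g -> linf f ->
  (forall z : halg T, dfun F z = eps (g z) *: 1) ->
  dfun (F * el f 1) z = eps (g (rconv f z)) *: 1.
Proof.
move=> lg lf eF; have lG := lin_dfun (T := T) (el f 1); rewrite dfunM /rconv.
have le := @linf_eps _ _ T.
rewrite (lin_sw _ _ (f := fun w => eps (g w) *: 1)); last by apply/lin_scalef/linf_comp.
apply: eq_sw => z1 z2; rewrite eF (linZ (lin_dact _ _ lG)) (dact1 aS SSb) //.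
by rewrite dfun_el // (linZ lg) (linfZ le) scalerA mulrC.
Qed.

Variables chi xi : halg T -> k.
Hypotheses (tr : trirep chi xi (@eps _ _ T)).
Hypotheses (chih : chi h = q^-1) (chix : chi x = 0) (xih : xi h = 0) (xix : xi x = - q^-1).
Let la := tr_la tr.
Let lx := tr_lx tr.

Let hD := el (@eps _ _ T) h.
Let xD := el (@eps _ _ T) x.
Let HD := el chi 1.
Let XD := el xi 1.

Lemma dfun_phi i j (z : halg T) : dfun (HD ^+ i * XD ^+ j) z = phi chi xi i j z *: 1.
Proof.
have it f e := iterD_lin (@lin_rconv _ _ T f) e.
have eH : forall z : halg T, dfun (HD ^+ i) z = eps (iter i (rconv chi) z) *: 1.
  elim: i => [|i IH] y; first by rewrite expr0 dfun1.
  by rewrite exprSr (dfunM_conv (g := iter i (rconv chi))) //= -iterSr.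
move: z; elim: j => [|j IH] z; first by rewrite expr0 mulr1 eH.
rewrite exprSr mulrA (dfunM_conv (g := fun z => iter i (rconv chi) (iter j (rconv xi) z))) //.
  by rewrite /phi -iterSr.
exact: lin_comp.
Qed.

Let hi := smap Sb h : halg T.

(** The skew antipode laws solved at h and at x. *)
Lemma skew_gens : [/\ hi * h = 1, h * hi = 1 & smap Sb x = - (hi * x) :> halg T].
Proof.
have [e1 e2] := Taft_eps coT n2 pres eh ex.
have lS := @lin_smap _ _ T Sb.
have h1 : hi * h = 1.
  by have := sw_skewl coT aS SSb SbS h; rewrite gh ?e1 ?scale1r //; lin.
split=> //.
  by have := sw_skewr coT aS SSb SbS h; rewrite gh ?e1 ?scale1r //; lin.
have := sw_skewl coT aS SSb SbS x; rewrite sx; [|lin|lin].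
by rewrite e2 scale0r mulr1 addrC => /eqP; rewrite addr_eq0 => /eqP.
Qed.

Lemma dact_h (g : halg T -> halg T) z : lin g -> dact Sb z g h = h * g (hi * z * h).
Proof.
move=> lg; have lS := @lin_smap _ _ T Sb.
by rewrite /dact gh; [|lin|lin]; rewrite gh //; lin.
Qed.

Lemma dact_x (g : halg T -> halg T) z : lin g ->
  dact Sb z g x = h * g (hi * z * x) + x * g (hi * z) - g (hi * x * z).
Proof.
move=> lg; have lS := @lin_smap _ _ T Sb; have [_ _ e] := skew_gens.
rewrite /dact sx; [|lin|lin]; rewrite sx; [|lin|lin]; rewrite sw_one; [|lin|lin].
by rewrite mulr1 mul1r mulr1 e -/hi mulNr linN.
Qed.

(** Elements of the double are compared as functions of z. Relations among functionals are tested on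
    monomials of T; mixed ones follow from the explicit cross relations [dact_h] and [dact_x]. *)
Lemma double_rels : @Q_rels k n q 1 (asig (halg D)) [:: hD; xD; HD; XD].
Proof.
have [hn xn xh] := Taft_rel pres; have [e1 e2] := Taft_eps coT n2 pres eh ex.
have [hih hhi ex'] := skew_gens.
have le := @linf_eps _ _ T.
have chihi : chi hi = q.
  have := congr1 chi hih; rewrite (tr_aM tr) (tr_a1 tr) chih => e.
  by rewrite -[LHS]mulr1 -(mulVf q0) mulrA e mul1r.
have xihi : xi hi = 0.
  by have := congr1 xi hih; rewrite (tr_xM tr) xih (tr_x1 tr) e1 mulr0 add0r mulr1.
have injD := @dfun_inj _ _ T.
have oneE f G (z : halg T) : linf f -> dfun (el f 1 * el (@eps _ _ T) G) z = f z *: G.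
  by move=> lf; rewrite -el_split // dfun_el.
apply/Q_relsP; split; first by rewrite el_epsX hn el_eps1.
split.
  apply: injD => z; rewrite -[HD ^+ n]mulr1 -(expr0 XD) dfun_phi dfun1 /phi /=.
  congr (_ *: _); apply: (@Taft_ext _ _ _ _ _ _ _ n2 pres k^o (fun z => eps (iter n (rconv chi) z)) (@eps _ _ T)).
  - exact: (linf_comp le (iterD_lin (@lin_rconv _ _ _ _) n)).
  - exact: le.
  move=> a b _; rewrite (iter_rchi_mono eh ex tr chih chix) linfZ //.
  by rewrite exprM exprVn (prim_expr_order pq) invr1 expr1n mul1r.
split; first by rewrite el_epsX xn; apply/ffunP=> p; rewrite !ffunE mulr0.
split.
  apply: injD => z; rewrite -[XD ^+ n]mul1r -(expr0 HD) dfun_phi.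
  rewrite /phi /= -[in RHS](scale0r 1) dfunZ scale0r -[RHS](scale0r 1); congr (_ *: _).
  apply: (@Taft_ext _ _ _ _ _ _ _ n2 pres k^o (fun z => eps (iter n (rconv xi) z)) (fun=> 0)).
  - exact: (linf_comp le (iterD_lin (@lin_rconv _ _ _ _) n)).
  - exact: lin_cst0.
  by move=> a b bn; rewrite (iter_rxi0 coT eh ex tr chih chix xih xix) // linf0.
split; first by rewrite !el_epsM xh elZ.
split.
  apply: injD => z; rewrite dfunZ.
  have -> : dfun (HD * XD) z = phi chi xi 1 1 z *: 1 by rewrite -dfun_phi !expr1.
  rewrite /phi /=.
  rewrite (dfunM_conv (g := rconv xi)) //; last 2 first.
  - exact: lin_rconv.
  - by move=> y; have := dfun_phi 0 1 y; rewrite expr0 mul1r expr1.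
  rewrite scalerA; congr (_ *: _).
  apply: (@Taft_ext _ _ _ _ _ _ _ n2 pres k^o (fun z => eps (rconv xi (rconv chi z)))
     (fun z => q ^+ n.-1 * eps (rconv chi (rconv xi z)))).
  - exact: (linf_comp le (lin_comp (@lin_rconv _ _ _ _) (@lin_rconv _ _ _ _))).
  - apply: linf_mull; exact: (linf_comp le (lin_comp (@lin_rconv _ _ _ _) (@lin_rconv _ _ _ _))).
  move=> a [|b] bn; rewrite (rchi_mono eh ex tr chih chix) (linZ (@lin_rconv _ _ _ _)).
    rewrite expr0 mulr1 (rxi_hX eh tr xih) (lin0 (@lin_rconv _ _ _ _)) scaler0.
    by rewrite linf0 // mulr0.
  rewrite (rxi_mono coT eh ex tr chih chix xih xix) (linZ (@lin_rconv _ _ _ _)).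
  rewrite (rchi_mono eh ex tr chih chix) !linfZ // addnS exprS.
  have -> : q ^+ n.-1 = q^-1.
    by rewrite -[RHS]mulr1 -(prim_expr_order pq) -(prednK n0) exprS mulKf.
  by rewrite -[LHS]mulrA; congr (_ * _); apply: mulrCA.
split.
  apply: injD => z; rewrite dfunZ oneE // dfunM_eps dact_x; last exact: lin_dfun.
  rewrite !dfun_el // !(tr_aM tr) chix !mulr0 mul0r !scale0r mulr0 add0r subr0.
  by rewrite chihi -scalerAr mulr1 scalerA.
split.
  apply: injD => z; rewrite dfunZ oneE // dfunM_eps dact_h; last exact: lin_dfun.
  rewrite dfun_el // !(tr_xM tr) xih xihi e1 mulr0 add0r mul0r addr0 mulr1.
  by rewrite chihi -scalerAr mulr1 scalerA.
split.
  (* With chi(h^-1) = q and xi(x) = -1/q, the three terms of [dact_x] become -chi(z) h, q xi(z) x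
     and eps(z), which is the relation with parameter 1. *)
  apply: injD => z; rewrite !dfunD !dfunZ !oneE // dfun1 dfunM_eps dact_x; last exact: lin_dfun.
  rewrite !dfun_el // !(tr_xM tr) !(tr_aM tr) xihi xix chihi chix e2.
  rewrite !(mulr0, mul0r, addr0, add0r, mulr1) -!scalerAr !mulr1 !mulrN mulfV // mulrAC mulfV //.
  rewrite mul1r mulN1r !scaleNr opprK !scale1r scalerA.
  by rewrite -addrA addrC -addrA.
apply: injD => z; rewrite oneE // dfunM_eps dact_h; last exact: lin_dfun.
rewrite dfun_el // !(tr_aM tr) mulrAC chihi chih mulfV // mul1r.
by rewrite -scalerAr mulr1.
Qed.

Lemma comul_el f a y b z c : linf f ->
  comul D (el f a) ((y, b), (z, c)) = f (ebas T z * ebas T y) * comul T a (b, c).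
Proof.
move=> lf; rewrite [LHS](comul_DD T Sb) dfun_el //.
by rewrite !comulE mulr_sumr; apply: eq_bigr => l _; rewrite ffunE mulrA.
Qed.

(** A character gives a group-like, and the Leibniz rule of xi gives a skew-primitive. The opposite
    coproduct on the dual puts chi in the second factor, matching X (x) H + 1 (x) X. *)
Lemma double_comul : [/\ comul D hD = tens hD hD, comul D HD = tens HD HD,
  comul D xD = tens xD hD + tens (aone D) xD & comul D XD = tens XD HD + tens (aone D) XD].
Proof.
have le := @linf_eps _ _ T.
have oneE : aone D = el (@eps _ _ T) 1 := esym el_eps1.
split; apply/ffunP=> -[[y b] [z c]]; rewrite comul_el //.
- by rewrite eh epsM !ffunE /= [eps (ebas T z) * _]mulrC mulrACA.
- by rewrite bcomul1 (tr_aM tr) !ffunE /= [chi (ebas T z) * _]mulrC mulrACA.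
- rewrite ex epsM oneE !ffunE /= mulrDr; congr (_ + _);
  by rewrite [eps (ebas T z) * _]mulrC [LHS]mulrACA ?ffunE.
- rewrite bcomul1 (tr_xM tr) oneE !ffunE /= mulrDl; congr (_ + _).
    by rewrite [chi (ebas T z) * _]mulrC [LHS]mulrACA ?ffunE.
  by rewrite [xi (ebas T z) * _]mulrC [LHS]mulrACA ?ffunE.
Qed.

Lemma double_eps : [/\ eps hD = 1, eps HD = 1, eps xD = 0 & eps XD = 0].
Proof.
have [e1 e2] := Taft_eps coT n2 pres eh ex; have le := @linf_eps _ _ T.
have epsE f a : linf f -> eps (el f a) = f 1 * eps a.
  by move=> lf; rewrite [LHS](counit_DD T Sb) dfun_el // linfZ.
by rewrite !epsE // e1 e2 !eps1 (tr_a1 tr) (tr_x1 tr) !mulr1 mulr0.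
Qed.

Section Surjective.
Variables (I : finType) (A : bialgebra k I) (f : halg A -> halg D).
Variables (h' x' H' X' : halg A).
Hypothesis fm : algmor f.
Hypotheses (fh : f h' = hD) (fx : f x' = xD) (fH : f H' = HD) (fX : f X' = XD).
Let im (F : halg D) := exists u, f u = F.

Let imD F G : im F -> im G -> im (F + G).
Proof. by move=> [u <-] [v <-]; exists (u + v); rewrite (linD (algmor_lin fm)). Qed.
Let imZ c F : im F -> im (c *: F).
Proof. by move=> [u <-]; exists (c *: u); rewrite (linZ (algmor_lin fm)). Qed.
Let imM F G : im F -> im G -> im (F * G).
Proof. by move=> [u <-] [v <-]; exists (u * v); case: fm => _ ->. Qed.

Lemma im_eps a : im (el (@eps _ _ T) a).
Proof.
elim: (Taft_cl pres a) => {a} [|a b _ IH _ IH'|c a _ IH|g a gg _ IH].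
- by exists 1; case: fm => _ _ ->; rewrite el_eps1.
- by rewrite elD; apply: imD.
- by rewrite elZ; apply: imZ.
- rewrite -el_epsM; apply: imM => //; move: gg; rewrite !inE => /orP[] /eqP->.
    by exists h'.
  by exists x'.
Qed.

Lemma im_functional g : linf g -> im (el g 1).
Proof.
move=> lg; have [d ed] := functional_phi coT n2 pq pres eh ex tr chih chix xih xix lg.
have -> : el g 1 = \sum_(i < n) \sum_(j < n) d i j *: (HD ^+ i * XD ^+ j).
  apply: (@dfun_inj _ _ T) => z; rewrite dfun_el // ed.
  have dfS (E : finType) (F : E -> halg D) : dfun (\sum_e F e) z = \sum_e dfun (F e) z.
    apply: (big_morph (fun F : halg D => dfun F z)) => [F1 F2|]; first exact: dfunD.
    by rewrite -(scale0r 1) dfunZ scale0r.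
  rewrite dfS scaler_suml; apply: eq_bigr => i _.
  rewrite dfS scaler_suml; apply: eq_bigr => j _.
  by rewrite dfunZ dfun_phi scalerA.
have im0 : im 0 by exists 0; rewrite (lin0 (algmor_lin fm)).
apply: (big_ind im) => // i _; apply: (big_ind im) => // j _; apply/imZ.
have [_ fM _] := fm.
by exists (H' ^+ i * X' ^+ j); rewrite fM !(algmorX _ _ fm) fH fX.
Qed.

(** A basis element factors as (e^i (x) 1)(eps (x) e_j): the first factor is a polynomial in H and
    X, the second comes from h and x. *)
Lemma im_ebas p : im (ebas D p).
Proof.
have -> : ebas D p = el (fun z => z p.1) (ebas T p.2).
  apply/ffunP=> r; rewrite !ffunE [r.1 == _]eq_sym -natrM mulnb.
  by case: p r => p1 p2 [r1 r2].
rewrite el_split; last exact: linf_coord.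
by apply: imM; [apply: im_functional; exact: linf_coord | exact: im_eps].
Qed.
End Surjective.

Lemma Q_iso_double (I : finType) (A : bialgebra k I) (h' x' H' X' : halg A) :
  presents A [:: h'; x'; H'; X'] (@Q_rels k n q 1) -> hopfgens h' x' H' X' ->
  HopfIso A D.
Proof.
move=> pA [coA g1 g2 s1 s2 h0 H0].
have [|f [fm [fh fx fH fX]]] := presents_mor pA _ double_rels; first by [].
have [c1 c2 c3 c4] := double_comul; have [d1 d2 d3 d4] := double_eps.
have [_ /generates_cl GA _] := pA.
apply: (HopfIso_mor fm GA); rewrite ?fh ?fx ?fH ?fX //.
(* The source has dimension at most n^4, the double at least n^4. *)
- apply: (surj_bij (algmor_lin fm) (im_ebas fm fh fx fH fX)).
  rewrite card_prod (leq_trans (Q_card n0 q0 pA)) // leq_mul //;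
  exact: (Taft_card coT n2 pq pres eh ex tr chih chix xih xix).
- exact: grouplikeP.
- exact: grouplikeP.
- exact: skewprimP.
- exact: skewprimP.
- by rewrite d1 eps_grouplike.
- by rewrite d2 eps_grouplike.
- by rewrite d3 (eps_skewprim coA h0 s1).
- by rewrite d4 (eps_skewprim coA H0 s2).
Qed.
End DoubleTaft.

Theorem theorem2p3 (k : fieldType) (m n : nat) (q qb : k) :
  [pchar k] =i pred0 ->
  (2 <= m)%N -> (2 <= n)%N ->
  m.-primitive_root q -> n.-primitive_root qb ->
  (* (1) *)
  ((n != m) \/ (qb != q) ->
   forall s s' : k, s ^+ gcdn m n = 1 -> s' ^+ gcdn m n = 1 ->
   forall (I J : finType) (A : bialg k I) (B : bialg k J),
     is_T A n m qb q s -> is_T B n m qb q s' ->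
     (HopfIso A B <-> s = s'))
  /\
  (* (2) *)
  (m = n -> qb = q ->
   forall s s' : k, s ^+ n = 1 -> s' ^+ n = 1 ->
   forall (I J : finType) (A : bialg k I) (B : bialg k J),
     is_T A n n q q s -> is_T B n n q q s' ->
     (HopfIso A B <-> s' = s \/ s' = s^-1))
  /\
  (* (3) *)
  (m = n ->
   (forall alpha : k, alpha != 0 ->
    forall (I J : finType) (A : bialg k I) (B : bialg k J),
      is_Q A n q alpha -> is_Q B n q 1 -> HopfIso A B)
   /\
   (forall (I J : finType) (A : bialg k I) (T : bialg k J)
           (S Sb : J -> J -> k),
      is_Q A n q 1 -> is_Taft T n q ->
      is_antipode T S ->
      (forall i l, \sum_u S i u * Sb u l = (i == l)%:R) ->
      (forall i l, \sum_u Sb i u * S u l = (i == l)%:R) ->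
      HopfIso A (DD T Sb)))
  /\
  (* (4) *)
  (m = n ->
   forall s : k, s ^+ n = 1 ->
   forall (I J : finType) (A : bialg k I) (B : bialg k J),
     is_Q A n q 1 -> is_T B n n (q ^+ n.-1) q s -> ~ HopfIso A B).
Proof.
move=> _ m2 n2 pq pqb; have [m0 n0] := (ltnW m2, ltnW n2).
split; [|split; [|split]].
- move=> neq s s' sd sd' I J A B TA TB.
  have expd (z : k) e : z ^+ gcdn m n = 1 -> (gcdn m n %| e)%N -> z ^+ e = 1.
    by move=> zd /dvdnP[c ->]; rewrite mulnC exprM zd expr1n.
  split=> [iso | ss]; last by rewrite -ss in TB; apply: T_iso_refl TA TB.
  have [] := T_mor m2 n2 pq pqb (expd _ _ sd (dvdn_gcdl _ _)) (expd _ _ sd (dvdn_gcdr _ _))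
    (expd _ _ sd' (dvdn_gcdl _ _)) (expd _ _ sd' (dvdn_gcdr _ _)) TA TB iso => // -[qq _].
  (* In the swap case q = qb is primitive of both orders, so m and n divide each other, against the
     assumption of this part. *)
  have mn : m = n.
    apply/eqP; rewrite eqn_dvd (prim_order_dvd pq) (prim_order_dvd pqb) qq.
    by rewrite (prim_expr_order pqb) -qq (prim_expr_order pq) eqxx.
  by case: neq => /eqP [].
- move=> mn qq s s' sn sn' I J A B TA TB; rewrite mn in pq.
  split=> [iso | [] e].
  + by case: (T_mor n2 n2 pq pq sn sn sn' sn' TA TB iso) => [->|[_ ->]]; [left | right].
  + by rewrite e in TB; apply: T_iso_refl TA TB.
  + by rewrite e in TB; apply: T_iso_flip TA TB.
- move=> mn; rewrite mn in pq; split=> [a a0 I J A B QA QB|].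
    exact: Q_iso_scale a0 QA QB.
  move=> I J A T S Sb /(is_Q_gens n0)[A' [h' [x' [H' [X' [<- pA dA]]]]]].
  move=> [hT [h [x [pT eh ex]]]] aS SSb SbS.
  have coT := coalgebra_hopf hT.
  have [chi [xi [tr e1 e2 e3 e4]]] := Taft_functionals (T := bialg_of_hopf hT) coT n2 pq pT eh ex.
  exact: (Q_iso_double (T := bialg_of_hopf hT) coT aS SSb SbS n2 pq pT eh ex tr e1 e2 e3 e4 pA dA).
- by move=> mn s sn I J A B; apply: Q_not_T => //; rewrite -mn in n2 *; rewrite mn in pq *.
Qed.
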